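(* For every $\mu\in\mathbb{Z}$, the pairing of the $K_0$-class of the projector $E_\mu$ and the cyclic cohomology class of the cyclic 2-cocycle $\phi_{S^2}$ (fundamental class) is equal to minus the winding number $\mu$ of the line bundle $L_\mu$: $$\langle[E_\mu],[\phi_{S^2}]\rangle=\frac{1}{2\pi i}\int_{S^2}\mathrm{Tr}(E_\mu\,\mathrm{d}E_\mu\wedge\mathrm{d}E_\mu)=\int_{S^2}c_1(L_\mu)=-\mu.$$
   Context: $S^3=\{(a,c)\in\mathbb{C}^2\mid|a|^2+|c|^2=1\}$ is identified with $SU(2)$ via $(a,c)\mapsto\begin{pmatrix}a&-\bar c\\c&\bar a\end{pmatrix}$; $\alpha,\gamma$ are the coordinate functions $\alpha(a,c)=a$, $\gamma(a,c)=c$, and $\alpha^*,\gamma^*$ their complex conjugates. $U(1)$ acts on the right by $(a,c)e^{i\phi}=(ae^{i\phi},ce^{i\phi})$. The quotient is $S^2\subset\mathbb{R}^3$ with coordinates $x_1,x_2,x_3$, where the Hopf projection $\pi:S^3\to S^2$ is given by $\pi^*(x_1+ix_2)=2\alpha^*\gamma$, $\pi^*(x_3)=\alpha^*\alpha-\gamma^*\gamma$; functions on $S^2$ are identified with $U(1)$-invariant functions on $S^3$. $S^2$ is oriented by the outward-pointing normal vector. $L_\mu$ is the complex line bundle associated to the Hopf fibration by the representation $e^{i\phi}\mapsto e^{i\mu\phi}$ of $U(1)$, i.e. $L_\mu=(S^3\times\mathbb{C})/U(1)$ for the right action $(x,z)g=(xg,g^{-\mu}z)$; its sections correspond to functions $f$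 on $S^3$ with $f(xg)=g^{-\mu}f(x)$. The integer $\mu$ is called the winding number of $L_\mu$. The projector $E_\mu$: with entries indexed by $k=0,\ldots,|\mu|$, define column vectors $\tilde v_\mu,\tilde w_\mu$ by: for $\mu\le0$, $(\tilde v_\mu)_k=\binom{-\mu}{k}(\alpha^* )^{-\mu-k}(\gamma^* )^k$, $(\tilde w_\mu)_k=\alpha^{-\mu-k}\gamma^k$; for $\mu\ge0$, $(\tilde v_\mu)_k=\binom{\mu}{k}\alpha^{\mu-k}\gamma^k$, $(\tilde w_\mu)_k=(\alpha^* )^{\mu-k}(\gamma^* )^k$. Let $\tilde E_\mu=\tilde w_\mu\tilde v_\mu^\top$, $A_\mu=\mathrm{diag}\big(\sqrt{\tbinom{|\mu|}{k}}\big)_{k=0}^{|\mu|}$ and $E_\mu:=A_\mu\tilde E_\mu A_\mu^{-1}$, a hermitian idempotent $(|\mu|+1)\times(|\mu|+1)$-matrix with entries smooth functions on $S^2$. The cyclic 2-cocycle is $\phi_{S^2}(f_0,f_1,f_2):=\frac{1}{2\pi i}\int_{S^2}f_0\,\mathrm{d}f_1\wedge\mathrm{d}f_2$, and its pairing with the class of an idempotent matrix $e=(e_{ij})$ of smooth functions is $\sum_{i,j,k}\phi_{S^2}(e_{ij},e_{jk},e_{ki})$. The first Chern class of a complex line bundle $L$ is the de Rham class of $c_1(\nabla)=-\frac{1}{2\pi i}\mathrm{Tr}\,\nabla^2$ for any connection $\nabla$ on $L$, where $\nabla^2$ is its curvature. *)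

(* Defs.v *)
From HB Require Import structures.
From mathcomp Require Import all_boot all_order all_algebra.
From mathcomp Require Import all_classical all_reals all_analysis.
From mathcomp Require Import complex ring lra.

Set Implicit Arguments.
Unset Strict Implicit.
Unset Printing Implicit Defensive.

Import Order.TTheory GRing.Theory Num.Theory.
Import numFieldNormedType.Exports.

Local Open Scope classical_set_scope.
Local Open Scope ring_scope.
Local Open Scope complex_scope.

Section Spheres.
Variable R : realType.
Local Notation C := R[i].

(* The library norm on 'rV[R]_n is the sup norm, hence this explicit          *)
(* Euclidean inner product.                                                   *)
Definition dot (n : nat) (u v : 'rV[R]_n) : R := \sum_(i < n) u 0 i * v 0 i.

Definition row3 (a b c : R) : 'rV[R]_3 := \row_(i < 3) [:: a; b; c]`_i.

Lemma dot_row3 (a b c : R) :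
  dot (row3 a b c) (row3 a b c) = a ^+ 2 + b ^+ 2 + c ^+ 2.
Proof. by rewrite /dot !big_ord_recl big_ord0 !mxE /= addr0 addrA !expr2. Qed.

Definition S2 := {x : 'rV[R]_3 | dot x x == 1}.
Definition S3 := {p : C * C | `|p.1| ^+ 2 + `|p.2| ^+ 2 == 1}.
Definition U1 := {g : C | `|g| == 1}.

Definition alpha (p : S3) : C := (val p).1.
Definition gamma (p : S3) : C := (val p).2.

Definition S3_coord (p : S3) : 'rV[R]_4 :=
  \row_(i < 4) [:: complex.Re (alpha p); complex.Im (alpha p);
                   complex.Re (gamma p); complex.Im (gamma p)]`_i.

Lemma S3_conj (p : S3) :
  alpha p * (alpha p)^* + gamma p * (gamma p)^* = 1.
Proof. by have /eqP := valP p; rewrite !sqr_normc. Qed.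

Lemma act_subproof (p : S3) (g : U1) :
  `|alpha p * val g| ^+ 2 + `|gamma p * val g| ^+ 2 == 1.
Proof. by rewrite !normrM (eqP (valP g)) !mulr1; exact: (valP p). Qed.

Definition act (p : S3) (g : U1) : S3 :=
  exist (fun p : C * C => `|p.1| ^+ 2 + `|p.2| ^+ 2 == 1)
    (alpha p * val g, gamma p * val g) (act_subproof p g).

Definition hopf_row (p : S3) : 'rV[R]_3 :=
  let z := 2 * (alpha p)^* * gamma p in
  row3 (complex.Re z) (complex.Im z)
    (complex.Re ((alpha p)^* * alpha p - (gamma p)^* * gamma p)).

Lemma hopf_subproof (p : S3) : dot (hopf_row p) (hopf_row p) == 1.
Proof.
rewrite dot_row3; have := S3_conj p; rewrite /alpha /gamma.
case: p => [[[a b] [c d]] /= _] [h _].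
apply/eqP; transitivity ((a * a - b * - b + (c * c - d * - d)) ^+ 2); first ring.
by rewrite h expr1n.
Qed.

Definition hopf (p : S3) : S2 :=
  exist (fun x : 'rV[R]_3 => dot x x == 1) (hopf_row p) (hopf_subproof p).

Lemma north_subproof : dot (row3 0 0 1) (row3 0 0 1) == 1.
Proof. by rewrite dot_row3 !expr0n /= !add0r expr1n. Qed.

Definition north : S2 :=
  exist (fun x : 'rV[R]_3 => dot x x == 1) (row3 0 0 1) north_subproof.

Lemma one_S3_subproof : `|1 : C| ^+ 2 + `|0 : C| ^+ 2 == 1.
Proof. by rewrite normr1 normr0 expr1n expr0n addr0. Qed.

Definition one_S3 : S3 :=
  exist (fun p : C * C => `|p.1| ^+ 2 + `|p.2| ^+ 2 == 1) (1, 0)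
    one_S3_subproof.

(* A function on S^2 from a U(1)-invariant function on S^3: evaluate on a     *)
(* chosen point of the fibre; see [descendE].                                 *)
Definition descend (T : Type) (f : S3 -> T) (x : S2) : T :=
  f (xget one_S3 [set p | hopf p = x]).

Lemma hopf_fibre (p q : S3) : hopf p = hopf q -> exists g, q = act p g.
Proof.
move=> /(congr1 val) /= /rowP e.
have := e ord_max; have := e 1; have := e 0; rewrite !mxE /=.
have := S3_conj q; have := S3_conj p.
case: p {e} => [[a c] /= hp]; case: q => [[a' c'] /= hq].
rewrite /alpha /gamma /= => sp sq e0 e1 e2.
have ez : a^* * c = a'^* * c'.
  apply: (@mulfI _ (2 : C)); first by rewrite pnatr_eq0.
  by rewrite !mulrA; apply/eqP; rewrite eq_complex e0 e1 !eqxx.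
have ew : a^* * a - c^* * c = a'^* * a' - c'^* * c'.
  apply/eqP; rewrite eq_complex e2 eqxx /=.
  by case: a c a' c' {hp hq sp sq e0 e1 e2 ez} => [? ?] [? ?] [? ?] [? ?] /=;
    apply/eqP; ring.
have ea : a * a^* = a' * a'^*.
  apply: (@mulfI _ (2 : C)); first by rewrite pnatr_eq0.
  have -> : 2 * (a * a^*) = (a * a^* + c * c^*) + (a^* * a - c^* * c) by ring.
  by rewrite sp ew -[X in X + _]sq; ring.
have ec : c * c^* = c' * c'^*.
  by have := sp; rewrite ea -sq => /addrI.
pose g := a^* * a' + c^* * c'.
have ga : a * g = a'.
  have ez' : a * c^* = a' * c'^*.
    by have := congr1 (@conjc R) ez; rewrite !rmorphM /= !conjcK.
  rewrite /g mulrDr !mulrA ea ez' -[RHS]mulr1 -sq; ring.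
have gc : c * g = c'.
  rewrite /g mulrDr !mulrA ec [c * a^*]mulrC ez -[RHS]mulr1 -sq; ring.
have hg : `|g| == 1.
  rewrite -(@eqrXn2 _ 2) ?normr_ge0 // expr1n.
  have /eqP := hq; rewrite -ga -gc !normrM !exprMn -mulrDl.
  by rewrite (eqP hp) mul1r => ->.
exists (exist (fun g : C => `|g| == 1) g hg).
by apply: val_inj; rewrite /= /alpha /gamma /= ga gc.
Qed.

Lemma descendE (T : Type) (f : S3 -> T) :
  (forall p g, f (act p g) = f p) -> forall p, descend f (hopf p) = f p.
Proof.
move=> finv p; rewrite /descend.
have /hopf_fibre[g ->] : hopf p = hopf (xget one_S3 [set q | hopf q = hopf p]).
  by case: xgetP => [q _ /= ->//|/(_ p) /(_ erefl)].
exact: finv.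
Qed.

End Spheres.

Section Smoothness.
Variable R : realType.

Definition iter_partial (n : nat) (s : seq 'I_n) (F : 'rV[R]_n -> R) :
  'rV[R]_n -> R := foldr (fun i G => 'D_(delta_mx 0 i) G) F s.

Definition smooth_on (n : nat) (U : set 'rV[R]_n) (F : 'rV[R]_n -> R) : Prop :=
  forall (s : seq 'I_n) x, U x ->
    {for x, continuous (iter_partial s F)} /\
    forall i, derivable (iter_partial s F) x (delta_mx 0 i).

(* Smoothness on the closed submanifold emb(M) of R^n: local extendability to *)
(* smooth functions on open subsets of R^n.                                   *)
Definition smooth_sub (M : Type) (n : nat) (emb : M -> 'rV[R]_n) (f : M -> R) :
  Prop :=
  forall m, exists U F, [/\ open U, U (emb m), smooth_on U F &
    forall m', U (emb m') -> F (emb m') = f m'].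

Definition smooth_subC (M : Type) (n : nat) (emb : M -> 'rV[R]_n)
  (f : M -> R[i]) : Prop :=
  smooth_sub emb (fun m => complex.Re (f m)) /\
  smooth_sub emb (fun m => complex.Im (f m)).

End Smoothness.

Section CalculusOnS2.
Variable R : realType.
Local Notation C := R[i].
Local Notation S2 := (S2 R).
Local Notation R3 := 'rV[R]_3.

(* Radial projection of R^3 minus the origin onto S^2; junk at the origin.    *)
Definition to_S2 (v : R3) : S2 :=
  insubd (north R) ((Num.sqrt (dot v v))^-1 *: v).

Definition tangent (x : S2) (u : R3) : Prop := dot (val x) u = 0.

(* df_x(u), differentiating along the curve t |-> (x + t u) / |x + t u|; only *)
(* meaningful for u tangent at x.                                             *)
Definition dR_S2 (f : S2 -> R) (x : S2) (u : R3) : R :=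
  derive1 (fun t : R => f (to_S2 (val x + t *: u))) 0.

Definition d_S2 (f : S2 -> C) (x : S2) (u : R3) : C :=
  dR_S2 (fun y => complex.Re (f y)) x u +i*
  dR_S2 (fun y => complex.Im (f y)) x u.

Definition smooth_S2 (f : S2 -> C) : Prop := smooth_subC (fun x : S2 => val x) f.

Definition vector_field (X : S2 -> R3) : Prop :=
  (forall x, tangent x (X x)) /\
  forall i, smooth_sub (fun x : S2 => val x) (fun x => X x 0 i).

(* Componentwise commutator in R^3; it is again tangent to S^2.               *)
Definition lie_bracket (X Y : S2 -> R3) (x : S2) : R3 :=
  \row_i (dR_S2 (fun y => Y y 0 i) x (X x) - dR_S2 (fun y => X y 0 i) x (Y x)).

(* Complex-valued differential forms on S^2, as functions of a point and of   *)
(* vectors of R^3 of which only the values on tangent vectors are relevant.   *)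
Definition form1 : Type := S2 -> R3 -> C.
Definition form2 : Type := S2 -> R3 -> R3 -> C.

Definition smooth_form1 (eta : form1) : Prop :=
  (forall x (a : R) u v, tangent x u -> tangent x v ->
     eta x (a *: u + v) = a%:C * eta x u + eta x v) /\
  (forall X, vector_field X -> smooth_S2 (fun x => eta x (X x))).

Definition wedge (eta theta : form1) : form2 :=
  fun x u v => eta x u * theta x v - eta x v * theta x u.

(* omega = omega' + d eta for some smooth eta.                                *)
Definition cohomologous (omega omega' : form2) : Prop :=
  exists2 eta : form1, smooth_form1 eta &
    forall X Y x, vector_field X -> vector_field Y ->
      omega x (X x) (Y x) = omega' x (X x) (Y x) +
        (d_S2 (fun y => eta y (Y y)) x (X x)
         - d_S2 (fun y => eta y (X y)) x (Y x)
         - eta x (lie_bracket X Y x)).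

Lemma chart_subproof (t p : R) :
  let v := row3 (sin t * cos p) (sin t * sin p) (cos t) in dot v v == 1.
Proof.
rewrite /= dot_row3 !exprMn -mulrDr cos2Dsin2 mulr1.
by rewrite addrC cos2Dsin2.
Qed.

(* Spherical coordinates: colatitude t in [0, pi], longitude p in [0, 2 pi].  *)
Definition chart (t p : R) : S2 :=
  exist (fun x : R3 => dot x x == 1)
    (row3 (sin t * cos p) (sin t * sin p) (cos t)) (chart_subproof t p).

Definition chart_pullback (omega : form2) (t p : R) : C :=
  omega (chart t p) (derive1 (fun t' : R => val (chart t' p)) t)
                    (derive1 (fun p' : R => val (chart t p')) p).

(* (t, p) is positively oriented for the outward normal of S^2, and the chart *)
(* is injective with dense, full-measure image on the open rectangle.         *)
Definition int_S2 (omega : form2) : C :=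
  (\int[lebesgue_measure]_(t in `[0, pi])
     \int[lebesgue_measure]_(p in `[0, 2 * pi])
       complex.Re (chart_pullback omega t p)) +i*
  (\int[lebesgue_measure]_(t in `[0, pi])
     \int[lebesgue_measure]_(p in `[0, 2 * pi])
       complex.Im (chart_pullback omega t p)).

Definition two_pi_i : C := 2 * (pi : R)%:C * 'i.

Definition phi_S2 (f0 f1 f2 : S2 -> C) : C :=
  two_pi_i^-1 *
  int_S2 (fun x u v => f0 x * wedge (d_S2 f1) (d_S2 f2) x u v).

Definition pairing (n : nat) (e : S2 -> 'M[C]_n)
  (phi : (S2 -> C) -> (S2 -> C) -> (S2 -> C) -> C) : C :=
  \sum_(i < n) \sum_(j < n) \sum_(k < n)
    phi (fun x => e x i j) (fun x => e x j k) (fun x => e x k i).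

Definition d_mx (n : nat) (e : S2 -> 'M[C]_n) (x : S2) (u : R3) : 'M[C]_n :=
  \matrix_(i < n, j < n) d_S2 (fun y => e y i j) x u.

(* Tr (e de /\ de)                                                            *)
Definition tr_e_de_de (n : nat) (e : S2 -> 'M[C]_n) : form2 :=
  fun x u v =>
    \tr (e x *m (d_mx e x u *m d_mx e x v - d_mx e x v *m d_mx e x u)).

End CalculusOnS2.

Section Projector.
Variable R : realType.
Local Notation C := R[i].
Local Notation S3 := (S3 R).
Variable mu : int.
Local Notation n := `|mu|%N.

Definition v_tilde (p : S3) : 'cV[C]_n.+1 :=
  \col_(k < n.+1)
    if mu <= 0 then 'C(n, k)%:R * (alpha p)^* ^+ (n - k) * (gamma p)^* ^+ k
    else 'C(n, k)%:R * alpha p ^+ (n - k) * gamma p ^+ k.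

Definition w_tilde (p : S3) : 'cV[C]_n.+1 :=
  \col_(k < n.+1)
    if mu <= 0 then alpha p ^+ (n - k) * gamma p ^+ k
    else (alpha p)^* ^+ (n - k) * (gamma p)^* ^+ k.

Definition A_mx : 'M[C]_n.+1 :=
  diag_mx (\row_(k < n.+1) (Num.sqrt ('C(n, k)%:R : R))%:C).

Definition E_S3 (p : S3) : 'M[C]_n.+1 :=
  A_mx *m (w_tilde p *m (v_tilde p)^T) *m invmx A_mx.

Lemma E_S3_invariant (p : S3) (g : U1 R) : E_S3 (act p g) = E_S3 p.
Proof.
have gg : val g * (val g)^* = 1.
  by rewrite -sqr_normc (eqP (valP g)) expr1n.
have Ea : alpha (act p g) = alpha p * val g by [].
have Eg : gamma (act p g) = gamma p * val g by [].
have h (x y : C) (k l : 'I_n.+1) : x * y = 1 ->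
    x ^+ (n - k) * x ^+ k * (y ^+ (n - l) * y ^+ l) = 1.
  move=> xy; have E2 (z : C) (m : 'I_n.+1) : z ^+ (n - m) * z ^+ m = z ^+ n.
    by rewrite -exprD (subnK (leq_ord m)).
  by rewrite !E2 -exprMn xy expr1n.
have K (a b x y c d z t k : C) : x * y * (z * t) = 1 ->
    a * x * (b * y) * (k * (c * z) * (d * t)) = a * b * (k * c * d).
  by move=> e; rewrite -[RHS]mulr1 -[X in _ = _ * X]e; ring.
suff e : w_tilde (act p g) *m (v_tilde (act p g))^T
         = w_tilde p *m (v_tilde p)^T by rewrite /E_S3 e.
apply/matrixP => i j; rewrite !mxE !big_ord1 !mxE Ea Eg !rmorphM /= !exprMn.
case: ifP => _; apply: K; first exact: (h _ _ i j gg).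
by apply: (h _ _ i j); rewrite mulrC; exact: gg.
Qed.

Definition E (x : S2 R) : 'M[C]_n.+1 := descend E_S3 x.

End Projector.

Section ChernClass.
Variable R : realType.
Local Notation C := R[i].
Local Notation S2 := (S2 R).
Local Notation S3 := (S3 R).
Local Notation R3 := 'rV[R]_3.
Variable mu : int.

(* Smooth sections of L_mu, as equivariant functions on S^3.                  *)
Definition is_section (s : S3 -> C) : Prop :=
  smooth_subC (@S3_coord R) s /\
  forall p g, s (act p g) = val g ^ (- mu) * s p.

(* nabla s, for a section s, is an L_mu-valued 1-form on S^2: for p above x   *)
(* and u tangent to S^2 at x, (nabla s) p u is the equivariant representative *)
(* of the covariant derivative of s along u.                                  *)
Definition cov_deriv : Type := (S3 -> C) -> S3 -> R3 -> C.

Definition nabla_along (nabla : cov_deriv) (X : S2 -> R3) (s : S3 -> C) :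
  S3 -> C := fun p => nabla s p (X (hopf p)).

Record is_connection (nabla : cov_deriv) : Prop := {
  connection_section : forall X s, vector_field X -> is_section s ->
    is_section (nabla_along nabla X s);
  connection_linear : forall s p (a : R) u v, is_section s ->
    tangent (hopf p) u -> tangent (hopf p) v ->
    nabla s p (a *: u + v) = a%:C * nabla s p u + nabla s p v;
  connection_add : forall s s' p u, is_section s -> is_section s' ->
    tangent (hopf p) u ->
    nabla (fun q => s q + s' q) p u = nabla s p u + nabla s' p u;
  connection_leibniz : forall f s p u, smooth_S2 f -> is_section s ->
    tangent (hopf p) u ->
    nabla (fun q => f (hopf q) * s q) p u =
      d_S2 f (hopf p) u * s p + f (hopf p) * nabla s p u }.

(* Tr nabla^2: the curvature nabla^2(X, Y) = [nabla_X, nabla_Y] - nabla_[X,Y] *)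
(* is an endomorphism of each fibre of the line bundle, and its trace is the  *)
(* scalar by which it acts.                                                   *)
Definition tr_curvature (nabla : cov_deriv) : form2 R := fun x u v =>
  xget 0 [set z : C | forall X Y s p,
    vector_field X -> vector_field Y -> is_section s ->
    hopf p = x -> X x = u -> Y x = v ->
    nabla_along nabla X (nabla_along nabla Y s) p
    - nabla_along nabla Y (nabla_along nabla X s) p
    - nabla_along nabla (lie_bracket X Y) s p = z * s p].

Definition c1_form (nabla : cov_deriv) : form2 R :=
  fun x u v => - (two_pi_i R)^-1 * tr_curvature nabla x u v.

(* The de Rham class c_1(L_mu), as the set of its representatives.            *)
Definition c1 : set (form2 R) :=
  [set omega | exists2 nabla, is_connection nabla &
                              cohomologous omega (c1_form nabla)].

End ChernClass.

(* Main.v *)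
Require Import Defs.
From HB Require Import structures.
From mathcomp Require Import all_boot all_order all_algebra.
From mathcomp Require Import all_classical all_reals all_analysis.
From mathcomp Require Import complex ring lra.

Set Implicit Arguments.
Unset Strict Implicit.
Unset Printing Implicit Defensive.

Import Order.TTheory GRing.Theory Num.Theory.
Import numFieldNormedType.Exports.

Local Open Scope classical_set_scope.
Local Open Scope ring_scope.
Local Open Scope complex_scope.

(** Chern-Weil theory for a frame. Let n = |mu| and let W_k (0 <= k <= n) be
    the monomials of degree n in alpha, gamma (or in their conjugates,
    according to the sign of mu), scaled by the square root of the binomial
    coefficient. The W_k are sections of L_mu, the binomial theorem gives
    sum_k |W_k|^2 = 1, and E_mu has entries W_i W_j^* ([E_projector]). Hence a
    section s is sum_k f_k W_k with f_k = W_k^* s a function on S^2, and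
    s |-> sum_k df_k W_k is a connection on L_mu ([grassmann]). Its curvature
    is - Tr (E [dE(X), dE(Y)]) ([grassmann_curvature]), because E dE E = 0 and
    because the bracket of vector fields is the commutator of derivations.

    An arbitrary connection differs from this one by a smooth 1-form a on S^2
    ([connectionE]), which changes the curvature by da. So each representative
    of c_1(L_mu) is (2 pi i)^-1 Tr (E dE /\ dE) plus an exact form
    ([c1_representative]). In spherical coordinates an exact form is the
    divergence of a pair of functions, the first zero at both poles and the
    second periodic in the longitude, so its integral vanishes
    ([stokes_S2]).

    It remains to integrate Tr (E dE /\ dE). Rotation by the longitude p acts
    on E by conjugation with a diagonal matrix, so that dE/dp = c [D, E] with
    D = diag(0, ..., n) and c = i or - i. For an idempotent E this turns the
    trace into c Tr (D dE/dt) ([trace_commutator]), the derivative of the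
    moment map c Tr (D E), and Tr (D E) = n sin^2 (t / 2) is the mean of a
    binomial distribution ([grading_moment]). The integrand is therefore
    - (mu i / 2) sin t, whose integral is - 2 pi i mu.

    The calculus on S^2 is done on R^3 minus the origin: a function on the
    sphere is replaced by its extension that is constant along rays
    ([homogeneous_ext]). *)

(** * Differential calculus in several variables *)

Section Calculus.
Variable R : realType.

Lemma continuous_rowP (T : topologicalType) n (M : T -> 'rV[R]_n) (x : T) :
  (forall i, {for x, continuous (fun y => M y 0 i)}) -> {for x, continuous M}.
Proof.
move=> cM; apply/cvgrPdist_le => /= e e0; near=> y.
rewrite /Num.Def.normr/= mx_normrE (bigmax_le _ (ltW e0))//= => -[i j] _.
rewrite !mxE/= ord1; move: j; near: y; apply: filter_forall => j.
exact: ((cvgrPdist_le _ _).1 (cM j)).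
Unshelve. all: by end_near. Qed.

Lemma is_derive_line (V W : normedModType R) (F : V -> W) x v s :
  derivable F (x + s *: v) v ->
  is_derive s (1 : R) (fun t : R => F (x + t *: v)) ('D_v F (x + s *: v)).
Proof.
have E : (fun h : R => h^-1 *: (((fun t : R => F (x + t *: v)) \o shift s) (h *: 1)
      - F (x + s *: v)))
    = (fun h : R => h^-1 *: ((F \o shift (x + s *: v)) (h *: v) - F (x + s *: v))).
  by apply/funext => h /=; rewrite [_%:A]mulr1 scalerDl addrCA.
by move=> dF; split; rewrite /derivable /derive /= E.
Qed.

Lemma MVT_line (V : normedModType R) (F : V -> R) (x v : V) (h : R) :
  (forall s : R, `|s| <= `|h| -> derivable F (x + s *: v) v) ->
  exists2 c : R, `|c| <= `|h| & F (x + h *: v) - F x = 'D_v F (x + c *: v) * h.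
Proof.
move=> dF; pose g (t : R) := F (x + t *: v).
have dg (s : R) : `|s| <= `|h| -> is_derive s (1 : R) g ('D_v F (x + s *: v)).
  by move=> sh; apply/is_derive_line/dF.
have g0 : g 0 = F x by rewrite /g scale0r addr0.
rewrite -g0 -/(g h).
have [h0|h0] := leP 0 h.
- have hs (s : R) : s \in `[0, h]%R -> `|s| <= `|h|.
    by rewrite in_itv /= => /andP[s0 sh]; rewrite !ger0_norm.
  have dh s : s \in `]0, h[%R -> is_derive s 1 g ('D_v F (x + s *: v)).
    by move=> /subset_itv_oo_cc /hs /dg.
  have ch : {within `[0, h], continuous g}.
    by apply: derivable_within_continuous => s /hs /dg; case.
  have [c /hs chh ->] := MVT_segment h0 dh ch.
  by exists c => //; rewrite subr0.
- have hs (s : R) : s \in `[h, 0]%R -> `|s| <= `|h|.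
    rewrite in_itv /= => /andP[s0 sh].
    by rewrite !ler0_norm ?lerN2 // ltW.
  have dh s : s \in `]h, 0[%R -> is_derive s 1 g ('D_v F (x + s *: v)).
    by move=> /subset_itv_oo_cc /hs /dg.
  have ch : {within `[h, 0], continuous g}.
    by apply: derivable_within_continuous => s /hs /dg; case.
  have [c /hs chh E] := MVT_segment (ltW h0) dh ch.
  by exists c => //; rewrite -opprB E; ring.
Qed.

Lemma normr_coord n (h : 'rV[R]_n) i : `|h 0 i| <= `|h|.
Proof.
rewrite [leRHS]/Num.Def.normr /= mx_normrE.
exact: (le_bigmax _ (fun ij : 'I_1 * 'I_n => `|h ij.1 ij.2|) (0, i)).
Qed.

Lemma normr_row_le n (h : 'rV[R]_n) e :
  0 <= e -> (forall i, `|h 0 i| <= e) -> `|h| <= e.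
Proof.
move=> e0 he; rewrite /Num.Def.normr /= mx_normrE bigmax_le // => -[i j] _ /=.
by rewrite ord1.
Qed.

Lemma continuous_sum (T : topologicalType) (I : finType) (f : I -> T -> R) (x : T) :
  (forall i, {for x, continuous (f i)}) ->
  {for x, continuous (fun y => \sum_i f i y)}.
Proof.
move=> cf; apply: cvg_big => [|i _]; last exact: cf.
by move=> [a b]; apply: cvgD; [exact: cvg_fst|exact: cvg_snd].
Qed.

Lemma linear_coord_continuous n (a : 'I_n -> R) :
  continuous (fun h : 'rV[R]_n => \sum_i h 0 i * a i).
Proof.
move=> x; apply: (@continuous_sum _ _ (fun i (h : 'rV[R]_n) => h 0 i * a i)) => i.
apply: (@continuousM _ _ (fun h : 'rV[R]_n => h 0 i) (fun=> a i)); last exact: cst_continuous.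
exact: coord_continuous.
Qed.

Section C1.
Variables (n : nat) (F : 'rV[R]_n -> R) (x : 'rV[R]_n).
Let e_ (i : 'I_n) : 'rV[R]_n := delta_mx 0 i.
Hypothesis dF : \forall y \near x, forall i, derivable F y (e_ i).
Hypothesis cF : forall i : 'I_n, {for x, continuous ('D_(e_ i) F)}.

Let trunc (h : 'rV[R]_n) k : 'rV[R]_n := \row_j (if (j < k)%N then h 0 j else 0).

Let truncS h (k : 'I_n) : trunc h k.+1 = trunc h k + h 0 k *: e_ k.
Proof.
apply/rowP => j; rewrite !mxE eqxx /= ltnS leq_eqVlt.
have [->|jk] := eqVneq j k; first by rewrite eqxx ltnn mulr1 add0r.
by rewrite (inj_eq val_inj) (negbTE jk) mulr0 addr0.
Qed.

Let truncn h : trunc h n = h.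
Proof. by apply/rowP => j; rewrite !mxE ltn_ord. Qed.

Let trunc0 h : trunc h 0 = 0.
Proof. by apply/rowP => j; rewrite !mxE ltn0. Qed.

(** From x to x + h one coordinate at a time: the mean value theorem applies on
    each of the n segments, and in the sup norm they all stay within |h| of x. *)
Lemma C1_estimate e : 0 < e -> exists2 d, 0 < d &
  forall h, `|h| < d ->
    `|F (x + h) - F x - \sum_i h 0 i * 'D_(e_ i) F x| <= e * `|h|.
Proof.
(* n.+1 instead of n keeps the division meaningful when n = 0. *)
move=> e0; pose e' := e / n.+1%:R.
have e'0 : 0 < e' by rewrite divr_gt0.
have : \forall y \near x, forall i, derivable F y (e_ i) /\
    `|'D_(e_ i) F x - 'D_(e_ i) F y| <= e'.
  have cF' : \forall y \near x, forall i, `|'D_(e_ i) F x - 'D_(e_ i) F y| <= e'.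
    near=> y => i; move: i; near: y; apply: filter_forall => i.
    by have /cvgrPdist_le := @cF i; apply.
  by near=> y => i; split; [move: i; near: y|move: i; near: y].
move=> /nbhs_ballP[d /= d0 Bd]; exists d => // h hd.
have -> : F (x + h) - F x = \sum_(k < n) (F (x + trunc h k.+1) - F (x + trunc h k)).
  by rewrite -(big_mkord predT (fun k => F (x + trunc h k.+1) - F (x + trunc h k)))
    telescope_sumr // truncn trunc0 addr0.
rewrite -sumrB (le_trans (ler_norm_sum _ _ _)) //.
apply: (@le_trans _ _ (\sum_(k < n) e' * `|h|)); last first.
  rewrite sumr_const card_ord -mulr_natl mulrA ler_wpM2r //.
  rewrite /e' mulrCA ler_piMr ?(ltW e0) // ler_pdivrMr // mul1r ler_nat.
  exact: leqnSn.
apply: ler_sum => k _; rewrite truncS addrA.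
have near_h s : `|s| <= `|h 0 k| -> ball x d (x + trunc h k + s *: e_ k).
  move=> sh; rewrite -ball_normE /ball_ /= -addrA opprD addNKr normrN.
  apply: le_lt_trans hd; apply: normr_row_le => // i.
  rewrite !mxE eqxx /=; have [->|ik] := eqVneq i k.
    by rewrite ltnn add0r mulr1 (le_trans sh) // normr_coord.
  by rewrite mulr0 addr0; case: ifP; rewrite ?normr0 // normr_coord.
have [|c /near_h/Bd /(_ k)[_ ch] ->] := @MVT_line _ F (x + trunc h k) (e_ k) (h 0 k).
  by move=> s /near_h/Bd /(_ k)[].
rewrite mulrC -mulrBr normrM mulrC ler_pM ?normr_coord //.
by rewrite distrC.
Unshelve. all: by end_near. Qed.

(** [smooth_on] only speaks of partial derivatives; this is what makes the chain
    rule available for such functions. *)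
Lemma C1_differentiable :
  differentiable F x /\ forall h, 'D_h F x = \sum_i h 0 i * 'D_(e_ i) F x.
Proof.
pose L (h : 'rV[R]_n) := \sum_i h 0 i * 'D_(e_ i) F x.
have linL : linear L.
  move=> a u v; rewrite /L scaler_sumr -big_split; apply: eq_bigr => i _ /=.
  by rewrite !mxE mulrDl -mulrA.
pose scallM := GRing.isLinear.Build _ _ _ _ _ linL.
pose Ll : {linear 'rV[R]_n -> R} := HB.pack L scallM.
have cL : continuous Ll by exact: linear_coord_continuous.
have FL : F \o shift x = cst (F x) + Ll +o_ (0 : 'rV[R]_n) id.
  apply/eqaddoP => e e0; have [d d0 hd] := C1_estimate e0.
  near=> h.
  have -> : (F \o shift x - (cst (F x) + Ll)) h = F (x + h) - F x - L h.
    by rewrite /= !fctE opprD addrA [h + x]addrC.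
  apply: hd; near: h; apply/nbhs_ballP; exists d => //= h.
  by rewrite -ball_normE /ball_ /= sub0r normrN.
have dd := diff_unique cL FL.
have dF' : differentiable F x.
  by apply/diff_locallyP; rewrite dd.
by split => // h; rewrite deriveE // dd.
Unshelve. all: by end_near. Qed.

End C1.
End Calculus.

Section Smooth.
Variable R : realType.

Lemma derive_line (V W : normedModType R) (f : V -> W) x v :
  'D_v f x = 'D_1 (fun h : R => f (h *: v + x)) 0.
Proof.
rewrite /derive; set g1 := fun h => h^-1 *: _; set g2 := fun h => h^-1 *: _.
suff -> : g1 = g2 by [].
by rewrite funeqE /g1 /g2 => h /=; rewrite addr0 scale0r add0r [_%:A]mulr1.
Qed.

(** The inner map is only differentiable along v: restricting it to the line
    through y reduces the statement to a curve, where differentiability along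
    the line is all there is. *)
Lemma is_derive_comp (V U : normedModType R) (G : V -> U) (F : U -> R) y v :
  differentiable F (G y) -> derivable G y v ->
  is_derive y v (fun z => F (G z)) ('D_('D_v G y) F (G y)).
Proof.
move=> dF dG; pose g (h : R) := G (h *: v + y).
have g0 : g 0 = G y by rewrite /g scale0r add0r.
have dg : differentiable g 0 by apply/derivable1_diffP/(derivable1P _ _ _).1.
have dFg : differentiable (F \o g) 0.
  by apply: differentiable_comp => //; rewrite g0.
split; first by apply/derivable1P; apply/derivable1_diffP.
have -> : 'D_v (fun z => F (G z)) y = 'D_1 (F \o g) 0 by rewrite derive_line.
have -> : 'D_v G y = 'D_1 g 0 by rewrite derive_line.
rewrite deriveE // diff_comp //; last by rewrite g0.
by rewrite [RHS]deriveE // g0 [X in 'd F _ X]deriveE.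
Qed.

Lemma is_derive_translate (V : normedModType R) (F : V -> R) x v w :
  derivable F (x + w) v ->
  is_derive x v (fun y => F (y + w)) ('D_v F (x + w)).
Proof.
have E : (fun h : R => h^-1 *: (((fun y => F (y + w)) \o shift x) (h *: v)
      - F (x + w)))
    = (fun h : R => h^-1 *: ((F \o shift (x + w)) (h *: v) - F (x + w))).
  by apply/funext => h /=; rewrite addrA.
by move=> dF; split; rewrite /derivable /derive /= E.
Qed.

(** The left-hand side is symmetric in v and w, and the right-hand side is the
    mixed derivative taken in one order at a nearby point: letting h tend to 0
    compares the two orders. *)
Lemma second_difference (V : normedModType R) (F : V -> R) x v w (h : R) :
  (forall s t : R, `|s| <= `|h| -> `|t| <= `|h| ->
     derivable F (x + s *: v + t *: w) v /\
     derivable ('D_v F) (x + s *: v + t *: w) w) ->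
  exists s t : R, [/\ `|s| <= `|h|, `|t| <= `|h| &
    F (x + h *: v + h *: w) - F (x + h *: v) - (F (x + h *: w) - F x) =
    'D_w ('D_v F) (x + s *: v + t *: w) * h * h].
Proof.
move=> dF; pose phi y := F (y + h *: w) - F y.
have n0 : `|0 : R| <= `|h| by rewrite normr0.
have dphi (s : R) : `|s| <= `|h| -> is_derive (x + s *: v) v phi
    ('D_v F (x + s *: v + h *: w) - 'D_v F (x + s *: v)).
  move=> sh; apply: is_deriveB.
    by apply: is_derive_translate; apply: (dF s h sh _).1.
  apply: derivableP; have [+ _] := dF s 0 sh n0.
  by rewrite scale0r addr0.
have [|s sh E] := @MVT_line R V phi x v h.
  by move=> s /dphi; case.
have [|t th E'] := @MVT_line R V ('D_v F) (x + s *: v) w h.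
  by move=> t th; apply: (dF s t sh th).2.
exists s, t; split => //.
by rewrite -E' -[RHS](congr1 ( *%R^~ h) (@derive_val _ _ _ _ _ _ _ (dphi s sh))) -E.
Qed.

Section Ck.
Variable n : nat.
Implicit Types (U : set 'rV[R]_n) (F G : 'rV[R]_n -> R).
Local Notation e_ i := (delta_mx 0 i : 'rV[R]_n).

(** The same information as [smooth_on], organised by the order of
    differentiation instead of by words of indices, so that closure properties
    can be proved by induction on k. *)
Fixpoint Ck k U F : Prop :=
  (forall x, U x -> {for x, continuous F}) /\
  if k is k'.+1 then
    forall i, (forall x, U x -> derivable F x (e_ i)) /\ Ck k' U ('D_(e_ i) F)
  else True.

Lemma Ck_continuous k U F x : Ck k U F -> U x -> {for x, continuous F}.
Proof. by case: k => [|k] [+ _]; apply. Qed.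

Lemma Ck_derivable k U F x i : Ck k.+1 U F -> U x -> derivable F x (e_ i).
Proof. by move=> [_ /(_ i)[+ _]]; apply. Qed.

Lemma Ck_partial k U F i : Ck k.+1 U F -> Ck k U ('D_(e_ i) F).
Proof. by move=> [_ /(_ i)[]]. Qed.

Lemma smooth_onP U F : smooth_on U F <-> forall k, Ck k U F.
Proof.
split=> [sF k|].
- elim: k F sF => [|k IH] F sF; split=> //.
  + by move=> x Ux; exact: (sF [::] x Ux).1.
  + by move=> x Ux; exact: (sF [::] x Ux).1.
  + move=> i; split => [x Ux|]; first by apply: (sF [::] x Ux).2.
    apply: IH => s x Ux; have := sF (rcons s i) x Ux.
    by rewrite /iter_partial foldr_rcons.
- move=> + s; elim/last_ind: s F => [|s i IH] F CF x Ux.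
  + split; first exact: (Ck_continuous (CF 0)).
    by move=> i; exact: (Ck_derivable (CF 1)).
  + rewrite /iter_partial foldr_rcons; apply: IH => // k.
    exact: (Ck_partial _ (CF k.+1)).
Qed.

Lemma CkW k U F : Ck k.+1 U F -> Ck k U F.
Proof.
elim: k F => [|k IH] F [cF dF]; split=> // i.
by have [dFi CFi] := dF i; split => //; exact: IH.
Qed.

Lemma Ck_sub k U V F : V `<=` U -> Ck k U F -> Ck k V F.
Proof.
move=> VU; elim: k F => [|k IH] F [cF dF]; split=> //.
- by move=> x /VU; exact: cF.
- by move=> x /VU; exact: cF.
- move=> i; have [dFi CFi] := dF i; split; last exact: IH.
  by move=> x /VU; exact: dFi.
Qed.

Lemma near_open_eq U F G x : open U -> (forall y, U y -> F y = G y) -> U x ->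
  \near x, F x = G x.
Proof.
move=> oU FG Ux; have /= := open_nbhs_nbhs (conj oU Ux).
by apply: filterS => y /FG.
Qed.

Lemma continuous_at_ext F G x : (\near x, F x = G x) ->
  {for x, continuous F} -> {for x, continuous G}.
Proof.
move=> FG cF; have FGx := nbhs_singleton FG.
rewrite /prop_for /continuous_at -FGx; apply: cvg_trans cF.
exact: (near_eq_cvg FG).
Qed.

Lemma Ck_ext k U F G : open U -> (forall x, U x -> F x = G x) ->
  Ck k U F -> Ck k U G.
Proof.
move=> oU; elim: k F G => [|k IH] F G FG [cF dF].
  split=> // x Ux; apply: continuous_at_ext (cF x Ux).
  exact: near_open_eq Ux.
split=> [x Ux|i].
  by apply: continuous_at_ext (cF x Ux); exact: near_open_eq Ux.
have [dFi CFi] := dF i; split.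
  move=> x Ux; apply: near_eq_derivable (dFi x Ux).
  exact: near_open_eq Ux.
apply: IH CFi => x Ux; apply: near_eq_derive; exact: near_open_eq Ux.
Qed.

Lemma Ck_cst k U (a : R) : Ck k U (fun=> a).
Proof.
elim: k a => [|k IH] a; split => //; try by move=> x Ux; exact: cst_continuous.
move=> i; split=> [x Ux|]; first exact: derivable_cst.
suff -> : 'D_(e_ i) (fun=> a) = (fun=> 0) by [].
by apply/funext => x; rewrite derive_cst.
Qed.

Lemma is_derive_coord (x v : 'rV[R]_n) (j : 'I_n) :
  is_derive x v (fun y : 'rV[R]_n => y 0 j) (v 0 j).
Proof.
have d := is_derive_id x v.
split; first by move: (@ex_derive _ _ _ _ _ _ _ d) => /derivable_mxP; exact.
have := @derive_val _ _ _ _ _ _ _ d.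
rewrite derive_mx; last exact: ex_derive.
by move=> /rowP /(_ j); rewrite mxE.
Qed.

Lemma Ck_coord k U j : Ck k U (fun x => x 0 j).
Proof.
case: k => [|k]; split=> //; try by move=> x _; exact: coord_continuous.
move=> i; split=> [x _|]; first by have [] := is_derive_coord x (e_ i) j.
suff -> : 'D_(e_ i) (fun x : 'rV[R]_n => x 0 j) = (fun=> (e_ i) 0 j) by exact: Ck_cst.
by apply/funext => x; have [] := is_derive_coord x (e_ i) j.
Qed.

Lemma CkD k U F G : open U -> Ck k U F -> Ck k U G -> Ck k U (fun x => F x + G x).
Proof.
move=> oU; elim: k F G => [|k IH] F G CF CG; split => //;
  try by move=> x Ux; apply: (@continuousD _ _ _ F G);
    [exact: Ck_continuous CF Ux|exact: Ck_continuous CG Ux].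
move=> i; split=> [x Ux|].
  by apply: (@derivableD _ _ _ F G); [exact: Ck_derivable CF Ux|exact: Ck_derivable CG Ux].
have := IH _ _ (Ck_partial i CF) (Ck_partial i CG); apply: Ck_ext => // x Ux.
by rewrite -(@deriveD _ _ _ F G) //;
  [exact: Ck_derivable CF Ux|exact: Ck_derivable CG Ux].
Qed.

Lemma CkM k U F G : open U -> Ck k U F -> Ck k U G -> Ck k U (fun x => F x * G x).
Proof.
move=> oU; elim: k F G => [|k IH] F G CF CG; split => //;
  try by move=> x Ux; apply: (@continuousM _ _ F G);
    [exact: Ck_continuous CF Ux|exact: Ck_continuous CG Ux].
move=> i; split=> [x Ux|].
  by apply: (@derivableM _ _ F G); [exact: Ck_derivable CF Ux|exact: Ck_derivable CG Ux].
have C1 := IH _ _ (CkW CF) (Ck_partial i CG).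
have C2 := IH _ _ (CkW CG) (Ck_partial i CF).
have := CkD oU C1 C2; apply: Ck_ext => // x Ux.
by rewrite (@deriveM _ _ F G) //;
  [exact: Ck_derivable CF Ux|exact: Ck_derivable CG Ux].
Qed.

Lemma Ck_sum k U (I : Type) (r : seq I) (F : I -> 'rV[R]_n -> R) : open U ->
  (forall i, Ck k U (F i)) -> Ck k U (fun x => \sum_(i <- r) F i x).
Proof.
move=> oU CF; elim: r => [|i r IH].
  by under eq_fun do rewrite big_nil; exact: Ck_cst.
by under eq_fun do rewrite big_cons; exact: CkD.
Qed.

Lemma Ck_differentiable k U F x : open U -> Ck k.+1 U F -> U x ->
  differentiable F x /\ forall h, 'D_h F x = \sum_i h 0 i * 'D_(e_ i) F x.
Proof.
move=> oU CF Ux; apply: C1_differentiable.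
  have /= := open_nbhs_nbhs (conj oU Ux).
  by apply: filterS => y Uy i; exact: Ck_derivable CF Uy.
by move=> i; exact: Ck_continuous (Ck_partial i CF) Ux.
Qed.

Lemma dist_le_half (a b c e : R) :
  `|a - c| <= e / 2 -> `|b - c| <= e / 2 -> `|a - b| <= e.
Proof.
move=> ac bc; rewrite [e]splitr; have -> : a - b = (a - c) - (b - c) by ring.
by rewrite (le_trans (ler_normB _ _)) // lerD.
Qed.

(** Both mixed derivatives at x are within e / 2 of a common value, the second
    difference of [second_difference] divided by h^2. *)
Lemma Ck_schwarz U F x i j : open U -> Ck 2 U F -> U x ->
  'D_(e_ i) ('D_(e_ j) F) x = 'D_(e_ j) ('D_(e_ i) F) x.
Proof.
move=> oU CF Ux.
have cD a b : {for x, continuous ('D_(e_ a) ('D_(e_ b) F))}.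
  exact: Ck_continuous (Ck_partial _ (Ck_partial _ CF)) Ux.
apply/eqP; rewrite -subr_eq0 -normr_le0; apply/ler_addgt0Pl => e e0.
have e20 : 0 < e / 2 by rewrite divr_gt0.
have N a b : \forall y \near x,
    `|'D_(e_ a) ('D_(e_ b) F) x - 'D_(e_ a) ('D_(e_ b) F) y| <= e / 2.
  by have /cvgrPdist_le := cD a b; apply.
have : \forall y \near x, [/\ U y,
    `|'D_(e_ i) ('D_(e_ j) F) x - 'D_(e_ i) ('D_(e_ j) F) y| <= e / 2 &
    `|'D_(e_ j) ('D_(e_ i) F) x - 'D_(e_ j) ('D_(e_ i) F) y| <= e / 2].
  apply: filterS3 (open_nbhs_nbhs (conj oU Ux)) (N i j) (N j i).
  by move=> y Uy Ny1 Ny2; split.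
move=> /nbhs_ballP[d /= d0 Bd].
(* The increments s and t below are at most h, so every point met lies within
   2 h < d of x. *)
pose h := d / 4; have h0 : 0 < h by rewrite divr_gt0.
have in_ball a b (s t : R) : `|s| <= `|h| -> `|t| <= `|h| ->
    ball x d (x + s *: e_ a + t *: e_ b).
  move=> sh th; rewrite -ball_normE /ball_ /= -addrA opprD addNKr normrN.
  apply: (@le_lt_trans _ _ (2 * h)); last first.
    by rewrite /h mulrA ltr_pdivrMr // mulrC ltr_pM2l // ltr_nat.
  apply: normr_row_le => [|c]; first by rewrite mulr_ge0 // ltW.
  rewrite !mxE mulr2n mulrDl mul1r (le_trans (ler_normD _ _)) //.
  rewrite !normrM -(gtr0_norm h0).
  apply: lerD; rewrite -[leRHS]mulr1; apply: ler_pM => //;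
    by case: (_ && _); rewrite ?normr1 ?normr0.
have dd a b (s t : R) : `|s| <= `|h| -> `|t| <= `|h| ->
   derivable F (x + s *: e_ a + t *: e_ b) (e_ a) /\
   derivable ('D_(e_ a) F) (x + s *: e_ a + t *: e_ b) (e_ b).
  move=> sh th; have [Uy _ _] := Bd _ (in_ball a b s t sh th); split.
    exact: Ck_derivable CF Uy.
  exact: Ck_derivable (Ck_partial _ CF) Uy.
have [s [t [sh th E1]]] := second_difference (dd i j).
have [s' [t' [sh' th' E2]]] := second_difference (dd j i).
have [_ _ B1] := Bd _ (in_ball i j s t sh th).
have [_ B2 _] := Bd _ (in_ball j i s' t' sh' th').
have E : 'D_(e_ j) ('D_(e_ i) F) (x + s *: e_ i + t *: e_ j) =
    'D_(e_ i) ('D_(e_ j) F) (x + s' *: e_ j + t' *: e_ i).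
  apply: (mulIf (lt0r_neq0 h0)); apply: (mulIf (lt0r_neq0 h0)).
  apply: etrans (esym E1) _; apply: etrans _ E2; rewrite (addrAC x (h *: e_ i)).
  move: (F (x + _ + _)) (F (x + h *: e_ i)) (F (x + h *: e_ j)) (F x) => p q r o.
  by ring.
by rewrite E in B1; rewrite addr0; exact: dist_le_half B2 B1.
Qed.

End Ck.

(** Each partial derivative of F o G is a sum of products of a partial
    derivative of G with a partial derivative of F composed with G; the latter
    is of order k by induction. *)
Lemma Ck_comp n m k (U : set 'rV[R]_m) (V : set 'rV[R]_n)
    (F : 'rV[R]_m -> R) (G : 'rV[R]_n -> 'rV[R]_m) :
  open U -> open V -> (forall x, V x -> U (G x)) ->
  (forall i, Ck k V (fun x => G x 0 i)) -> Ck k U F ->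
  Ck k V (fun x => F (G x)).
Proof.
move=> oU oV VU; elim: k F => [|k IH] F CG CF; split=> //; try by
  move=> x Vx; apply: (@continuous_comp _ _ _ G F);
    [by apply: continuous_rowP => j; exact: Ck_continuous (CG j) Vx
    |exact: Ck_continuous CF (VU _ Vx)].
have dG x (i : 'I_n) : V x -> derivable G x (delta_mx 0 i).
  by move=> Vx; apply/derivable_mxP => a j; rewrite ord1; exact: Ck_derivable (CG j) Vx.
have dFG x (i : 'I_n) : V x -> is_derive x (delta_mx 0 i) (fun x => F (G x))
    (\sum_j 'D_(delta_mx 0 i) (fun x => G x 0 j) x * 'D_(delta_mx 0 j) F (G x)).
  move=> Vx; have [dF EF] := Ck_differentiable oU CF (VU _ Vx).
  have := is_derive_comp dF (dG x i Vx).
  rewrite EF => d; apply: (is_derive_eq d); apply: eq_bigr => j _.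
  by rewrite derive_mx ?mxE //; exact: dG.
move=> i; split=> [x Vx|]; first by have [] := dFG x i Vx.
have : Ck k V (fun x => \sum_j 'D_(delta_mx 0 i) (fun x => G x 0 j) x *
    'D_(delta_mx 0 j) F (G x)).
  apply: Ck_sum => // j; apply: CkM => //; first exact: Ck_partial (CG j).
  by apply: (IH ('D_(delta_mx 0 j) F)); [move=> a; exact: CkW|exact: Ck_partial CF].
by apply: Ck_ext => // x Vx; have [] := dFG x i Vx.
Qed.

Lemma is_derive_rsqrt (y : R) : 0 < y ->
  is_derive y 1 (fun z => (Num.sqrt z)^-1) (- 2^-1 * (Num.sqrt y)^-1 ^+ 3).
Proof.
move=> y0; have s0 : Num.sqrt y != 0 by rewrite sqrtr_eq0 -ltNge.
have d := is_derive1_sqrt y0.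
split; first by apply: derivableV => //; exact: ex_derive.
rewrite deriveV //.
rewrite derive_val /GRing.scale /=.
by field.
Qed.

(** The induction closes because the derivative of r = F^(-1/2) is
    - 1/2 r^3 dF, again a polynomial in r and a derivative of F. *)
Lemma Ck_rsqrt n k (U : set 'rV[R]_n) (F : 'rV[R]_n -> R) : open U ->
  (forall x, U x -> 0 < F x) -> Ck k U F ->
  Ck k U (fun x => (Num.sqrt (F x))^-1).
Proof.
move=> oU F0; elim: k => [|k IH] CF.
  split=> // x Ux; apply: (@continuous_comp _ _ _ F (fun z => (Num.sqrt z)^-1)).
    exact: Ck_continuous CF Ux.
  apply/differentiable_continuous/derivable1_diffP.
  by have [] := is_derive_rsqrt (F0 x Ux).
have d x (i : 'I_n) : U x -> is_derive x (delta_mx 0 i) (fun x => (Num.sqrt (F x))^-1)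
    (- 2^-1 * ((Num.sqrt (F x))^-1 * ((Num.sqrt (F x))^-1 * (Num.sqrt (F x))^-1))
      * 'D_(delta_mx 0 i) F x).
  move=> Ux; have dr := is_derive_rsqrt (F0 x Ux).
  have difr : differentiable (fun z => (Num.sqrt z)^-1) (F x).
    by apply/derivable1_diffP; case: dr.
  have D := is_derive_comp difr (Ck_derivable (i := i) CF Ux).
  apply: (is_derive_eq D).
  rewrite deriveE // -[X in 'd _ _ X]mulr1 linearZ /= -deriveE // derive_val.
  rewrite /GRing.scale /=; ring.
have CI := IH (CkW CF); split=> [x Ux|i]; first exact: Ck_continuous CI Ux.
split=> [x Ux|]; first by have [] := d x i Ux.
have : Ck k U (fun x => - 2^-1 * ((Num.sqrt (F x))^-1 * ((Num.sqrt (F x))^-1 * (Num.sqrt (F x))^-1))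
      * 'D_(delta_mx 0 i) F x).
  apply: CkM => //; last exact: Ck_partial CF.
  by apply: CkM => //; [exact: Ck_cst|do 2!apply: CkM => //].
by apply: Ck_ext => // x Ux; have [] := d x i Ux.
Qed.

End Smooth.

(** * Iterated integrals over a rectangle *)

Section DoubleIntegrals.
Variable R : realType.
Local Notation mu := (@lebesgue_measure R).
Implicit Types f g : R -> R -> R.

Definition continuous2 g := continuous (fun z : R * R => g z.1 z.2).

Lemma continuous2_left g t : continuous2 g -> continuous (g t).
Proof.
move=> cg p; apply: (@continuous_comp _ _ _ (fun p => (t, p)) (fun z : R * R => g z.1 z.2)); last exact: cg.
exact: (cvg_pair (cvg_cst t) cvg_id).
Qed.

Lemma continuous2_right g p : continuous2 g -> continuous (g^~ p).
Proof.
move=> cg t; apply: (@continuous_comp _ _ _ (fun t => (t, p)) (fun z : R * R => g z.1 z.2)); last exact: cg.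
exact: (cvg_pair cvg_id (cvg_cst p)).
Qed.

Lemma continuous_integrable (f : R -> R) a b : continuous f ->
  mu.-integrable `[a, b] (EFin \o f).
Proof.
move=> cf; apply: continuous_compact_integrable; first exact: segment_compact.
exact: continuous_subspaceT.
Qed.

Lemma continuous2_bounded g a b c d : continuous2 g ->
  exists M, 0 <= M /\ forall t p, t \in `[a, b]%R -> p \in `[c, d]%R -> `|g t p| <= M.
Proof.
move=> cg; have K : compact (`[a, b] `*` `[c, d] : set (R * R)).
  by apply: compact_setX; exact: segment_compact.
have := continuous_compact (continuous_subspaceT cg) K.
move=> /compact_bounded[M0 [_ HM]].
exists (`|M0| + 1); split; first by rewrite addr_ge0.
move=> t p tab pcd; apply: (HM (`|M0| + 1)); first by rewrite ltr_pwDr // ler_norm.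
by exists (t, p).
Qed.

Lemma FTC_Rintegral (F f : R -> R) a b : a < b -> continuous f ->
  (forall x : R, is_derive x (1 : R) F (f x)) ->
  \int[mu]_(x in `[a, b]) f x = F b - F a.
Proof.
move=> ab cf dF.
have cF : continuous F.
  by move=> x; apply/differentiable_continuous/derivable1_diffP; have [] := dF x.
rewrite /Rintegral (@continuous_FTC2 _ f F) //.
- exact: continuous_subspaceT.
- split.
  + by move=> x _; have [] := dF x.
  + exact/cvg_at_right_filter/cF.
  + exact/cvg_at_left_filter/cF.
- by move=> x _; rewrite derive1E; have [] := dF x.
Qed.

(** Dominated by a constant: a continuous function is bounded on the compact
    rectangle [t - 1, t + 1] x [a, b]. *)
Lemma continuous_integral g a b : continuous2 g ->
  continuous (fun t => \int[mu]_(p in `[a, b]) g t p).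
Proof.
move=> cg t.
have [M [M0 HM]] := continuous2_bounded (t - 1) (t + 1) a b cg.
apply: (@continuity_under_integral R _ _ mu g `[a, b] _ (t - 1) (t + 1) _ _ (fun=> M)) => //.
- by move=> x _; apply: continuous_integrable; exact: continuous2_left.
- by apply: aeW => p _ x _; exact: continuous2_right.
- by apply: continuous_integrable; exact: cst_continuous.
- move=> x xI; apply: aeW => p pab; apply: HM => //.
  exact: subset_itv_oo_cc xI.
- by rewrite inE /= in_itv /= ltrBlDr ltrDl ltr01.
Qed.

Definition int2 a b c d g :=
  \int[mu]_(t in `[a, b]) \int[mu]_(p in `[c, d]) g t p.

Lemma int2D a b c d f g : continuous2 f -> continuous2 g ->
  int2 a b c d (fun t p => f t p + g t p) = int2 a b c d f + int2 a b c d g.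
Proof.
move=> cf cg; rewrite /int2.
under eq_Rintegral => t _.
  rewrite RintegralD //; first over.
  - exact/continuous_integrable/continuous2_left.
  - exact/continuous_integrable/continuous2_left.
by rewrite RintegralD //; exact/continuous_integrable/continuous_integral.
Qed.

Lemma int2_eq a b c d f g : (forall t p, f t p = g t p) ->
  int2 a b c d f = int2 a b c d g.
Proof. by move=> fg; congr int2; apply/funext => t; apply/funext => p. Qed.

Lemma int2_derive_snd a b c d (Q Q' : R -> R -> R) : c < d ->
  continuous2 Q' -> (forall t p : R, is_derive p (1 : R) (Q t) (Q' t p)) ->
  (forall t, Q t c = Q t d) -> int2 a b c d Q' = 0.
Proof.
move=> cd cQ' dQ per; rewrite /int2.
under eq_Rintegral => t _.
  rewrite (@FTC_Rintegral (Q t)) //; last exact: continuous2_left.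
  rewrite per subrr; over.
by rewrite Rintegral_cst // mul0r.
Qed.

(** Differentiation under the inner integral turns the iterated integral into
    the integral of the derivative of t |-> int P t p dp. *)
Lemma int2_derive_fst a b c d (P P' : R -> R -> R) : a < b ->
  continuous2 P -> continuous2 P' ->
  (forall t p : R, is_derive t (1 : R) (P^~ p) (P' t p)) ->
  (forall p, P a p = 0) -> (forall p, P b p = 0) -> int2 a b c d P' = 0.
Proof.
move=> ab cP cP' dP Pa Pb; pose G t := \int[mu]_(p in `[c, d]) P t p.
have E t p : partial1of2 P t p = P' t p.
  by rewrite partial1of2E; have [] := dP t p.
have dG t : is_derive t (1 : R) G (\int[mu]_(p in `[c, d]) P' t p).
  have [M [M0 HM]] := continuous2_bounded (t - 1) (t + 1) c d cP'.
  have It : `]t - 1, t + 1[%classic t by rewrite /= in_itv /= ltrBlDr ltrDl ltr01.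
  have I1 x : `]t - 1, t + 1[%classic x -> mu.-integrable `[c, d] (EFin \o P x).
    by move=> _; apply: continuous_integrable; exact: continuous2_left.
  have D1 x y : `]t - 1, t + 1[%classic x -> `[c, d]%classic y -> derivable (P^~ y) x 1.
    by move=> _ _; have [] := dP x y.
  have IM : mu.-integrable `[c, d] (EFin \o (fun=> M)).
    by apply: continuous_integrable; exact: cst_continuous.
  have B1 x y : `]t - 1, t + 1[%classic x -> `[c, d]%classic y -> `|partial1of2 P x y| <= M.
    by move=> xI yI; rewrite E; apply: HM => //; exact: subset_itv_oo_cc xI.
  split.
    exact: (@derivable_under_integral R _ _ mu P `[c, d] _ t (t - 1) (t + 1) It I1 D1 (fun=> M)).
  rewrite -derive1E.
  rewrite (@differentiation_under_integral R _ _ mu P `[c, d] _ t (t - 1) (t + 1) It I1 D1 (fun=> M)) //.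
  by apply: eq_Rintegral => p _; exact: E.
rewrite /int2 (@FTC_Rintegral G) //; last exact: continuous_integral.
rewrite /G; under eq_Rintegral do rewrite Pb.
under [X in _ - X]eq_Rintegral do rewrite Pa.
by rewrite subrr.
Qed.

End DoubleIntegrals.

(** * Smooth functions on a subset of R^n *)

Section SmoothSub.
Variable R : realType.

Lemma Ck_local n k (U : set 'rV[R]_n) F :
  (forall x, U x -> exists V, [/\ open V, V x & Ck k V F]) -> Ck k U F.
Proof.
elim: k F => [|k IH] F H; split=> //.
- by move=> x /H[V [oV Vx CF]]; exact: Ck_continuous CF Vx.
- by move=> x /H[V [oV Vx CF]]; exact: Ck_continuous CF Vx.
- move=> i; split=> [x /H[V [oV Vx CF]]|]; first exact: Ck_derivable CF Vx.
  apply: IH => x /H[V [oV Vx CF]]; exists V; split=> //.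
  exact: Ck_partial CF.
Qed.

Lemma open_preimage_on n m (V : set 'rV[R]_n) (U : set 'rV[R]_m)
    (H : 'rV[R]_n -> 'rV[R]_m) :
  open V -> open U -> (forall x, V x -> {for x, continuous H}) ->
  open [set x | V x /\ U (H x)].
Proof.
move=> oV oU cH; rewrite openE => x [Vx UHx].
have N1 := open_nbhs_nbhs (conj oV Vx).
have N2 := cH x Vx _ (open_nbhs_nbhs (conj oU UHx)).
by apply: filterS2 N1 N2 => y.
Qed.

Lemma Ck_continuous_row n m k (V : set 'rV[R]_n) (H : 'rV[R]_n -> 'rV[R]_m) x :
  (forall i, Ck k V (fun x => H x 0 i)) -> V x -> {for x, continuous H}.
Proof.
by move=> CH Vx; apply: continuous_rowP => i; exact: Ck_continuous (CH i) Vx.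
Qed.

Section Generic.
Variables (M : Type) (n : nat) (emb : M -> 'rV[R]_n).
Local Notation smooth := (@smooth_sub R M n emb).
Implicit Types f g : M -> R.

Lemma smooth_sub_ext f g : (forall m, f m = g m) -> smooth f -> smooth g.
Proof. by move=> /funext ->. Qed.

Lemma smooth_sub_cst (a : R) : smooth (fun=> a).
Proof.
move=> m; exists setT, (fun=> a); split=> //; first exact: openT.
by apply/smooth_onP => k; exact: Ck_cst.
Qed.

Lemma smooth_sub_coord i : smooth (fun m => emb m 0 i).
Proof.
move=> m; exists setT, (fun x => x 0 i); split=> //; first exact: openT.
by apply/smooth_onP => k; exact: Ck_coord.
Qed.

Lemma smooth_subD f g : smooth f -> smooth g -> smooth (fun m => f m + g m).
Proof.
move=> sf sg m; have [U [F [oU Um SF fF]]] := sf m.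
have [V [G [oV Vm SG gG]]] := sg m.
exists (U `&` V), (fun x => F x + G x); split=> //.
- exact: openI.
- apply/smooth_onP => k; apply: CkD; first exact: openI.
  + by apply: Ck_sub (@subIsetl _ _ _) _; exact: (smooth_onP _ _).1.
  + by apply: Ck_sub (@subIsetr _ _ _) _; exact: (smooth_onP _ _).1.
- by move=> m' [Um' Vm']; rewrite fF // gG.
Qed.

Lemma smooth_subM f g : smooth f -> smooth g -> smooth (fun m => f m * g m).
Proof.
move=> sf sg m; have [U [F [oU Um SF fF]]] := sf m.
have [V [G [oV Vm SG gG]]] := sg m.
exists (U `&` V), (fun x => F x * G x); split=> //.
- exact: openI.
- apply/smooth_onP => k; apply: CkM; first exact: openI.
  + by apply: Ck_sub (@subIsetl _ _ _) _; exact: (smooth_onP _ _).1.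
  + by apply: Ck_sub (@subIsetr _ _ _) _; exact: (smooth_onP _ _).1.
- by move=> m' [Um' Vm']; rewrite fF // gG.
Qed.

Lemma smooth_subN f : smooth f -> smooth (fun m => - f m).
Proof.
move=> sf; apply: smooth_sub_ext (smooth_subM (smooth_sub_cst (-1)) sf) => m.
by rewrite mulN1r.
Qed.

Lemma smooth_subB f g : smooth f -> smooth g -> smooth (fun m => f m - g m).
Proof. by move=> sf sg; apply: smooth_subD => //; exact: smooth_subN. Qed.

Lemma smooth_sub_sum (I : Type) (r : seq I) (f : I -> M -> R) :
  (forall i, smooth (f i)) -> smooth (fun m => \sum_(i <- r) f i m).
Proof.
move=> sf; elim: r => [|i r IH].
  by under eq_fun do rewrite big_nil; exact: smooth_sub_cst.
by under eq_fun do rewrite big_cons; exact: smooth_subD.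
Qed.

End Generic.

(** The map h is allowed to depend on the point and to be smooth only near it.
    This covers pull-back along a polynomial map as well as descent along a
    fibration through its local sections. *)
Lemma smooth_sub_comp (M M' : Type) n n' (emb : M -> 'rV[R]_n)
    (emb' : M' -> 'rV[R]_n') (f : M' -> R) (g : M -> R) :
  (forall m, exists W (H : 'rV[R]_n -> 'rV[R]_n') (h : M -> M'), [/\ open W, W (emb m),
     forall k i, Ck k W (fun x => H x 0 i) &
     forall m', W (emb m') -> emb' (h m') = H (emb m') /\ g m' = f (h m')]) ->
  smooth_sub emb' f -> smooth_sub emb g.
Proof.
move=> Hloc sf m; have [W [H [h [oW Wm CH Wh]]]] := Hloc m.
have [U [F [oU Um SF fF]]] := sf (h m).
have oV : open [set x | W x /\ U (H x)].
  apply: open_preimage_on => // x Wx; exact: (Ck_continuous_row (CH 0)).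
exists [set x | W x /\ U (H x)], (fun x => F (H x)); split => //.
- by split=> //; rewrite -(Wh m Wm).1.
- apply/smooth_onP => k; apply: (@Ck_comp _ _ _ k U) => //.
  + by move=> x [].
  + by move=> i; apply: Ck_sub (CH k i) => x [].
  + exact: (smooth_onP _ _).1.
- by move=> m' [Wm' UHm']; rewrite -(Wh m' Wm').1 fF ?(Wh m' Wm').1 // (Wh m' Wm').2.
Qed.

End SmoothSub.

(** * Real calculus on the two-sphere *)

(* Conversion must not unfold the limits of difference quotients. *)
Local Opaque derive.

Section CalculusS2.
Variable R : realType.
Local Notation S2 := (S2 R).
Local Notation R3 := 'rV[R]_3.
Local Notation e_ i := (delta_mx 0 i : R3).
Local Notation smooth := (smooth_sub (fun x : S2 => val x)).
Implicit Types (f g : S2 -> R) (x : S2) (u v w : R3).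

Definition punctured : set R3 := [set v | 0 < dot v v].
Definition normalize v : R3 := (Num.sqrt (dot v v))^-1 *: v.
(** With this extension the derivative [dR_S2] along a tangent vector is an
    ordinary directional derivative in R^3, and extension commutes with sums and
    products, so the rules of calculus carry over. *)
Definition homogeneous_ext f v : R := f (to_S2 v).
Local Notation hat := homogeneous_ext.

Lemma S2_dot x : dot (val x) (val x) = 1.
Proof. by apply/eqP; exact: (valP x). Qed.

Lemma dotC n (u v : 'rV[R]_n) : dot u v = dot v u.
Proof. by apply: eq_bigr => i _; rewrite mulrC. Qed.

Lemma dotDr n (w u v : 'rV[R]_n) : dot w (u + v) = dot w u + dot w v.
Proof. by rewrite /dot -big_split; apply: eq_bigr => i _; rewrite mxE mulrDr. Qed.

Lemma dotZr n (a : R) (w u : 'rV[R]_n) : dot w (a *: u) = a * dot w u.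
Proof. by rewrite /dot mulr_sumr; apply: eq_bigr => i _; rewrite mxE mulrCA. Qed.

Lemma dotNr n (w u : 'rV[R]_n) : dot w (- u) = - dot w u.
Proof. by rewrite -scaleN1r dotZr mulN1r. Qed.

Lemma dot_delta n (u : 'rV[R]_n) i : dot u (delta_mx 0 i) = u 0 i.
Proof.
rewrite /dot (bigD1 i) //= big1 ?addr0 ?mxE ?eqxx ?mulr1 // => j ji.
by rewrite mxE (negbTE ji) mulr0.
Qed.

Lemma S2_punctured x : punctured (val x).
Proof. by rewrite /punctured /= S2_dot. Qed.

Lemma Ck_dot k U : open U -> Ck k U (fun v : R3 => dot v v).
Proof. by move=> oU; apply: Ck_sum => // i; apply: CkM => //; exact: Ck_coord. Qed.

Lemma punctured_open : open punctured.
Proof.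
have c : continuous (fun v : R3 => dot v v).
  by move=> v; exact: (Ck_continuous (@Ck_dot 0 setT openT)).
rewrite (_ : punctured = (fun v : R3 => dot v v) @^-1` [set y | 0 < y]) //.
by apply: open_comp => [v _|]; [exact: c|exact: open_gt].
Qed.

Lemma Ck_normalize k i : Ck k punctured (fun v => normalize v 0 i).
Proof.
have o := punctured_open.
apply: (@Ck_ext _ _ _ _ (fun v : R3 => (Num.sqrt (dot v v))^-1 * v 0 i)) => //.
  by move=> v _; rewrite mxE.
apply: CkM => //; last exact: Ck_coord.
by apply: Ck_rsqrt => //; exact: Ck_dot.
Qed.

Lemma val_to_S2 v : punctured v -> val (to_S2 v) = normalize v.
Proof.
move=> v0; rewrite /to_S2 val_insubd -/(normalize v) ifT //.
rewrite dotZr dotC dotZr mulrA -expr2 exprVn sqr_sqrtr ?(ltW v0) //.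
by rewrite mulVf // lt0r_neq0.
Qed.

Lemma normalize_S2 x : normalize (val x) = val x.
Proof. by rewrite /normalize S2_dot sqrtr1 invr1 scale1r. Qed.

Lemma to_S2_val x : to_S2 (val x) = x.
Proof. by apply: val_inj; rewrite val_to_S2 ?normalize_S2 //; exact: S2_punctured. Qed.

Lemma hatE f x : hat f (val x) = f x.
Proof. by rewrite /hat to_S2_val. Qed.

Lemma open_normalize_preimage U : open U ->
  open [set w | punctured w /\ U (normalize w)].
Proof.
move=> oU; have cN w : punctured w -> {for w, continuous normalize}.
  exact: (Ck_continuous_row (Ck_normalize 0)).
exact: (open_preimage_on punctured_open oU cN).
Qed.

(** Near v the extension of f is F o normalize, for a local extension F of f
    around the projection of v. *)
Lemma Ck_hat f k : smooth f -> Ck k punctured (hat f).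
Proof.
move=> sf; apply: Ck_local => v v0; have [U [F [oU Ux SF fF]]] := sf (to_S2 v).
have oV := open_normalize_preimage oU.
exists [set w | punctured w /\ U (normalize w)]; split=> //.
  by split=> //; rewrite -val_to_S2.
apply: (@Ck_ext _ _ _ _ (fun w => F (normalize w))) => //.
  by move=> w [w0 Uw]; rewrite -val_to_S2 // fF // val_to_S2.
apply: (@Ck_comp _ _ _ k U) => //.
- by move=> w [].
- by move=> i; apply: Ck_sub (Ck_normalize k i) => w [].
- exact: (smooth_onP _ _).1.
Qed.

Lemma dR_S2E f x u : dR_S2 f x u = 'D_u (hat f) (val x).
Proof.
have E : (fun t : R => f (to_S2 (val x + t *: u))) =
    (fun t : R => hat f (t *: u + val x)).
  by apply/funext => t; rewrite addrC.
by rewrite /dR_S2 E derive1E -(derive_line (hat f) (val x) u).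
Qed.

(** Partial derivatives of the extension of f. They depend on the extension,
    and yet their combination with a tangent vector does not. *)
Definition partial f i x : R := 'D_(e_ i) (hat f) (val x).
Definition partial2 f i j x : R := 'D_(e_ j) ('D_(e_ i) (hat f)) (val x).

Lemma hat_differentiable f x : smooth f -> differentiable (hat f) (val x) /\
  forall u, dR_S2 f x u = \sum_i u 0 i * partial f i x.
Proof.
move=> sf; have [d E] := Ck_differentiable punctured_open (Ck_hat 1 sf) (S2_punctured x).
by split=> // u; rewrite dR_S2E E.
Qed.

Lemma dR_partialE f x u : smooth f ->
  dR_S2 f x u = \sum_i u 0 i * partial f i x.
Proof. by move=> /(hat_differentiable x)[]. Qed.

Lemma dR_linear f x (a : R) u v : smooth f ->
  dR_S2 f x (a *: u + v) = a * dR_S2 f x u + dR_S2 f x v.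
Proof.
move=> sf; rewrite !dR_partialE // mulr_sumr -big_split; apply: eq_bigr => i _.
by rewrite !mxE mulrDl mulrA.
Qed.

Lemma hat_derivable f x u : smooth f -> derivable (hat f) (val x) u.
Proof. by move=> /(hat_differentiable x)[d _]; exact: diff_derivable. Qed.

Lemma dR_cst (a : R) x u : dR_S2 (fun=> a) x u = 0.
Proof. by rewrite dR_S2E (_ : hat _ = fun=> a) // derive_cst. Qed.

Lemma dRD f g x u : smooth f -> smooth g ->
  dR_S2 (fun y => f y + g y) x u = dR_S2 f x u + dR_S2 g x u.
Proof.
move=> sf sg; rewrite !dR_S2E -deriveD //; exact: hat_derivable.
Qed.

Lemma dRM f g x u : smooth f -> smooth g ->
  dR_S2 (fun y => f y * g y) x u = dR_S2 f x u * g x + f x * dR_S2 g x u.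
Proof.
move=> sf sg; rewrite !dR_S2E (@deriveM _ _ (hat f) (hat g)); try exact: hat_derivable.
by rewrite !hatE /GRing.scale /= addrC [g x * _]mulrC.
Qed.

Lemma dRN f x u : smooth f -> dR_S2 (fun y => - f y) x u = - dR_S2 f x u.
Proof.
move=> sf; have := dRM x u (smooth_sub_cst (fun x : S2 => val x) (-1)) sf.
rewrite dR_cst mul0r add0r mulN1r => <-; congr (dR_S2 _ _ _).
by apply/funext => y; rewrite mulN1r.
Qed.

Lemma dR_sum (I : Type) (r : seq I) (f : I -> S2 -> R) x u :
  (forall i, smooth (f i)) ->
  dR_S2 (fun y => \sum_(i <- r) f i y) x u = \sum_(i <- r) dR_S2 (f i) x u.
Proof.
move=> sf; elim: r => [|i r IH].
  by under eq_fun do rewrite big_nil; rewrite dR_cst big_nil.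
under eq_fun do rewrite big_cons.
by rewrite dRD ?IH ?big_cons //; exact: smooth_sub_sum.
Qed.

Lemma is_derive_dot x u :
  is_derive (val x) u (fun v : R3 => dot v v) (2 * dot (val x) u).
Proof.
have d (i : 'I_3) : is_derive (val x) u ((fun v : R3 => v 0 i) * (fun v : R3 => v 0 i))
   ((val x) 0 i *: u 0 i + (val x) 0 i *: u 0 i).
  by apply: is_deriveM; exact: is_derive_coord.
have := is_derive_sum d; rewrite (_ : \sum_i _ = (fun v : R3 => dot v v)); last first.
  by apply/funext => v; rewrite fct_sumE.
move=> h; apply: (is_derive_eq h).
by rewrite /dot mulr_sumr; apply: eq_bigr => i _; rewrite /GRing.scale /=; ring.
Qed.

(** The differential of the radial projection at a point of the sphere is the
    orthogonal projection to the tangent plane. *)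
Lemma derive_normalize x u : tangent x u ->
  derivable normalize (val x) u /\ 'D_u normalize (val x) = u.
Proof.
rewrite /tangent => xu.
have dots : 0 < dot (val x) (val x) by rewrite S2_dot.
have dr : is_derive (val x) u (fun v : R3 => (Num.sqrt (dot v v))^-1) 0.
  have r := is_derive_rsqrt dots.
  have difr : differentiable (fun z => (Num.sqrt z)^-1) (dot (val x) (val x)).
    by apply/derivable1_diffP; case: r.
  have dd := is_derive_dot x u.
  have dd' : derivable (fun v : R3 => dot v v) (val x) u by case: dd.
  have D := @is_derive_comp R R3 R (fun v => dot v v)
    (fun z => (Num.sqrt z)^-1) (val x) u difr dd'.
  apply: (is_derive_eq D); rewrite derive_val xu mulr0 derive0 //.
have di (i : 'I_3) : is_derive (val x) u (fun v => normalize v 0 i) (u 0 i).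
  have := @is_deriveM _ _ _ (fun v : R3 => v 0 i) _ _ _ _ dr (is_derive_coord (val x) u i).
  rewrite (_ : _ * _ = fun v => normalize v 0 i); last by apply/funext => v; rewrite mxE.
  move=> h; apply: (is_derive_eq h).
  by rewrite S2_dot sqrtr1 invr1 scale1r scaler0 addr0.
have d : derivable normalize (val x) u.
  by apply/derivable_mxP => i j; rewrite ord1; have [] := di j.
split=> //; rewrite derive_mx //; apply/rowP => i; rewrite mxE.
by have [] := di i.
Qed.

(** Any smooth extension G computes the derivative along a tangent vector. This
    is needed to differentiate the partial derivatives of f, which are
    restrictions of functions that are not constant along rays. *)
Lemma dR_extension f x u (U : set R3) (G : R3 -> R) :
  open U -> U (val x) -> Ck 1 U G ->
  (forall y : S2, U (val y) -> G (val y) = f y) -> tangent x u ->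
  dR_S2 f x u = 'D_u G (val x).
Proof.
move=> oU Ux CG Gf tu; have [dN EN] := derive_normalize tu.
have [dG _] := Ck_differentiable oU CG Ux.
have dG' : differentiable G (normalize (val x)) by rewrite normalize_S2.
have D := is_derive_comp dG' dN.
rewrite dR_S2E -{2}(normalize_S2 x) -{2}EN -(@derive_val _ _ _ _ _ _ _ D).
apply: near_eq_derive.
have oV := open_normalize_preimage oU.
apply: (near_open_eq oV); last by split; [exact: S2_punctured|rewrite normalize_S2].
by move=> w [w0 Uw]; rewrite /hat -Gf val_to_S2.
Qed.

Lemma dR_coord i x u : tangent x u -> dR_S2 (fun y => val y 0 i) x u = u 0 i.
Proof.
move=> tu; rewrite (@dR_extension _ _ _ setT (fun v => v 0 i)) //.
- by have [] := is_derive_coord (val x) u i.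
- exact: openT.
- exact: Ck_coord.
Qed.

Lemma smooth_partial f i : smooth f -> smooth (partial f i).
Proof.
move=> sf x; exists punctured, ('D_(e_ i) (hat f)); split=> //.
- exact: punctured_open.
- exact: S2_punctured.
- by apply/smooth_onP => k; exact: Ck_partial (Ck_hat k.+1 sf).
Qed.

Lemma smooth_dR f X : smooth f -> vector_field X ->
  smooth (fun x => dR_S2 f x (X x)).
Proof.
move=> sf [_ sX].
apply: (@smooth_sub_ext _ _ _ _ (fun x => \sum_i X x 0 i * partial f i x)).
  by move=> x; rewrite dR_partialE.
by apply: smooth_sub_sum => i; apply: smooth_subM => //; exact: smooth_partial.
Qed.

Lemma partial2C f i j x : smooth f -> partial2 f i j x = partial2 f j i x.
Proof.
by move=> sf; exact: Ck_schwarz punctured_open (Ck_hat 2 sf) (S2_punctured x).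
Qed.

Lemma dR_partial f i x u : smooth f -> tangent x u ->
  dR_S2 (partial f i) x u = \sum_j u 0 j * partial2 f i j x.
Proof.
move=> sf tu; have CG := Ck_partial i (Ck_hat 2 sf).
have [_ E] := Ck_differentiable punctured_open CG (S2_punctured x).
by rewrite (dR_extension punctured_open (S2_punctured x) CG _ tu).
Qed.

Lemma dR_dR f x X Y : smooth f -> vector_field X -> vector_field Y ->
  dR_S2 (fun y => dR_S2 f y (Y y)) x (X x) =
  \sum_i dR_S2 (fun y => Y y 0 i) x (X x) * partial f i x +
  \sum_i \sum_j Y x 0 i * X x 0 j * partial2 f i j x.
Proof.
move=> sf [tX sX] [tY sY].
have -> : (fun y => dR_S2 f y (Y y)) =
    fun y => \sum_i Y y 0 i * partial f i y.
  by apply/funext => y; rewrite dR_partialE.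
have sP i : smooth (partial f i) by exact: smooth_partial.
rewrite dR_sum => [|i]; last exact: smooth_subM.
rewrite -big_split; apply: eq_bigr => i _ /=.
rewrite dRM // (dR_partial i sf (tX x)) mulr_sumr.
by congr (_ + _); apply: eq_bigr => j _; rewrite mulrA.
Qed.

(** The second-order terms cancel by the symmetry of second derivatives; the
    first-order terms are the components of the bracket. *)
Lemma dR_lie_bracket f x X Y : smooth f -> vector_field X -> vector_field Y ->
  dR_S2 (fun y => dR_S2 f y (Y y)) x (X x) -
  dR_S2 (fun y => dR_S2 f y (X y)) x (Y x) =
  dR_S2 f x (lie_bracket X Y x).
Proof.
move=> sf vX vY.
apply: etrans (congr2 (fun a b => a - b) (dR_dR x sf vX vY) (dR_dR x sf vY vX)) _.
apply: etrans _ (esym (dR_partialE x _ sf)).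
have -> : \sum_i \sum_j Y x 0 i * X x 0 j * partial2 f i j x =
    \sum_i \sum_j X x 0 i * Y x 0 j * partial2 f i j x.
  rewrite exchange_big; apply: eq_bigr => i _; apply: eq_bigr => j _ /=.
  by rewrite partial2C // [Y x 0 j * _]mulrC.
rewrite opprD addrACA subrr addr0 -sumrB; apply: eq_bigr => i _.
by rewrite mxE mulrBl.
Qed.

(** Differentiating <x, Y> = 0 along X gives <x, X Y> = - <X, Y>, which is
    symmetric in X and Y. *)
Lemma lie_bracket_tangent X Y x : vector_field X -> vector_field Y ->
  tangent x (lie_bracket X Y x).
Proof.
have H (Z T : S2 -> R3) : vector_field Z -> vector_field T ->
    \sum_i val x 0 i * dR_S2 (fun y => T y 0 i) x (Z x) = - dot (Z x) (T x).
  move=> [tZ sZ] [tT sT]; apply/eqP; rewrite -addr_eq0 addrC; apply/eqP.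
  rewrite /dot -big_split /=.
  transitivity (dR_S2 (fun y => \sum_i val y 0 i * T y 0 i) x (Z x)); last first.
    rewrite (_ : (fun y => _) = fun=> 0) ?dR_cst //.
    by apply/funext => y; exact: tT.
  rewrite dR_sum => [|i]; last by apply: smooth_subM => //; exact: smooth_sub_coord.
  apply: eq_bigr => i _; rewrite dRM //; last exact: smooth_sub_coord.
  by rewrite dR_coord.
move=> vX vY; rewrite /tangent /dot.
transitivity (\sum_i val x 0 i * dR_S2 (fun y => Y y 0 i) x (X x) -
    \sum_i val x 0 i * dR_S2 (fun y => X y 0 i) x (Y x)).
  by rewrite -sumrB; apply: eq_bigr => i _; rewrite mxE mulrBr.
by rewrite !H // dotC subrr.
Qed.

(** The orthogonal projection of a constant vector: it extends a given tangent
    vector to a global vector field, and the projections of the standard basis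
    span every tangent plane. *)
Definition tangent_field u x : R3 := u - dot (val x) u *: val x.

Lemma tangent_field_vector_field u : vector_field (tangent_field u).
Proof.
split=> [x|i].
  by rewrite /tangent /tangent_field dotDr dotNr dotZr S2_dot mulr1 subrr.
apply: (@smooth_sub_ext _ _ _ _ (fun x : S2 => u 0 i - dot (val x) u * val x 0 i)).
  by move=> x; rewrite !mxE.
apply: smooth_subB; first exact: smooth_sub_cst.
apply: smooth_subM; last exact: smooth_sub_coord.
apply: smooth_sub_sum => j; apply: smooth_subM; last exact: smooth_sub_cst.
exact: smooth_sub_coord.
Qed.

Lemma tangent_fieldE u x : tangent x u -> tangent_field u x = u.
Proof. by rewrite /tangent /tangent_field => ->; rewrite scale0r subr0. Qed.

Lemma tangent_decomposition x u : tangent x u ->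
  u = \sum_i u 0 i *: tangent_field (e_ i) x.
Proof.
move=> tu; under eq_bigr do rewrite /tangent_field scalerBr scalerA.
rewrite sumrB -row_sum_delta -scaler_suml.
rewrite (_ : \sum_i _ = 0) ?scale0r ?subr0 //.
rewrite -[RHS]tu; apply: eq_bigr => i _.
by rewrite dot_delta mulrC.
Qed.

End CalculusS2.

(** * Complex-valued functions *)

Local Opaque dR_S2.

Section ComplexParts.
Variable R : realType.
Local Notation C := R[i].
Implicit Types x y : C.

Lemma complex_ext x y : complex.Re x = complex.Re y -> complex.Im x = complex.Im y -> x = y.
Proof. by move=> e1 e2; apply/eqP; rewrite eq_complex e1 e2 !eqxx. Qed.

Lemma cReD x y : complex.Re (x + y) = complex.Re x + complex.Re y.
Proof. by case: x y => [a b] [c d]. Qed.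

Lemma cImD x y : complex.Im (x + y) = complex.Im x + complex.Im y.
Proof. by case: x y => [a b] [c d]. Qed.

Lemma cReN x : complex.Re (- x) = - complex.Re x.
Proof. by case: x. Qed.

Lemma cImN x : complex.Im (- x) = - complex.Im x.
Proof. by case: x. Qed.

Lemma cReM x y : complex.Re (x * y) =
  complex.Re x * complex.Re y - complex.Im x * complex.Im y.
Proof. by case: x y => [a b] [c d]. Qed.

Lemma cImM x y : complex.Im (x * y) =
  complex.Re x * complex.Im y + complex.Im x * complex.Re y.
Proof. by case: x y => [a b] [c d]. Qed.

Lemma Re_sum (I : Type) (r : seq I) (f : I -> C) :
  complex.Re (\sum_(i <- r) f i) = \sum_(i <- r) complex.Re (f i).
Proof. exact: (big_morph _ cReD). Qed.

Lemma Im_sum (I : Type) (r : seq I) (f : I -> C) :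
  complex.Im (\sum_(i <- r) f i) = \sum_(i <- r) complex.Im (f i).
Proof. exact: (big_morph _ cImD). Qed.

Definition simpC := (cReD, cImD, cReN, cImN, cReM, cImM).
End ComplexParts.

Section SmoothSubC.
Variables (R : realType) (M : Type) (n : nat) (emb : M -> 'rV[R]_n).
Local Notation C := R[i].
Local Notation smooth := (@smooth_subC R M n emb).
Implicit Types f g : M -> C.

Lemma smooth_subC_cst (a : C) : smooth (fun=> a).
Proof. by split; exact: smooth_sub_cst. Qed.

Lemma smooth_subC_real (f : M -> R) : smooth_sub emb f -> smooth (fun m => (f m)%:C).
Proof. by move=> sf; split => //=; exact: smooth_sub_cst. Qed.

Lemma smooth_subCD f g : smooth f -> smooth g -> smooth (fun m => f m + g m).
Proof.
move=> [f1 f2] [g1 g2]; split; [have := smooth_subD f1 g1|have := smooth_subD f2 g2];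
  by apply: smooth_sub_ext => m; rewrite simpC.
Qed.

Lemma smooth_subCM f g : smooth f -> smooth g -> smooth (fun m => f m * g m).
Proof.
move=> [f1 f2] [g1 g2]; split.
  have := smooth_subB (smooth_subM f1 g1) (smooth_subM f2 g2).
  by apply: smooth_sub_ext => m; rewrite simpC.
have := smooth_subD (smooth_subM f1 g2) (smooth_subM f2 g1).
by apply: smooth_sub_ext => m; rewrite simpC.
Qed.

Lemma smooth_subC_conj f : smooth f -> smooth (fun m => (f m)^*).
Proof.
move=> [f1 f2]; split; first by apply: smooth_sub_ext f1 => m; case: (f m).
by apply: smooth_sub_ext (smooth_subN f2) => m; case: (f m).
Qed.

Lemma smooth_subC_sum (I : Type) (r : seq I) (f : I -> M -> C) :
  (forall i, smooth (f i)) -> smooth (fun m => \sum_(i <- r) f i m).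
Proof.
move=> sf; elim: r => [|i r IH].
  by under eq_fun do rewrite big_nil; exact: smooth_subC_cst.
by under eq_fun do rewrite big_cons; exact: smooth_subCD.
Qed.

Lemma smooth_subCX f k : smooth f -> smooth (fun m => f m ^+ k).
Proof.
move=> sf; elim: k => [|k IH]; first exact: smooth_subC_cst.
by under eq_fun do rewrite exprS; exact: smooth_subCM.
Qed.

End SmoothSubC.

Section ComplexCalculusS2.
Variable R : realType.
Local Notation C := R[i].
Local Notation S2 := (S2 R).
Local Notation R3 := 'rV[R]_3.
Implicit Types (f g : S2 -> C) (x : S2) (u v : R3) (X Y : S2 -> R3).

Lemma eq_dR (f g : S2 -> R) x u : (forall y, f y = g y) ->
  dR_S2 f x u = dR_S2 g x u.
Proof. by move=> /funext ->. Qed.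

Lemma dS2_linear f x (a : R) u v : smooth_S2 f ->
  d_S2 f x (a *: u + v) = a%:C * d_S2 f x u + d_S2 f x v.
Proof.
move=> [f1 f2]; apply: complex_ext.
  by rewrite cReD cReM /= mul0r subr0; exact: dR_linear.
by rewrite cImD cImM /= mul0r addr0; exact: dR_linear.
Qed.

Lemma dS2_cst (a : C) x u : d_S2 (fun=> a) x u = 0.
Proof. by apply: complex_ext; exact: dR_cst. Qed.

Lemma dS2D f g x u : smooth_S2 f -> smooth_S2 g ->
  d_S2 (fun y => f y + g y) x u = d_S2 f x u + d_S2 g x u.
Proof.
move=> [f1 f2] [g1 g2]; apply: complex_ext.
  rewrite cReD -[RHS](dRD x u f1 g1).
  by apply: eq_dR => y; exact: cReD.
rewrite cImD -[RHS](dRD x u f2 g2).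
by apply: eq_dR => y; exact: cImD.
Qed.

Lemma dS2M f g x u : smooth_S2 f -> smooth_S2 g ->
  d_S2 (fun y => f y * g y) x u = d_S2 f x u * g x + f x * d_S2 g x u.
Proof.
move=> [f1 f2] [g1 g2]; apply: complex_ext; rewrite ?cReD ?cImD ?cReM ?cImM /=.
  transitivity (dR_S2 (fun y => complex.Re (f y) * complex.Re (g y) +
      - (complex.Im (f y) * complex.Im (g y))) x u).
    by apply: eq_dR => y; exact: cReM.
  rewrite dRD ?dRN ?dRM //; [ring|exact: smooth_subM|exact: smooth_subM|].
  by apply: smooth_subN; exact: smooth_subM.
transitivity (dR_S2 (fun y => complex.Re (f y) * complex.Im (g y) +
    complex.Im (f y) * complex.Re (g y)) x u).
  by apply: eq_dR => y; exact: cImM.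
by rewrite dRD ?dRM //; [ring|exact: smooth_subM|exact: smooth_subM].
Qed.

Lemma dS2_sum (I : Type) (r : seq I) (f : I -> S2 -> C) x u :
  (forall i, smooth_S2 (f i)) ->
  d_S2 (fun y => \sum_(i <- r) f i y) x u = \sum_(i <- r) d_S2 (f i) x u.
Proof.
move=> sf; elim: r => [|i r IH].
  by under eq_fun do rewrite big_nil; rewrite dS2_cst big_nil.
under eq_fun do rewrite big_cons.
by rewrite dS2D ?IH ?big_cons //; exact: smooth_subC_sum.
Qed.

Lemma smooth_dS2 f X : smooth_S2 f -> vector_field X ->
  smooth_S2 (fun x => d_S2 f x (X x)).
Proof. by move=> [f1 f2] vX; split; exact: smooth_dR. Qed.

Lemma dS2_lie_bracket f x X Y : smooth_S2 f -> vector_field X -> vector_field Y ->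
  d_S2 (fun y => d_S2 f y (Y y)) x (X x) -
  d_S2 (fun y => d_S2 f y (X y)) x (Y x) =
  d_S2 f x (lie_bracket X Y x).
Proof.
by move=> [f1 f2] vX vY; apply: complex_ext; rewrite !simpC /=; exact: dR_lie_bracket.
Qed.

Lemma dS2_real (f : S2 -> R) x u : d_S2 (fun y => (f y)%:C) x u = (dR_S2 f x u)%:C.
Proof. by apply: complex_ext => //=; rewrite dR_cst. Qed.

End ComplexCalculusS2.

(** * The Hopf fibration *)

Section Hopf.
Variable R : realType.
Local Notation C := R[i].
Local Notation S2 := (S2 R).
Local Notation S3 := (S3 R).
Local Notation emb3 := (@S3_coord R).

Lemma smooth_alpha : smooth_subC emb3 (@alpha R).
Proof.
split; [have := smooth_sub_coord emb3 0|have := smooth_sub_coord emb3 1];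
  by apply: smooth_sub_ext => p; rewrite mxE.
Qed.

Lemma smooth_gamma : smooth_subC emb3 (@gamma R).
Proof.
split; [have := smooth_sub_coord emb3 2|have := smooth_sub_coord emb3 3];
  by apply: smooth_sub_ext => p; rewrite mxE.
Qed.

Lemma Ck_row3 n k (W : set 'rV[R]_n) (F0 F1 F2 : 'rV[R]_n -> R) :
  Ck k W F0 -> Ck k W F1 -> Ck k W F2 ->
  forall i, Ck k W (fun v => row3 (F0 v) (F1 v) (F2 v) 0 i).
Proof.
move=> C0 C1 C2 [[|[|[|//]]] i3]; set i := Ordinal i3;
  [have -> : (fun v => row3 (F0 v) (F1 v) (F2 v) 0 i) = F0
  |have -> : (fun v => row3 (F0 v) (F1 v) (F2 v) 0 i) = F1
  |have -> : (fun v => row3 (F0 v) (F1 v) (F2 v) 0 i) = F2] => //;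
  by apply/funext => v; rewrite mxE.
Qed.

Definition row4 (a b c d : R) : 'rV[R]_4 := \row_(i < 4) [:: a; b; c; d]`_i.

Lemma Ck_row4 n k (W : set 'rV[R]_n) (F0 F1 F2 F3 : 'rV[R]_n -> R) :
  Ck k W F0 -> Ck k W F1 -> Ck k W F2 -> Ck k W F3 ->
  forall i, Ck k W (fun v => row4 (F0 v) (F1 v) (F2 v) (F3 v) 0 i).
Proof.
move=> C0 C1 C2 C3 [[|[|[|[|//]]]] i4]; set i := Ordinal i4;
  [have -> : (fun v => row4 (F0 v) (F1 v) (F2 v) (F3 v) 0 i) = F0
  |have -> : (fun v => row4 (F0 v) (F1 v) (F2 v) (F3 v) 0 i) = F1
  |have -> : (fun v => row4 (F0 v) (F1 v) (F2 v) (F3 v) 0 i) = F2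
  |have -> : (fun v => row4 (F0 v) (F1 v) (F2 v) (F3 v) 0 i) = F3] => //;
  by apply/funext => v; rewrite mxE.
Qed.

Lemma hopf_rowE (p : S3) (q := S3_coord p) : hopf_row p =
  row3 (2 * (q 0 0 * q 0 2 + q 0 1 * q 0 3)) (2 * (q 0 0 * q 0 3 - q 0 1 * q 0 2))
       (q 0 0 * q 0 0 + q 0 1 * q 0 1 - q 0 2 * q 0 2 - q 0 3 * q 0 3).
Proof.
rewrite /q !mxE /= /hopf_row; case: p {q} => [[[a b] [c d]] /= _].
by rewrite /alpha /gamma /=; congr row3; ring.
Qed.

Lemma smooth_sub_hopf (f : S2 -> R) : smooth_sub (fun x : S2 => val x) f ->
  smooth_sub emb3 (fun p => f (hopf p)).
Proof.
apply: smooth_sub_comp => p.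
exists setT, (fun q : 'rV[R]_4 =>
  row3 (2 * (q 0 0 * q 0 2 + q 0 1 * q 0 3)) (2 * (q 0 0 * q 0 3 + -1 * (q 0 1 * q 0 2)))
       (q 0 0 * q 0 0 + q 0 1 * q 0 1 + -1 * (q 0 2 * q 0 2 + q 0 3 * q 0 3))), (@hopf R).
split=> //; first exact: openT.
- have oT : open [set: 'rV[R]_4] := openT.
  move=> k; apply: Ck_row3;
  by repeat first [exact: Ck_coord | exact: Ck_cst | apply: CkM => // | apply: CkD => //].
- move=> p' _; split=> //; rewrite /= hopf_rowE; congr row3; ring.
Qed.

Lemma smooth_subC_hopf (f : S2 -> C) : smooth_S2 f ->
  smooth_subC emb3 (fun p => f (hopf p)).
Proof.
by move=> [f1 f2]; split; [exact: (smooth_sub_hopf f1)|exact: (smooth_sub_hopf f2)].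
Qed.

(** The value is meaningful only when the four reals have unit Euclidean norm. *)
Definition S3_of (a b c d : R) : S3 :=
  insubd (one_S3 R) (a +i* b, c +i* d).

Lemma val_S3_of (a b c d : R) : a ^+ 2 + b ^+ 2 + c ^+ 2 + d ^+ 2 = 1 ->
  val (S3_of a b c d) = (a +i* b, c +i* d).
Proof.
move=> h; rewrite val_insubd ifT //= !sqr_normc; apply/eqP.
by apply: complex_ext; rewrite !simpC /=; [rewrite -h|]; ring.
Qed.

Lemma S3_coord_of (a b c d : R) : a ^+ 2 + b ^+ 2 + c ^+ 2 + d ^+ 2 = 1 ->
  S3_coord (S3_of a b c d) = row4 a b c d.
Proof. by move=> h; rewrite /S3_coord /alpha /gamma val_S3_of. Qed.

Lemma S2_sqr (x : S2) (v := val x) : v 0 0 ^+ 2 + v 0 1 ^+ 2 + v 0 2 ^+ 2 = 1.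
Proof.
rewrite -(S2_dot x) /dot !big_ord_recl big_ord0 addr0 !expr2 addrA.
by congr (v 0 _ * v 0 _ + v 0 _ * v 0 _ + v 0 _ * v 0 _); apply: val_inj.
Qed.

Lemma row3_eta (v : 'rV[R]_3) : v = row3 (v 0 0) (v 0 1) (v 0 2).
Proof.
apply/rowP => -[[|[|[|//]]] i3]; rewrite mxE /=; congr (v 0 _); exact: val_inj.
Qed.

Lemma hopf_S3_of (a b c d : R) (x : S2) : a ^+ 2 + b ^+ 2 + c ^+ 2 + d ^+ 2 = 1 ->
  val x 0 0 = 2 * (a * c + b * d) -> val x 0 1 = 2 * (a * d - b * c) ->
  val x 0 2 = a * a + b * b - c * c - d * d ->
  hopf (S3_of a b c d) = x.
Proof.
move=> h x0 x1 x2; apply: val_inj; rewrite /= hopf_rowE S3_coord_of //.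
by rewrite [RHS]row3_eta x0 x1 x2 !mxE /=.
Qed.

Section LocalSections.
Variable x : S2.
Local Notation v := (val x : 'rV[R]_3).

Let rsq (s : R) : 0 < s -> (Num.sqrt s)^-1 ^+ 2 = s^-1.
Proof. by move=> s0; rewrite exprVn sqr_sqrtr // ltW. Qed.

(** The section of the Hopf map over the complement of the south pole for which
    alpha is positive. *)
Definition south_section : S3 :=
  let r := (Num.sqrt (2 * (1 + v 0 2)))^-1 in
  S3_of ((1 + v 0 2) * r) 0 (v 0 0 * r) (v 0 1 * r).

(** The section over the complement of the north pole for which gamma is
    positive. *)
Definition north_section : S3 :=
  let r := (Num.sqrt (2 * (1 - v 0 2)))^-1 in
  S3_of (v 0 0 * r) (- (v 0 1 * r)) ((1 - v 0 2) * r) 0.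

Lemma south_sphere : 0 < 1 + v 0 2 ->
  let r := (Num.sqrt (2 * (1 + v 0 2)))^-1 in
  ((1 + v 0 2) * r) ^+ 2 + 0 ^+ 2 + (v 0 0 * r) ^+ 2 + (v 0 1 * r) ^+ 2 = 1.
Proof.
move=> s0; have s20 : 0 < 2 * (1 + v 0 2) by rewrite mulr_gt0.
have := rsq s20; set r := _^-1 => h /=; rewrite !exprMn h.
have := S2_sqr x => /= sx; move: (lt0r_neq0 s0) => n0.
by rewrite expr0n addr0 -!mulrDl [X in X / _](_ : _ = 2 * (1 + v 0 2)) ?divff ?lt0r_neq0 //;
  move: sx; move: (v 0 0) (v 0 1) (v 0 2) => a b c; nra.
Qed.

Lemma north_sphere : 0 < 1 - v 0 2 ->
  let r := (Num.sqrt (2 * (1 - v 0 2)))^-1 in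
  (v 0 0 * r) ^+ 2 + (- (v 0 1 * r)) ^+ 2 + ((1 - v 0 2) * r) ^+ 2 + 0 ^+ 2 = 1.
Proof.
move=> s0; have s20 : 0 < 2 * (1 - v 0 2) by rewrite mulr_gt0.
have := rsq s20; set r := _^-1 => h /=; rewrite sqrrN !exprMn h.
have := S2_sqr x => /= sx; move: (lt0r_neq0 s0) => n0.
by rewrite expr0n addr0 -!mulrDl [X in X / _](_ : _ = 2 * (1 - v 0 2)) ?divff ?lt0r_neq0 //;
  move: sx; move: (v 0 0) (v 0 1) (v 0 2) => a b c; nra.
Qed.

Lemma hopf_south : 0 < 1 + v 0 2 -> hopf south_section = x.
Proof.
move=> s0; have s20 : 0 < 2 * (1 + v 0 2) by rewrite mulr_gt0.
have := rsq s20; have := south_sphere s0; rewrite /south_section.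
set r := _^-1 => /= sph h; apply: hopf_S3_of => //;
  have := S2_sqr x => /= sx; move: (lt0r_neq0 s0) => n0; move: h n0 sx;
  move: r (v 0 0) (v 0 1) (v 0 2) {sph s20 s0} => r a b c h n0 sx.
- have -> : 2 * ((1 + c) * r * (a * r) + 0 * (b * r)) = 2 * (1 + c) * a * r ^+ 2 by ring.
  by rewrite h; field.
- have -> : 2 * ((1 + c) * r * (b * r) - 0 * (a * r)) = 2 * (1 + c) * b * r ^+ 2 by ring.
  by rewrite h; field.
- have -> : (1 + c) * r * ((1 + c) * r) + 0 * 0 - a * r * (a * r) - b * r * (b * r)
    = ((1 + c) ^+ 2 + c ^+ 2 - (a ^+ 2 + b ^+ 2 + c ^+ 2)) * r ^+ 2 by ring.
  by rewrite h sx; field.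
Qed.

Lemma hopf_north : 0 < 1 - v 0 2 -> hopf north_section = x.
Proof.
move=> s0; have s20 : 0 < 2 * (1 - v 0 2) by rewrite mulr_gt0.
have := rsq s20; have := north_sphere s0; rewrite /north_section.
set r := _^-1 => /= sph h; apply: hopf_S3_of => //;
  have := S2_sqr x => /= sx; move: (lt0r_neq0 s0) => n0; move: h n0 sx;
  move: r (v 0 0) (v 0 1) (v 0 2) {sph s20 s0} => r a b c h n0 sx.
- have -> : 2 * (a * r * ((1 - c) * r) + - (b * r) * 0) = 2 * (1 - c) * a * r ^+ 2 by ring.
  by rewrite h; field.
- have -> : 2 * (a * r * 0 - - (b * r) * ((1 - c) * r)) = 2 * (1 - c) * b * r ^+ 2 by ring.
  by rewrite h; field.
- have -> : a * r * (a * r) + - (b * r) * - (b * r) - (1 - c) * r * ((1 - c) * r) - 0 * 0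
    = ((a ^+ 2 + b ^+ 2 + c ^+ 2) - c ^+ 2 - (1 - c) ^+ 2) * r ^+ 2 by ring.
  by rewrite h sx; field.
Qed.

Lemma south_or_north : 0 < 1 + v 0 2 \/ 0 < 1 - v 0 2.
Proof. by have [h|h] := ltP 0 (1 + v 0 2); [left|right; lra]. Qed.

End LocalSections.

Lemma hopf_surj (x : S2) : exists p, hopf p = x.
Proof.
have [h|h] := south_or_north x.
  by exists (south_section x); exact: hopf_south.
by exists (north_section x); exact: hopf_north.
Qed.

Lemma open_affine (c : R) : open [set v : 'rV[R]_3 | 0 < 1 + c * v 0 2].
Proof.
have cc : continuous (fun v : 'rV[R]_3 => 1 + c * v 0 2).
  have C0 : Ck 0 setT (fun v : 'rV[R]_3 => 1 + c * v 0 2).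
    apply: CkD; [exact: openT|exact: Ck_cst|].
    by apply: CkM; [exact: openT|exact: Ck_cst|exact: Ck_coord].
  by move=> v; exact: (Ck_continuous C0).
rewrite (_ : [set v | _] = (fun v : 'rV[R]_3 => 1 + c * v 0 2) @^-1` [set y | 0 < y]) //.
by apply: open_comp => [v _|]; [exact: cc|exact: open_gt].
Qed.

(** Near each point the descended function is the pull-back of f by one of the
    two local sections. *)
Lemma smooth_sub_descend (f : S3 -> R) :
  (forall p g, f (act p g) = f p) -> smooth_sub emb3 f ->
  smooth_sub (fun x : S2 => val x) (descend f).
Proof.
move=> inv; apply: smooth_sub_comp => x.
have [h|h] := south_or_north x.
- pose W := [set v : 'rV[R]_3 | 0 < 1 + 1 * v 0 2].
  have oW : open W := @open_affine 1.
  pose r (v : 'rV[R]_3) := (Num.sqrt (2 * (1 + 1 * v 0 2)))^-1.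
  exists W, (fun v : 'rV[R]_3 => row4 ((1 + v 0 2) * r v) 0 (v 0 0 * r v) (v 0 1 * r v)),
    south_section.
  split=> //; first by rewrite /W /= mul1r.
  + have CA k : Ck k W (fun v : 'rV[R]_3 => 1 + 1 * v 0 2).
      apply: CkD => //; first exact: Ck_cst.
      by apply: CkM => //; [exact: Ck_cst|exact: Ck_coord].
    have Cr k : Ck k W r.
      apply: Ck_rsqrt => //; first by move=> v Wv; rewrite mulr_gt0.
      by apply: CkM => //; exact: Ck_cst.
    move=> k; apply: Ck_row4; last 3 first.
    * exact: Ck_cst.
    * by apply: CkM => //; exact: Ck_coord.
    * by apply: CkM => //; exact: Ck_coord.
    apply: CkM => //; apply: CkD => //; [exact: Ck_cst|exact: Ck_coord].
  + move=> y; rewrite /W /= mul1r => Wy; split.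
      by rewrite /south_section S3_coord_of ?/r ?mul1r //; exact: south_sphere.
    by rewrite -{1}(hopf_south Wy) descendE.
- pose W := [set v : 'rV[R]_3 | 0 < 1 + (-1) * v 0 2].
  have oW : open W := @open_affine (-1).
  pose r (v : 'rV[R]_3) := (Num.sqrt (2 * (1 + (-1) * v 0 2)))^-1.
  exists W, (fun v : 'rV[R]_3 => row4 (v 0 0 * r v) (-1 * (v 0 1 * r v))
      ((1 + -1 * v 0 2) * r v) 0), north_section.
  split=> //; first by rewrite /W /= mulN1r.
  + have CA k : Ck k W (fun v : 'rV[R]_3 => 1 + (-1) * v 0 2).
      apply: CkD => //; first exact: Ck_cst.
      by apply: CkM => //; [exact: Ck_cst|exact: Ck_coord].
    have Cr k : Ck k W r.
      apply: Ck_rsqrt => //; first by move=> v Wv; rewrite mulr_gt0.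
      by apply: CkM => //; exact: Ck_cst.
    move=> k; apply: Ck_row4; last exact: Ck_cst.
    * by apply: CkM => //; exact: Ck_coord.
    * by apply: CkM => //; [exact: Ck_cst|apply: CkM => //; exact: Ck_coord].
    * by apply: CkM.
  + move=> y; rewrite /W /= mulN1r => Wy; split.
      by rewrite /north_section S3_coord_of ?/r ?mulN1r //; exact: north_sphere.
    by rewrite -{1}(hopf_north Wy) descendE.
Qed.

Lemma smooth_S2_descend (f : S3 -> C) :
  (forall p g, f (act p g) = f p) -> smooth_subC emb3 f -> smooth_S2 (descend f).
Proof.
move=> inv [f1 f2]; split.
  by apply: (@smooth_sub_descend (fun p => complex.Re (f p))) => // p g; rewrite inv.
by apply: (@smooth_sub_descend (fun p => complex.Im (f p))) => // p g; rewrite inv.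
Qed.

(** Gives access to the value of [descend] when f is invariant along a single
    fibre only. *)
Lemma descend_at (T : Type) (f : S3 -> T) (x : S2) :
  exists p, hopf p = x /\ descend f x = f p.
Proof.
have [q hq] := hopf_surj x.
exists (xget (one_S3 R) [set p | hopf p = x]); split=> //.
exact: (@xgetPex _ (one_S3 R) [set p | hopf p = x] (ex_intro _ q hq)).
Qed.

End Hopf.

(** * Differential forms on the two-sphere *)

Section Forms.
Variable R : realType.
Local Notation C := R[i].
Local Notation S2 := (S2 R).
Local Notation S3 := (S3 R).
Local Notation R3 := 'rV[R]_3.
Local Notation e_ i := (delta_mx 0 i : R3).
Implicit Types (x : S2) (u v : R3) (X Y : S2 -> R3).

Lemma hopf_act (p : S3) g : hopf (act p g) = hopf p.
Proof.
have gg : val g * (val g)^* = 1 by rewrite -sqr_normc (eqP (valP g)) expr1n.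
have E (a b : C) : (a * val g)^* * (b * val g) = a^* * b.
  by rewrite (rmorphM (@conjc R)) /= mulrACA [(val g)^* * _]mulrC gg mulr1.
apply: val_inj; rewrite /= /hopf_row -!mulrA.
by rewrite !E.
Qed.

Lemma hopf_ind (P : S2 -> Prop) : (forall p, P (hopf p)) -> forall x, P x.
Proof. by move=> H x; have [p <-] := hopf_surj x. Qed.

(** The coefficient of dx_i when eta is written with the restrictions of the
    coordinate differentials, which span the cotangent spaces. *)
Definition form_coef (eta : form1 R) i x : C := eta x (tangent_field (e_ i) x).

(** The 2-form sum_i dh_i /\ dx_i, the exterior derivative of
    sum_i h_i dx_i. *)
Definition exterior (h : 'I_3 -> S2 -> C) : form2 R := fun x u v =>
  \sum_i (d_S2 (h i) x u * (v 0 i)%:C - d_S2 (h i) x v * (u 0 i)%:C).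

Lemma exterior_linear (h k : 'I_3 -> S2 -> C) (c : C) x u v :
  (forall i, smooth_S2 (h i)) -> (forall i, smooth_S2 (k i)) ->
  exterior (fun i y => h i y + c * k i y) x u v =
  exterior h x u v + c * exterior k x u v.
Proof.
move=> sh sk; rewrite /exterior mulr_sumr -big_split; apply: eq_bigr => i _ /=.
have sc : smooth_S2 (fun _ : S2 => c) by exact: smooth_subC_cst.
have D w : d_S2 (fun y => h i y + c * k i y) x w =
    d_S2 (h i) x w + c * d_S2 (k i) x w.
  rewrite (dS2D x w (sh i) (smooth_subCM sc (sk i))) (dS2M x w sc (sk i)).
  by rewrite dS2_cst mul0r add0r.
have alg (a b a' b' z w : C) : (a + c * b) * z - (a' + c * b') * w =
    a * z - a' * w + c * (b * z - b' * w) by ring.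
by rewrite !D; exact: alg.
Qed.

Section Form1.
Variable eta : form1 R.
Hypothesis eta_smooth : smooth_form1 eta.

Lemma smooth_form_coef i : smooth_S2 (form_coef eta i).
Proof. exact: eta_smooth.2 (tangent_field_vector_field _). Qed.

Lemma form1_0 x : eta x 0 = 0.
Proof.
have t0 : tangent x 0 by rewrite /tangent -(scale0r 0) dotZr mul0r.
have := eta_smooth.1 x 1 0 0 t0 t0; rewrite scaler0 addr0 mul1r.
by rewrite -[X in X = _]addr0 => /addrI <-.
Qed.

Lemma form1_sum x (I : Type) (r : seq I) (a : I -> R) (u : I -> R3) :
  (forall i, tangent x (u i)) ->
  tangent x (\sum_(i <- r) a i *: u i) /\
  eta x (\sum_(i <- r) a i *: u i) = \sum_(i <- r) (a i)%:C * eta x (u i).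
Proof.
move=> tu; elim: r => [|i r [IHt IH]].
  by rewrite !big_nil form1_0 /tangent -(scale0r 0) dotZr mul0r.
rewrite !big_cons eta_smooth.1 // IH; split=> //.
by rewrite /tangent dotDr dotZr IHt tu mulr0 addr0.
Qed.

Lemma form1E x u : tangent x u -> eta x u = \sum_i (u 0 i)%:C * form_coef eta i x.
Proof.
move=> tu; rewrite [in LHS](tangent_decomposition tu).
apply: (form1_sum _ _ _).2 => i; exact: (tangent_field_vector_field _).1.
Qed.

(** The invariant formula for the exterior derivative depends on the vector
    fields only through their values at x: after expansion in the dx_i the
    derivatives of the components of X and Y add up to those of the bracket. *)
Lemma exteriorE x X Y : vector_field X -> vector_field Y ->
  d_S2 (fun y => eta y (Y y)) x (X x) - d_S2 (fun y => eta y (X y)) x (Y x)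
    - eta x (lie_bracket X Y x) = exterior (form_coef eta) x (X x) (Y x).
Proof.
have H Z T : vector_field Z -> vector_field T ->
    d_S2 (fun y => eta y (T y)) x (Z x) =
    \sum_i (dR_S2 (fun y => T y 0 i) x (Z x))%:C * form_coef eta i x +
    \sum_i d_S2 (form_coef eta i) x (Z x) * (T x 0 i)%:C.
  move=> [tZ sZ] [tT sT]; rewrite -big_split /=.
  rewrite (_ : (fun y => _) = fun y => \sum_i (T y 0 i)%:C * form_coef eta i y); last first.
    by apply/funext => y; exact: form1E.
  have sT' i : smooth_S2 (fun y => (T y 0 i)%:C) by exact: smooth_subC_real.
  rewrite dS2_sum => [|i]; last first.
    by apply: smooth_subCM; [exact: sT'|exact: smooth_form_coef].
  apply: eq_bigr => i _; rewrite dS2M //; last exact: smooth_form_coef.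
  by rewrite dS2_real [X in _ + X]mulrC.
move=> vX vY; rewrite (H X Y vX vY) (H Y X vY vX).
rewrite form1E; last exact: lie_bracket_tangent.
have -> : \sum_i (lie_bracket X Y x 0 i)%:C * form_coef eta i x =
   \sum_i (dR_S2 (fun y => Y y 0 i) x (X x))%:C * form_coef eta i x -
   \sum_i (dR_S2 (fun y => X y 0 i) x (Y x))%:C * form_coef eta i x.
  rewrite -sumrB; apply: eq_bigr => i _; rewrite mxE -mulrBl; congr (_ * _).
  by rewrite rmorphB.
rewrite /exterior sumrB.
have alg (a b c d : C) : a + b - (c + d) - (a - c) = b - d by ring.
exact: alg.
Qed.

End Form1.
End Forms.

(** * Sections of L_mu and the connection of a frame *)

Section LineBundle.
Variables (R : realType) (mu : int).
Local Notation C := R[i].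
Local Notation S2 := (S2 R).
Local Notation S3 := (S3 R).
Local Notation R3 := 'rV[R]_3.
Local Notation emb3 := (@S3_coord R).
Local Notation is_section := (@is_section R mu).
Implicit Types (x : S2) (p : S3) (u v : R3) (X Y : S2 -> R3) (s : S3 -> C).

Lemma U1_char (g : U1 R) : (val g ^ (- mu))^* * val g ^ (- mu) = 1.
Proof.
have : (val g)^* * val g = 1 by rewrite mulrC -sqr_normc (eqP (valP g)) expr1n.
move: (val g) => z zz.
have z0 : z != 0 by apply/eqP => z0; move/eqP: zz; rewrite z0 mulr0 eq_sym oner_eq0.
have zV : z^* = z^-1 by rewrite -[LHS]mulr1 -(divff z0) mulrA zz mul1r.
rewrite (rmorphXz (@conjc R)) /=; last by rewrite unitfE.
by rewrite zV -expfzMl mulVf // exp1rz.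
Qed.

Lemma is_sectionD s s' : is_section s -> is_section s' ->
  is_section (fun p => s p + s' p).
Proof.
move=> [s1 s2] [s1' s2']; split; first exact: smooth_subCD.
by move=> p g; rewrite s2 s2' mulrDr.
Qed.

Lemma is_sectionZ (f : S2 -> C) s : smooth_S2 f -> is_section s ->
  is_section (fun p => f (hopf p) * s p).
Proof.
move=> sf [s1 s2]; split; first by apply: smooth_subCM => //; exact: smooth_subC_hopf.
by move=> p g; rewrite s2 hopf_act mulrCA.
Qed.

Lemma is_section0 : is_section (fun=> 0).
Proof. by split=> [|p g]; [exact: smooth_subC_cst|rewrite mulr0]. Qed.

Lemma is_section_sum (I : Type) (r : seq I) (s : I -> S3 -> C) :
  (forall i, is_section (s i)) -> is_section (fun p => \sum_(i <- r) s i p).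
Proof.
move=> ss; elim: r => [|i r IH].
  by under eq_fun do rewrite big_nil; exact: is_section0.
by under eq_fun do rewrite big_cons; exact: is_sectionD.
Qed.

Lemma section_pair_invariant s s' p g : is_section s -> is_section s' ->
  (s (act p g))^* * s' (act p g) = (s p)^* * s' p.
Proof.
move=> [_ s2] [_ s2']; rewrite s2 s2' (rmorphM (@conjc R)) /= mulrACA.
by rewrite U1_char mul1r.
Qed.

(** The Hermitian product of two sections, as a function on S^2. *)
Definition section_pair s s' : S2 -> C := descend (fun p => (s p)^* * s' p).

Lemma section_pairE s s' p : is_section s -> is_section s' ->
  section_pair s s' (hopf p) = (s p)^* * s' p.
Proof.
move=> ss ss'; apply: (@descendE _ _ (fun p => (s p)^* * s' p)) => q g.
exact: section_pair_invariant.
Qed.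

Lemma smooth_section_pair s s' : is_section s -> is_section s' ->
  smooth_S2 (section_pair s s').
Proof.
move=> ss ss'; apply: smooth_S2_descend => [q g|].
  exact: section_pair_invariant.
by apply: smooth_subCM; [apply: smooth_subC_conj; case: ss|case: ss'].
Qed.

Section Frame.
Variables (m : nat) (W : 'I_m -> S3 -> C).
Hypothesis W_section : forall k, is_section (W k).
Hypothesis W_norm : forall p, \sum_k (W k p)^* * W k p = 1.

Definition coef s k : S2 -> C := section_pair (W k) s.

Lemma smooth_coef s k : is_section s -> smooth_S2 (coef s k).
Proof. by move=> ss; exact: smooth_section_pair. Qed.

Lemma section_decomposition s p : is_section s ->
  s p = \sum_k coef s k (hopf p) * W k p.
Proof.
move=> ss; rewrite -[LHS]mul1r -(W_norm p) mulr_suml; apply: eq_bigr => k _.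
by rewrite /coef section_pairE // mulrAC.
Qed.

(** The projection of the trivial bundle onto the line bundle, in the frame W. *)
Definition projector x : 'M[C]_m := \matrix_(i, j) section_pair (W j) (W i) x.

Lemma smooth_projector i j : smooth_S2 (fun x => projector x i j).
Proof.
rewrite (_ : (fun x => _) = section_pair (W j) (W i)).
  exact: smooth_section_pair.
by apply/funext => x; rewrite mxE.
Qed.

Definition frame_col p : 'cV[C]_m := \col_k W k p.
Definition frame_row p : 'rV[C]_m := \row_k (W k p)^*.
Definition coef_row s x : 'rV[C]_m := \row_k coef s k x.
Definition dcoef_row s x u : 'rV[C]_m := \row_k d_S2 (coef s k) x u.

Lemma projector_frame p : projector (hopf p) = frame_col p *m frame_row p.
Proof.
apply/matrixP => i j; rewrite !mxE big_ord1 !mxE section_pairE //.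
exact: mulrC.
Qed.

Lemma frame_norm p : frame_row p *m frame_col p = 1%:M.
Proof.
apply/matrixP => i j; rewrite !ord1 mxE [RHS]mxE eqxx -(W_norm p).
by apply: eq_bigr => k _; rewrite !mxE.
Qed.

Lemma projector_idem x : projector x *m projector x = projector x.
Proof.
elim/hopf_ind: x => p; rewrite projector_frame mulmxA -(mulmxA (frame_col p)).
by rewrite frame_norm mulmx1.
Qed.

Lemma coef_row_frame s p : is_section s ->
  coef_row s (hopf p) = s p *: frame_row p.
Proof.
by move=> ss; apply/rowP => k; rewrite !mxE /coef section_pairE // mulrC.
Qed.

Lemma coef_row_projector s x : is_section s ->
  coef_row s x *m projector x = coef_row s x.
Proof.
move=> ss; elim/hopf_ind: x => p.
rewrite coef_row_frame // projector_frame -scalemxAl mulmxA frame_norm.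
by rewrite mul1mx.
Qed.

Local Notation e := projector.
Local Notation de := (d_mx projector).

Lemma d_mx_mul x u a b :
  \sum_k (de x u a k * e x k b + e x a k * de x u k b) = de x u a b.
Proof.
rewrite [RHS]mxE.
rewrite (_ : (fun y => e y a b) = fun y => \sum_k e y a k * e y k b); last first.
  by apply/funext => y; rewrite -{1}projector_idem mxE.
rewrite dS2_sum => [|k]; last by apply: smooth_subCM; exact: smooth_projector.
apply: eq_bigr => k _; rewrite dS2M; try exact: smooth_projector.
by rewrite !mxE.
Qed.

Lemma d_projector x u : de x u = de x u *m e x + e x *m de x u.
Proof.
apply/matrixP => a b; rewrite -[LHS]d_mx_mul big_split [RHS]mxE.
by congr (_ + _); rewrite [RHS]mxE.
Qed.

(** Multiply de = de e + e de by e on both sides. *)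
Lemma projector_d_projector x u : e x *m de x u *m e x = 0.
Proof.
have := congr1 (fun M => e x *m M *m e x) (d_projector x u).
rewrite /= mulmxDr mulmxDl !mulmxA projector_idem -!(mulmxA _ (e x) (e x)).
rewrite projector_idem => /esym /eqP.
by rewrite -subr_eq0 addrK => /eqP.
Qed.

Lemma dcoef_row_projector s x u : is_section s ->
  dcoef_row s x u = dcoef_row s x u *m e x + coef_row s x *m de x u.
Proof.
move=> ss; apply/rowP => k; rewrite [LHS]mxE.
rewrite (_ : coef s k = fun y => \sum_j coef s j y * e y j k); last first.
  apply/funext => y; have /rowP/(_ k) := coef_row_projector y ss.
  by rewrite !mxE => <-; apply: eq_bigr => j _; rewrite !mxE.
rewrite dS2_sum => [|j]; last first.
  by apply: smooth_subCM; [exact: smooth_coef|exact: smooth_projector].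
rewrite !mxE -big_split; apply: eq_bigr => j _ /=.
rewrite dS2M; [|exact: smooth_coef|exact: smooth_projector].
by rewrite !mxE.
Qed.

(** The connection induced on the line bundle by the trivial connection on the
    coefficients with respect to the frame. *)
Definition grassmann s p u : C :=
  \sum_k d_S2 (coef s k) (hopf p) u * W k p.

Lemma grassmann_section X s : vector_field X -> is_section s ->
  is_section (fun p => grassmann s p (X (hopf p))).
Proof.
move=> vX ss; apply: is_section_sum => k.
apply: (@is_sectionZ (fun x => d_S2 (coef s k) x (X x))) => //.
by apply: smooth_dS2 => //; exact: smooth_coef.
Qed.

Lemma grassmann_linear s p (a : R) u v : is_section s ->
  grassmann s p (a *: u + v) = a%:C * grassmann s p u + grassmann s p v.
Proof.
move=> ss; rewrite /grassmann mulr_sumr -big_split; apply: eq_bigr => k _ /=.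
by rewrite dS2_linear ?mulrDl ?mulrA //; exact: smooth_coef.
Qed.

Lemma grassmann_add s s' p u : is_section s -> is_section s' ->
  grassmann (fun q => s q + s' q) p u = grassmann s p u + grassmann s' p u.
Proof.
move=> ss ss'; rewrite /grassmann -big_split; apply: eq_bigr => k _ /=.
rewrite (_ : coef _ k = fun x => coef s k x + coef s' k x).
  by rewrite dS2D ?mulrDl //; exact: smooth_coef.
apply/funext; apply: hopf_ind => q; rewrite /coef !section_pairE ?mulrDr //.
exact: is_sectionD.
Qed.

Lemma coefZ (f : S2 -> C) s k : smooth_S2 f -> is_section s ->
  coef (fun q => f (hopf q) * s q) k = fun x => f x * coef s k x.
Proof.
move=> sf ss; apply/funext; apply: hopf_ind => q.
have e1 := section_pairE q (W_section k) (is_sectionZ sf ss).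
by rewrite /coef e1 (section_pairE q (W_section k) ss) mulrCA.
Qed.

Lemma grassmann_leibniz (f : S2 -> C) s p u : smooth_S2 f -> is_section s ->
  grassmann (fun q => f (hopf q) * s q) p u =
  d_S2 f (hopf p) u * s p + f (hopf p) * grassmann s p u.
Proof.
move=> sf ss; rewrite {1}(section_decomposition p ss) /grassmann !mulr_sumr.
rewrite -big_split; apply: eq_bigr => k _ /=.
rewrite coefZ // dS2M //; last exact: smooth_coef.
by rewrite mulrDl !mulrA.
Qed.

(** The coefficients of the derivative of s along Y are the row
    (Y f_l)_l multiplied by e, whence a second term that involves de. *)
Lemma grassmann_grassmann X Y s p : vector_field X -> vector_field Y ->
  is_section s ->
  grassmann (fun q => grassmann s q (Y (hopf q))) p (X (hopf p)) =
  \sum_k d_S2 (fun y => d_S2 (coef s k) y (Y y)) (hopf p) (X (hopf p)) * W k p +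
  (dcoef_row s (hopf p) (Y (hopf p)) *m de (hopf p) (X (hopf p)) *m frame_col p) 0 0.
Proof.
move=> vX vY ss; set x := hopf p.
have sd k : smooth_S2 (fun y => d_S2 (coef s k) y (Y y)).
  by apply: smooth_dS2 => //; exact: smooth_coef.
have Ec k : coef (fun q => grassmann s q (Y (hopf q))) k =
    fun y => \sum_l d_S2 (coef s l) y (Y y) * e y l k.
  apply/funext; apply: hopf_ind => q; rewrite /coef section_pairE //; last first.
    exact: grassmann_section.
  rewrite /grassmann mulr_sumr; apply: eq_bigr => l _.
  by rewrite mxE section_pairE // mulrCA.
have Ed k : d_S2 (coef (fun q => grassmann s q (Y (hopf q))) k) x (X x) =
    \sum_l (d_S2 (fun y => d_S2 (coef s l) y (Y y)) x (X x) * e x l k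
            + dcoef_row s x (Y x) 0 l * de x (X x) l k).
  rewrite Ec dS2_sum => [|l]; last first.
    by apply: smooth_subCM; [exact: sd|exact: smooth_projector].
  apply: eq_bigr => l _; rewrite dS2M; [|exact: sd|exact: smooth_projector].
  by rewrite !mxE.
rewrite {1}/grassmann -/x.
transitivity ((\row_l d_S2 (fun y => d_S2 (coef s l) y (Y y)) x (X x) *m e x *m frame_col p
    + dcoef_row s x (Y x) *m de x (X x) *m frame_col p) 0 0).
  rewrite -mulmxDl [RHS]mxE; apply: eq_bigr => k _; rewrite Ed big_split.
  rewrite [X in X * _ = _]addrC ![in RHS]mxE [in RHS]addrC.
  by congr ((_ + _) * _); apply: eq_bigr => l _; rewrite !mxE.
rewrite mxE /x projector_frame -!mulmxA frame_norm mulmx1 mulmxA; congr (_ + _).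
by rewrite mxE; apply: eq_bigr => k _; rewrite !mxE.
Qed.

(** Since f = f e, one has Yf = Yf e + f Ye; the first term dies against
    e Xe e = 0 because the frame column is fixed by e. *)
Lemma dcoef_d_projector s p u v : is_section s -> let x := hopf p in
  (dcoef_row s x v *m de x u *m frame_col p) 0 0 =
  s p * (frame_row p *m (de x v *m de x u) *m frame_col p) 0 0.
Proof.
move=> ss x.
have fe : frame_col p = e x *m frame_col p.
  by rewrite /x projector_frame -mulmxA frame_norm mulmx1.
rewrite (dcoef_row_projector x v ss) !mulmxDl {1}fe.
have -> : dcoef_row s x v *m e x *m de x u *m (e x *m frame_col p) = 0.
  transitivity (dcoef_row s x v *m (e x *m de x u *m e x) *m frame_col p).
    by rewrite !mulmxA.
  by rewrite projector_d_projector mulmx0 mul0mx.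
by rewrite add0r /x coef_row_frame // -!scalemxAl mxE !mulmxA.
Qed.

Lemma grassmann_lie_bracket X Y s p : vector_field X -> vector_field Y ->
  is_section s -> grassmann s p (lie_bracket X Y (hopf p)) =
  \sum_k d_S2 (fun y => d_S2 (coef s k) y (Y y)) (hopf p) (X (hopf p)) * W k p -
  \sum_k d_S2 (fun y => d_S2 (coef s k) y (X y)) (hopf p) (Y (hopf p)) * W k p.
Proof.
move=> vX vY ss; rewrite -sumrB; apply: eq_bigr => k _; rewrite -mulrBl.
by rewrite (dS2_lie_bracket (hopf p) (smooth_coef k ss) vX vY).
Qed.

Lemma tr_e_de_deE p u v : tr_e_de_de e (hopf p) u v =
  (frame_row p *m (de (hopf p) u *m de (hopf p) v) *m frame_col p) 0 0 -
  (frame_row p *m (de (hopf p) v *m de (hopf p) u) *m frame_col p) 0 0.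
Proof.
rewrite /tr_e_de_de; move: (hopf p) (projector_frame p) => x ->.
rewrite -mulmxA mxtrace_mulC mulmxBr mulmxBl.
by rewrite trace_mx11 mxE [X in _ + X]mxE.
Qed.

Lemma grassmann_curvature X Y s p : vector_field X -> vector_field Y ->
  is_section s ->
  grassmann (fun q => grassmann s q (Y (hopf q))) p (X (hopf p))
  - grassmann (fun q => grassmann s q (X (hopf q))) p (Y (hopf p))
  - grassmann s p (lie_bracket X Y (hopf p)) =
  - tr_e_de_de e (hopf p) (X (hopf p)) (Y (hopf p)) * s p.
Proof.
move=> vX vY ss.
have EX := grassmann_grassmann p vX vY ss.
have EY := grassmann_grassmann p vY vX ss.
rewrite (dcoef_d_projector p (X (hopf p)) (Y (hopf p)) ss) /= in EX.
rewrite (dcoef_d_projector p (Y (hopf p)) (X (hopf p)) ss) /= in EY.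
apply: etrans (congr2 (fun a b => a - b - grassmann s p (lie_bracket X Y (hopf p))) EX EY) _.
rewrite grassmann_lie_bracket // tr_e_de_deE.
have alg (a b c d z : C) : a + z * c - (b + z * d) - (a - b) = - (d - c) * z by ring.
exact: alg.
Qed.

End Frame.
End LineBundle.

(** * Arbitrary connections and the first Chern class *)

Section Connections.
Variables (R : realType) (mu : int).
Local Notation C := R[i].
Local Notation S2 := (S2 R).
Local Notation S3 := (S3 R).
Local Notation R3 := 'rV[R]_3.
Local Notation e_ i := (delta_mx 0 i : R3).
Local Notation is_section := (@is_section R mu).
Implicit Types (x : S2) (p : S3) (u v : R3) (X Y : S2 -> R3) (s : S3 -> C).
Variables (m : nat) (W : 'I_m -> S3 -> C).
Hypothesis W_section : forall k, is_section (W k).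
Hypothesis W_norm : forall p, \sum_k (W k p)^* * W k p = 1.
Local Notation e := (projector W).
Local Notation grassmann := (grassmann W).

Section ConnectionForm.
Variable nabla : cov_deriv R.
Hypothesis nabla_conn : is_connection mu nabla.

Lemma connection_equivariant s p g u : is_section s -> tangent (hopf p) u ->
  nabla s (act p g) u = val g ^ (- mu) * nabla s p u.
Proof.
move=> ss tu.
have [_ /(_ p g)] := connection_section nabla_conn (tangent_field_vector_field u) ss.
by rewrite /nabla_along hopf_act tangent_fieldE.
Qed.

(** The difference between nabla and [grassmann], read off from the values of
    nabla on the frame. *)
Definition connection_form : form1 R := fun x u =>
  descend (fun p => \sum_k (W k p)^* * nabla (W k) p u) x.

(** nabla is equivariant on tangent vectors only, so the representative chosen
    by [descend] has to be compared with p directly. *)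
Lemma connection_formE p u : tangent (hopf p) u ->
  connection_form (hopf p) u = \sum_k (W k p)^* * nabla (W k) p u.
Proof.
move=> tu; rewrite /connection_form.
have [q [hq ->]] := descend_at
  (fun p => \sum_k (W k p)^* * nabla (W k) p u) (hopf p).
have [g ->] := hopf_fibre (esym hq); apply: eq_bigr => k _.
rewrite connection_equivariant // (W_section k).2 (rmorphM (@conjc R)) /=.
by rewrite mulrACA U1_char mul1r.
Qed.

Lemma connection_form_smooth : smooth_form1 connection_form.
Proof.
split=> [x a u v|X vX].
  elim/hopf_ind: x => p tu tv.
  have tauv : tangent (hopf p) (a *: u + v).
    by rewrite /tangent dotDr dotZr tu tv mulr0 addr0.
  rewrite !connection_formE // mulr_sumr -big_split; apply: eq_bigr => k _ /=.
  by rewrite (connection_linear nabla_conn) // mulrDr mulrCA.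
have sW k := connection_section nabla_conn vX (W_section k).
have : smooth_S2 (fun x => \sum_k section_pair (W k) (nabla_along nabla X (W k)) x).
  by apply: smooth_subC_sum => k; exact: (smooth_section_pair (W_section k)).
congr smooth_S2; apply/funext; apply: hopf_ind => p.
rewrite connection_formE; last exact: vX.1.
by apply: eq_bigr => k _; exact: (section_pairE p (W_section k) (sW k)).
Qed.

Lemma connection_0 p u : tangent (hopf p) u -> nabla (fun=> 0) p u = 0.
Proof.
move=> tu; have s0 : smooth_S2 (fun _ : S2 => 0 : C) by exact: smooth_subC_cst.
have := connection_leibniz nabla_conn s0 (is_section0 R mu) tu.
have -> : (fun _ : S3 => 0 * 0 : C) = (fun=> 0).
  by apply/funext => q; rewrite mul0r.
by rewrite dS2_cst !mul0r addr0.
Qed.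

Lemma connection_sum (I : Type) (r : seq I) (s : I -> S3 -> C) p u :
  (forall i, is_section (s i)) -> tangent (hopf p) u ->
  nabla (fun q => \sum_(i <- r) s i q) p u = \sum_(i <- r) nabla (s i) p u.
Proof.
move=> ss tu; elim: r => [|i r IH].
  by under eq_fun do rewrite big_nil; rewrite big_nil connection_0.
under eq_fun do rewrite big_cons.
rewrite big_cons -IH (connection_add nabla_conn) //.
exact: is_section_sum.
Qed.

(** Apply the Leibniz rule to s = sum_k f_k W_k. *)
Lemma connectionE s p u : is_section s -> tangent (hopf p) u ->
  nabla s p u = grassmann s p u + connection_form (hopf p) u * s p.
Proof.
move=> ss tu.
have sc k : smooth_S2 (coef W s k) by exact: smooth_coef.
have {1}-> : s = fun q => \sum_k coef W s k (hopf q) * W k q.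
  by apply/funext => q; exact: section_decomposition.
rewrite connection_sum //; last by move=> k; exact: is_sectionZ.
rewrite connection_formE // mulr_suml -big_split; apply: eq_bigr => k _ /=.
rewrite (connection_leibniz nabla_conn (sc k) (W_section k) tu); congr (_ + _).
rewrite /coef (section_pairE p (W_section k) ss).
by rewrite mulrAC.
Qed.

Definition curvature_form : form2 R := fun x u v =>
  - tr_e_de_de e x u v + exterior (form_coef connection_form) x u v.

Lemma connection_curvature X Y s p : vector_field X -> vector_field Y ->
  is_section s ->
  nabla_along nabla X (nabla_along nabla Y s) p
  - nabla_along nabla Y (nabla_along nabla X s) p
  - nabla_along nabla (lie_bracket X Y) s p
  = curvature_form (hopf p) (X (hopf p)) (Y (hopf p)) * s p.
Proof.
move=> vX vY ss; pose a := connection_form; have sa := connection_form_smooth.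
have step Z T : vector_field Z -> vector_field T ->
    nabla_along nabla Z (nabla_along nabla T s) p =
    grassmann (fun q => grassmann s q (T (hopf q))) p (Z (hopf p)) +
    (d_S2 (fun y => a y (T y)) (hopf p) (Z (hopf p)) * s p +
     a (hopf p) (T (hopf p)) * grassmann s p (Z (hopf p))) +
    a (hopf p) (Z (hopf p)) * (grassmann s p (T (hopf p)) + a (hopf p) (T (hopf p)) * s p).
  move=> vZ vT.
  have sT : smooth_S2 (fun y => a y (T y)) by exact: sa.2.
  have gT : is_section (fun q => grassmann s q (T (hopf q))) by exact: grassmann_section.
  have aT : is_section (fun q => a (hopf q) (T (hopf q)) * s q).
    exact: (is_sectionZ sT ss).
  rewrite {1}/nabla_along.
  have -> : nabla_along nabla T s =
      fun q => grassmann s q (T (hopf q)) + a (hopf q) (T (hopf q)) * s q.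
    by apply/funext => q; rewrite /nabla_along connectionE //; exact: vT.1.
  rewrite connectionE; [|exact: is_sectionD|exact: vZ.1].
  rewrite (grassmann_add W_section p (Z (hopf p)) gT aT).
  by rewrite (grassmann_leibniz W_section W_norm p (Z (hopf p)) sT ss).
rewrite (step X Y vX vY) (step Y X vY vX) {step}.
rewrite {1}/nabla_along connectionE //; last exact: lie_bracket_tangent.
rewrite /curvature_form mulrDl -(grassmann_curvature W_section W_norm p vX vY ss).
rewrite -(exteriorE sa (hopf p) vX vY) -/a.
have alg (gXY gYX dX dY gX gY gL aX aY aL z : C) :
    gXY + (dX * z + aY * gX) + aX * (gY + aY * z)
    - (gYX + (dY * z + aX * gY) + aY * (gX + aX * z)) - (gL + aL * z)
    = gXY - gYX - gL + (dX - dY - aL) * z by ring.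
exact: alg.
Qed.

(** The scalar is unique because some W_k does not vanish at the given point
    and because u and v extend to vector fields. *)
Lemma tr_curvatureE x u v : tangent x u -> tangent x v ->
  tr_curvature mu nabla x u v = curvature_form x u v.
Proof.
move=> tu tv; rewrite /tr_curvature; apply: xget_unique.
  move=> X Y s p vX vY ss hp Xx Yx.
  by rewrite connection_curvature // hp Xx Yx.
move=> z /= Hz; have [p hp] := hopf_surj x.
have vu := tangent_field_vector_field u; have vv := tangent_field_vector_field v.
have [k Wk0] : exists k, W k p != 0.
  apply/existsP; rewrite -[X in is_true X]negbK negb_exists; apply/negP => /forallP W0.
  have := W_norm p; rewrite big1 => [/eqP|k _]; first by rewrite eq_sym oner_eq0.
  by have := W0 k; rewrite negbK => /eqP ->; rewrite mulr0.
have := Hz _ _ (W k) p vu vv (W_section k) hp (tangent_fieldE tu) (tangent_fieldE tv).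
rewrite connection_curvature // hp !tangent_fieldE // => /(mulIf Wk0).
by move=> ->.
Qed.

End ConnectionForm.

Lemma grassmann_connection : is_connection mu grassmann.
Proof.
split.
- by move=> X s vX ss; exact: grassmann_section.
- by move=> s p a u v ss _ _; exact: grassmann_linear.
- by move=> s s' p u ss ss' _; exact: grassmann_add.
- by move=> f s p u sf ss _; exact: grassmann_leibniz.
Qed.

Lemma c1_nonempty : exists omega : form2 R, c1 mu omega.
Proof.
exists (c1_form mu grassmann), grassmann; first exact: grassmann_connection.
exists (fun _ _ => 0).
  split=> [x a u v _ _|X _]; first by rewrite mulr0 addr0.
  exact: smooth_subC_cst.
by move=> X Y x _ _; rewrite !dS2_cst !subr0 addr0.
Qed.

(** Both the exact term allowed by cohomology and the change of connection
    contribute terms of the form dh_i /\ dx_i. *)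
Lemma c1_representative omega : c1 mu omega ->
  exists h : 'I_3 -> S2 -> C, (forall i, smooth_S2 (h i)) /\
  forall x u v, tangent x u -> tangent x v ->
    omega x u v = (two_pi_i R)^-1 * tr_e_de_de e x u v + exterior h x u v.
Proof.
move=> [nabla conn [eta seta Heta]]; pose c := (two_pi_i R)^-1.
have sa := connection_form_smooth conn; set a := connection_form nabla in sa.
have sh i : smooth_S2 (form_coef eta i) by exact: smooth_form_coef.
have sk i : smooth_S2 (form_coef a i) by exact: smooth_form_coef.
have sck i : smooth_S2 (fun x => - c * form_coef a i x).
  by apply: smooth_subCM; [exact: smooth_subC_cst|exact: sk].
exists (fun i x => form_coef eta i x + - c * form_coef a i x); split.
  by move=> i; exact: (smooth_subCD (sh i) (sck i)).
move=> x u v tu tv.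
have vu := tangent_field_vector_field u; have vv := tangent_field_vector_field v.
have := Heta _ _ x vu vv; rewrite (exteriorE seta x vu vv) !tangent_fieldE // => ->.
rewrite /c1_form tr_curvatureE // /curvature_form -/a -/c.
rewrite (exterior_linear (- c) x u v sh sk).
have alg (E1 E2 T : C) : - c * (- T + E2) + E1 = c * T + (E1 + - c * E2) by ring.
exact: alg.
Qed.

End Connections.

(** * Spherical coordinates and the theorem of Stokes *)

Section Continuous2.
Variable R : realType.
Implicit Types f g : R -> R -> R.

Lemma continuous2_cst (a : R) : continuous2 (fun _ _ : R => a).
Proof. by move=> z; exact: cst_continuous. Qed.

Lemma continuous2D f g : continuous2 f -> continuous2 g ->
  continuous2 (fun t p => f t p + g t p).
Proof. by move=> cf cg z; apply: continuousD; [exact: cf|exact: cg]. Qed.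

Lemma continuous2M f g : continuous2 f -> continuous2 g ->
  continuous2 (fun t p => f t p * g t p).
Proof. by move=> cf cg z; apply: continuousM; [exact: cf|exact: cg]. Qed.

Lemma continuous2N f : continuous2 f -> continuous2 (fun t p => - f t p).
Proof. by move=> cf z; apply: continuousN; exact: cf. Qed.

Lemma continuous2_sum (I : finType) (f : I -> R -> R -> R) :
  (forall i, continuous2 (f i)) -> continuous2 (fun t p => \sum_i f i t p).
Proof.
move=> cf z; apply: (@continuous_sum R _ I (fun i (z : R * R) => f i z.1 z.2)) => i.
exact: cf.
Qed.

Lemma continuous2_fst (g : R -> R) : continuous g -> continuous2 (fun t _ : R => g t).
Proof. by move=> cg z; apply: (@continuous_comp _ _ _ fst g); [exact: cvg_fst|exact: cg]. Qed.

Lemma continuous2_snd (g : R -> R) : continuous g -> continuous2 (fun _ p : R => g p).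
Proof. by move=> cg z; apply: (@continuous_comp _ _ _ snd g); [exact: cvg_snd|exact: cg]. Qed.

Lemma continuous2_row3 (f0 f1 f2 : R -> R -> R) i :
  continuous2 f0 -> continuous2 f1 -> continuous2 f2 ->
  continuous2 (fun t p => row3 (f0 t p) (f1 t p) (f2 t p) 0 i).
Proof.
move: i => [[|[|[|//]]] i3] c0 c1 c2; set i := Ordinal i3;
  [have -> : (fun t p => row3 (f0 t p) (f1 t p) (f2 t p) 0 i) = f0
  |have -> : (fun t p => row3 (f0 t p) (f1 t p) (f2 t p) 0 i) = f1
  |have -> : (fun t p => row3 (f0 t p) (f1 t p) (f2 t p) 0 i) = f2] => //;
  by apply/funext => t; apply/funext => p; rewrite mxE.
Qed.

Lemma is_derive_row3 (f0 f1 f2 : R -> R) (d0 d1 d2 t : R) :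
  is_derive t (1 : R) f0 d0 -> is_derive t (1 : R) f1 d1 -> is_derive t (1 : R) f2 d2 ->
  is_derive t (1 : R) (fun s => row3 (f0 s) (f1 s) (f2 s)) (row3 d0 d1 d2).
Proof.
move=> h0 h1 h2.
have hi (i : 'I_3) : is_derive t (1 : R) (fun s => row3 (f0 s) (f1 s) (f2 s) 0 i)
    (row3 d0 d1 d2 0 i).
  move: i => [[|[|[|//]]] i3]; set i := Ordinal i3; rewrite [row3 d0 d1 d2 0 i]mxE /=;
  [have -> : (fun s => row3 (f0 s) (f1 s) (f2 s) 0 i) = f0
  |have -> : (fun s => row3 (f0 s) (f1 s) (f2 s) 0 i) = f1
  |have -> : (fun s => row3 (f0 s) (f1 s) (f2 s) 0 i) = f2] => //;
  by apply/funext => s; rewrite mxE.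
have d : derivable (fun s => row3 (f0 s) (f1 s) (f2 s)) t 1.
  by apply/derivable_mxP => i j; rewrite ord1; have [] := hi j.
split=> //; rewrite derive_mx //; apply/rowP => i; rewrite mxE.
by have [] := hi i.
Qed.

Lemma is_derive_bigsum (I : finType) (f : I -> R -> R) (df : I -> R) (t : R) :
  (forall i, is_derive t (1 : R) (f i) (df i)) ->
  is_derive t (1 : R) (fun s => \sum_i f i s) (\sum_i df i).
Proof.
move=> h; elim: (index_enum I) => [|i r IH].
  by under eq_fun do rewrite big_nil; rewrite big_nil; exact: is_derive_cst.
under eq_fun do rewrite big_cons; rewrite big_cons.
exact: (@is_deriveD _ _ _ (f i) (fun s => \sum_(j <- r) f j s)).
Qed.

End Continuous2.

Section Chart.
Variable R : realType.
Local Notation C := R[i].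
Local Notation S2 := (S2 R).
Local Notation R3 := 'rV[R]_3.
Local Notation smooth := (smooth_sub (fun x : S2 => val x)).

Definition chart_t (t p : R) : R3 := row3 (cos t * cos p) (cos t * sin p) (- sin t).
Definition chart_p (t p : R) : R3 := row3 (- (sin t * sin p)) (sin t * cos p) 0.
Definition chart_tp (t p : R) : R3 := row3 (- (cos t * sin p)) (cos t * cos p) 0.

Let is_derive_mulcst (f : R -> R) (c d t : R) : is_derive t (1 : R) f d ->
  is_derive t (1 : R) (fun s => f s * c) (d * c).
Proof.
move=> h; have := @is_deriveM _ _ f (fun=> c) t 1 d 0 h (is_derive_cst c t 1).
by move=> h'; apply: (is_derive_eq h'); rewrite scaler0 add0r /GRing.scale /= mulrC.
Qed.

Let is_derive_cstmul (f : R -> R) (c d t : R) : is_derive t (1 : R) f d ->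
  is_derive t (1 : R) (fun s => c * f s) (c * d).
Proof.
move=> /(is_derive_mulcst c); rewrite mulrC; congr is_derive.
by apply/funext => s; rewrite mulrC.
Qed.

Lemma is_derive_chart_t t p :
  is_derive t (1 : R) (fun s => val (chart s p)) (chart_t t p).
Proof.
exact: (is_derive_row3 (is_derive_mulcst (cos p) (is_derive_sin t))
  (is_derive_mulcst (sin p) (is_derive_sin t)) (is_derive_cos t)).
Qed.

Lemma is_derive_chart_p t p :
  is_derive p (1 : R) (fun s => val (chart t s)) (chart_p t p).
Proof.
rewrite /chart_p -mulrN.
exact: (is_derive_row3 (is_derive_cstmul (sin t) (is_derive_cos p))
  (is_derive_cstmul (sin t) (is_derive_sin p)) (is_derive_cst (cos t) p 1)).
Qed.

Lemma is_derive_chart_t_coord t p i :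
  is_derive p (1 : R) (fun s => chart_t t s 0 i) (chart_tp t p 0 i).
Proof.
have d : is_derive p (1 : R) (chart_t t) (chart_tp t p).
  rewrite /chart_tp -mulrN.
  exact: (is_derive_row3 (is_derive_cstmul (cos t) (is_derive_cos p))
    (is_derive_cstmul (cos t) (is_derive_sin p)) (is_derive_cst (- sin t) p 1)).
have dd : derivable (chart_t t) p 1 by case: d.
split; first by move/derivable_mxP : dd => /(_ 0 i).
have [_] := d; rewrite derive_mx // => /rowP /(_ i).
by rewrite mxE.
Qed.

Lemma is_derive_chart_p_coord t p i :
  is_derive t (1 : R) (fun s => chart_p s p 0 i) (chart_tp t p 0 i).
Proof.
have d : is_derive t (1 : R) (chart_p^~ p) (chart_tp t p).
  rewrite /chart_tp -mulrN.
  have E : chart_p^~ p = fun s => row3 (sin s * - sin p) (sin s * cos p) 0.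
    by apply/funext => s; rewrite /chart_p mulrN.
  rewrite E.
  exact: (is_derive_row3 (is_derive_mulcst (- sin p) (is_derive_sin t))
    (is_derive_mulcst (cos p) (is_derive_sin t)) (is_derive_cst 0 t 1)).
have dd : derivable (chart_p^~ p) t 1 by case: d.
split; first by move/derivable_mxP : dd => /(_ 0 i).
have [_] := d; rewrite derive_mx // => /rowP /(_ i).
by rewrite mxE.
Qed.

Lemma dot3 (a b c a' b' c' : R) :
  dot (row3 a b c) (row3 a' b' c') = a * a' + b * b' + c * c'.
Proof. by rewrite /dot !big_ord_recl big_ord0 !mxE /= addr0 addrA. Qed.

Lemma chart_t_tangent t p : tangent (chart t p) (chart_t t p).
Proof.
rewrite /tangent /= dot3.
transitivity (sin t * cos t * (cos p ^+ 2 + sin p ^+ 2) - sin t * cos t); first ring.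
by rewrite cos2Dsin2 mulr1 subrr.
Qed.

Lemma chart_p_tangent t p : tangent (chart t p) (chart_p t p).
Proof. rewrite /tangent /= dot3; ring. Qed.

Lemma chart_pullbackE (omega : form2 R) t p :
  chart_pullback omega t p = omega (chart t p) (chart_t t p) (chart_p t p).
Proof.
rewrite /chart_pullback !derive1E.
by congr (omega _ _ _);
  [have [] := is_derive_chart_t t p|have [] := is_derive_chart_p t p].
Qed.

(** The velocity of a curve on the sphere is the vector along which [dR_S2] has
    to be taken. *)
Lemma is_derive_smooth_curve (f : S2 -> R) (c : R -> S2) (t : R) u : smooth f ->
  is_derive t (1 : R) (fun s => val (c s)) u ->
  is_derive t (1 : R) (fun s => f (c s)) (dR_S2 f (c t) u).
Proof.
move=> sf dc; have [dF _] := hat_differentiable (c t) sf.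
have dc' : derivable (fun s => val (c s)) t 1 by case: dc.
have D := @is_derive_comp R R R3 (fun s => val (c s)) (homogeneous_ext f) t 1 dF dc'.
have E : 'D_1 (fun s => val (c s)) t = u by case: dc.
rewrite E -dR_S2E in D.
have Ef : (fun s => homogeneous_ext f (val (c s))) = (fun s => f (c s)).
  by apply/funext => s; exact: hatE.
by rewrite Ef in D.
Qed.

Lemma continuous2_chart_coord i : continuous2 (fun t p => val (chart t p) 0 i : R).
Proof.
apply: continuous2_row3.
- apply: continuous2M; [apply: continuous2_fst|apply: continuous2_snd].
    exact: continuous_sin.
  exact: continuous_cos.
- apply: continuous2M; [apply: continuous2_fst|apply: continuous2_snd];
  exact: continuous_sin.
- by apply: continuous2_fst; exact: continuous_cos.
Qed.

Lemma continuous2_smooth (f : S2 -> R) : smooth f ->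
  continuous2 (fun t p => f (chart t p)).
Proof.
move=> sf z.
have E : (fun z : R * R => f (chart z.1 z.2)) =
    (fun z : R * R => homogeneous_ext f (val (chart z.1 z.2))).
  by apply/funext => y; rewrite hatE.
rewrite E; apply: (@continuous_comp _ _ _ (fun z : R * R => val (chart z.1 z.2))).
  apply: continuous_rowP => i; exact: (@continuous2_chart_coord i).
exact: (Ck_continuous (Ck_hat 0 sf) (S2_punctured _)).
Qed.

Lemma continuous2_chart_t i : continuous2 (fun t p => chart_t t p 0 i).
Proof.
apply: continuous2_row3.
- by apply: continuous2M; [apply: continuous2_fst|apply: continuous2_snd];
  exact: continuous_cos.
- apply: continuous2M; [apply: continuous2_fst|apply: continuous2_snd].
    exact: continuous_cos.
  exact: continuous_sin.
- by apply: continuous2N; apply: continuous2_fst; exact: continuous_sin.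
Qed.

Lemma continuous2_chart_p i : continuous2 (fun t p => chart_p t p 0 i).
Proof.
apply: continuous2_row3.
- by apply: continuous2N; apply: continuous2M; [apply: continuous2_fst|apply: continuous2_snd];
  exact: continuous_sin.
- apply: continuous2M; [apply: continuous2_fst|apply: continuous2_snd].
    exact: continuous_sin.
  exact: continuous_cos.
- exact: continuous2_cst.
Qed.

Lemma continuous2_chart_tp i : continuous2 (fun t p => chart_tp t p 0 i).
Proof.
apply: continuous2_row3.
- apply: continuous2N; apply: continuous2M; [apply: continuous2_fst|apply: continuous2_snd].
    exact: continuous_cos.
  exact: continuous_sin.
- by apply: continuous2M; [apply: continuous2_fst|apply: continuous2_snd];
  exact: continuous_cos.
- exact: continuous2_cst.
Qed.

Lemma continuous2_dR (f : S2 -> R) (u : R -> R -> R3) : smooth f ->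
  (forall i, continuous2 (fun t p => u t p 0 i)) ->
  continuous2 (fun t p => dR_S2 f (chart t p) (u t p)).
Proof.
move=> sf cu.
have -> : (fun t p => dR_S2 f (chart t p) (u t p)) =
    fun t p => \sum_i u t p 0 i * partial f i (chart t p).
  by apply/funext => t; apply/funext => p; rewrite dR_partialE.
apply: continuous2_sum => i; apply: continuous2M; first exact: cu.
by apply: continuous2_smooth; exact: smooth_partial.
Qed.

(** The integrand is dP/dt + dQ/dp, where P is zero at both poles since the
    parallels shrink to points there, and Q is periodic in the longitude. *)
Lemma stokes_chart (f : 'I_3 -> S2 -> R) : (forall i, smooth (f i)) ->
  int2 0 pi 0 (2 * pi) (fun t p =>
    \sum_i (dR_S2 (f i) (chart t p) (chart_t t p) * chart_p t p 0 i -
            dR_S2 (f i) (chart t p) (chart_p t p) * chart_t t p 0 i)) = 0.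
Proof.
move=> sf; have pi0 : 0 < pi :> R := pi_gt0 R.
pose P t p := \sum_i f i (chart t p) * chart_p t p 0 i.
pose Q t p := \sum_i f i (chart t p) * - chart_t t p 0 i.
pose P' t p := \sum_i (dR_S2 (f i) (chart t p) (chart_t t p) * chart_p t p 0 i
   + f i (chart t p) * chart_tp t p 0 i).
pose Q' t p := \sum_i (dR_S2 (f i) (chart t p) (chart_p t p) * - chart_t t p 0 i
   + f i (chart t p) * - chart_tp t p 0 i).
have cf i := continuous2_smooth (sf i).
have cdt i : continuous2 (fun t p => dR_S2 (f i) (chart t p) (chart_t t p)).
  by apply: continuous2_dR => //; exact: continuous2_chart_t.
have cdp i : continuous2 (fun t p => dR_S2 (f i) (chart t p) (chart_p t p)).
  by apply: continuous2_dR => //; exact: continuous2_chart_p.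
have cP : continuous2 P.
  by apply: continuous2_sum => i; apply: continuous2M; [exact: cf|exact: continuous2_chart_p].
have cP' : continuous2 P'.
  apply: continuous2_sum => i; apply: continuous2D; apply: continuous2M;
    [exact: cdt|exact: continuous2_chart_p|exact: cf|exact: continuous2_chart_tp].
have cQ' : continuous2 Q'.
  apply: continuous2_sum => i; apply: continuous2D; apply: continuous2M.
  - exact: cdp.
  - by apply: continuous2N; exact: continuous2_chart_t.
  - exact: cf.
  - by apply: continuous2N; exact: continuous2_chart_tp.
have prod (a b : R -> R) (t da db : R) : is_derive t (1 : R) a da ->
    is_derive t (1 : R) b db ->
    is_derive t (1 : R) (fun s => a s * b s) (da * b t + a t * db).
  move=> ha hb; apply: (is_derive_eq (is_deriveM ha hb)).
  by rewrite /GRing.scale /= addrC; congr (_ + _); exact: mulrC.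
have dP t p : is_derive t (1 : R) (P^~ p) (P' t p).
  apply: is_derive_bigsum => i; apply: prod; last exact: is_derive_chart_p_coord.
  exact: (is_derive_smooth_curve (c := fun s => chart s p) (sf i) (is_derive_chart_t t p)).
have dQ t p : is_derive p (1 : R) (Q t) (Q' t p).
  apply: is_derive_bigsum => i; apply: prod.
    exact: (is_derive_smooth_curve (c := chart t) (sf i) (is_derive_chart_p t p)).
  apply: (@is_deriveN _ _ _ (fun s => chart_t t s 0 i)).
  exact: is_derive_chart_t_coord.
transitivity (int2 0 pi 0 (2 * pi) (fun t p => P' t p + Q' t p)).
  apply: int2_eq => t p; rewrite /P' /Q' -big_split; apply: eq_bigr => i _ /=.
  have alg (a b c d e g : R) : a * b - d * e = a * b + c * g + (d * - e + c * - g) by ring.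
  exact: alg.
rewrite (int2D 0 pi 0 (2 * pi) cP' cQ').
have P0 s : sin s = 0 -> forall p, P s p = 0.
  move=> s0 p; rewrite /P big1 // => -[[|[|[|//]]] i3] _;
  by rewrite /chart_p s0 mxE /= ?mul0r ?oppr0 mulr0.
rewrite (@int2_derive_fst R 0 pi 0 (2 * pi) P P' pi0 cP cP' dP); first last.
- by apply: P0; exact: sinpi.
- by apply: P0; exact: sin0.
rewrite (@int2_derive_snd R 0 pi 0 (2 * pi) Q Q') ?addr0 //.
- by rewrite mulr_gt0.
- move=> t; rewrite /Q.
  have c2 : cos (2 * pi) = 1 :> R by rewrite mulr_natl cos2pi.
  have s2 : sin (2 * pi) = 0 :> R by rewrite mulr_natl sin2pi.
  have -> : chart t 0 = chart t (2 * pi).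
    by apply: val_inj; rewrite /= c2 s2 cos0 sin0.
  by rewrite /chart_t c2 s2 cos0 sin0.
Qed.

Lemma int_S2E (omega : form2 R) : int_S2 omega =
  int2 0 pi 0 (2 * pi) (fun t p => complex.Re (chart_pullback omega t p)) +i*
  int2 0 pi 0 (2 * pi) (fun t p => complex.Im (chart_pullback omega t p)).
Proof. by []. Qed.

Definition continuous2C (g : R -> R -> C) : Prop :=
  continuous2 (fun t p => complex.Re (g t p)) /\
  continuous2 (fun t p => complex.Im (g t p)).

Definition continuous_pullback (omega : form2 R) : Prop :=
  continuous2C (chart_pullback omega).

Lemma int_S2_eq (omega omega' : form2 R) :
  (forall t p, chart_pullback omega t p = chart_pullback omega' t p) ->
  int_S2 omega = int_S2 omega'.
Proof. move=> E; rewrite !int_S2E.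
have -> : chart_pullback omega = chart_pullback omega'.
  by apply/funext => t; apply/funext => p.
by []. Qed.

Lemma int_S2D (omega omega' : form2 R) :
  continuous_pullback omega -> continuous_pullback omega' ->
  int_S2 (fun x u v => omega x u v + omega' x u v) = int_S2 omega + int_S2 omega'.
Proof.
move=> [c1 c2] [c1' c2']; apply: complex_ext.
  apply: etrans _ (esym (cReD (int_S2 omega) (int_S2 omega'))).
  apply: etrans _ (int2D 0 pi 0 (2 * pi) c1 c1').
  by apply: int2_eq => t p; exact: cReD.
apply: etrans _ (esym (cImD (int_S2 omega) (int_S2 omega'))).
apply: etrans _ (int2D 0 pi 0 (2 * pi) c2 c2').
by apply: int2_eq => t p; exact: cImD.
Qed.

Lemma continuous_pullbackD (omega omega' : form2 R) :
  continuous_pullback omega -> continuous_pullback omega' ->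
  continuous_pullback (fun x u v => omega x u v + omega' x u v).
Proof.
move=> [c1 c2] [c1' c2']; split.
  rewrite (_ : (fun t p => _) = fun t p => complex.Re (chart_pullback omega t p) +
    complex.Re (chart_pullback omega' t p)); first exact: continuous2D.
  by apply/funext => t; apply/funext => p; exact: cReD.
rewrite (_ : (fun t p => _) = fun t p => complex.Im (chart_pullback omega t p) +
  complex.Im (chart_pullback omega' t p)); first exact: continuous2D.
by apply/funext => t; apply/funext => p; exact: cImD.
Qed.

Lemma int2_0 a b c d : int2 a b c d (fun _ _ : R => 0) = 0.
Proof.
rewrite /int2; under eq_Rintegral do rewrite Rintegral_cst // mul0r.
by rewrite Rintegral_cst // mul0r.
Qed.

Lemma int_S2_sum (I : Type) (r : seq I) (omega : I -> form2 R) :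
  (forall i, continuous_pullback (omega i)) ->
  continuous_pullback (fun x u v => \sum_(i <- r) omega i x u v) /\
  int_S2 (fun x u v => \sum_(i <- r) omega i x u v) = \sum_(i <- r) int_S2 (omega i).
Proof.
move=> co; elim: r => [|i r [IHc IH]].
  have -> : (fun x u v => \sum_(i <- [::]) omega i x u v) = (fun _ _ _ => 0).
    by apply/funext => x; apply/funext => u; apply/funext => v; rewrite big_nil.
  split; first by split; exact: continuous2_cst.
  by rewrite big_nil int_S2E /chart_pullback /= int2_0.
have -> : (fun x u v => \sum_(j <- i :: r) omega j x u v) =
    (fun x u v => omega i x u v + \sum_(j <- r) omega j x u v).
  by apply/funext => x; apply/funext => u; apply/funext => v; rewrite big_cons.
split; first exact: continuous_pullbackD.
by rewrite int_S2D // IH big_cons.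
Qed.

Lemma stokes_S2 (h : 'I_3 -> S2 -> C) : (forall i, smooth_S2 (h i)) ->
  continuous_pullback (exterior h) /\ int_S2 (exterior h) = 0.
Proof.
move=> sh.
pose D (f : 'I_3 -> S2 -> R) t p := \sum_i (dR_S2 (f i) (chart t p) (chart_t t p) * chart_p t p 0 i -
            dR_S2 (f i) (chart t p) (chart_p t p) * chart_t t p 0 i).
have cD f : (forall i, smooth (f i)) -> continuous2 (D f).
  move=> sf; apply: continuous2_sum => i; apply: continuous2D.
    apply: continuous2M; last exact: continuous2_chart_p.
    by apply: continuous2_dR => //; exact: continuous2_chart_t.
  apply: continuous2N; apply: continuous2M; last exact: continuous2_chart_t.
  by apply: continuous2_dR => //; exact: continuous2_chart_p.
pose f1 i x := complex.Re (h i x); pose f2 i x := complex.Im (h i x).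
have s1 i : smooth (f1 i) by case: (sh i).
have s2 i : smooth (f2 i) by case: (sh i).
have E1 : (fun t p => complex.Re (chart_pullback (exterior h) t p)) = D f1.
  apply/funext => t; apply/funext => p; rewrite chart_pullbackE Re_sum.
  have alg (z w : C) (a b : R) : complex.Re (z * a%:C - w * b%:C) =
      complex.Re z * a - complex.Re w * b by case: z w => [? ?] [? ?] /=; ring.
  by apply: eq_bigr => i _; exact: alg.
have E2 : (fun t p => complex.Im (chart_pullback (exterior h) t p)) = D f2.
  apply/funext => t; apply/funext => p; rewrite chart_pullbackE Im_sum.
  have alg (z w : C) (a b : R) : complex.Im (z * a%:C - w * b%:C) =
      complex.Im z * a - complex.Im w * b by case: z w => [? ?] [? ?] /=; ring.
  by apply: eq_bigr => i _; exact: alg.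
split; first by split; rewrite ?E1 ?E2; exact: cD.
by rewrite int_S2E E1 E2 !stokes_chart.
Qed.

Lemma int_S2_sin (omega : form2 R) (c : C) :
  (forall t p, chart_pullback omega t p = c * (sin t)%:C) ->
  continuous_pullback omega /\ int_S2 omega = c * (4 * pi)%:C.
Proof.
move=> E; have pi0 : 0 < pi :> R := pi_gt0 R.
have I (a : R) : continuous2 (fun t _ : R => a * sin t) /\
    int2 0 pi 0 (2 * pi) (fun t _ : R => a * sin t) = a * (4 * pi).
  have cs : continuous (fun t : R => a * sin t).
    by move=> t; apply: continuousM; [exact: cst_continuous|exact: continuous_sin].
  split; first exact: continuous2_fst.
  have inner (t : R) : \int[lebesgue_measure]_(p in `[0, 2 * pi]) (a * sin t) =
      2 * pi * (a * sin t).
    have p20 : 0 < 2 * pi :> R by rewrite mulr_gt0.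
    have cc : continuous (fun _ : R => a * sin t) by move=> x; exact: cst_continuous.
    have d (x : R) : is_derive x (1 : R) (fun p => p * (a * sin t)) (a * sin t).
      rewrite -[X in is_derive _ _ _ X]mul1r.
      exact: (is_derive_mulcst (a * sin t) (is_derive_id x 1)).
    by apply: etrans (FTC_Rintegral p20 cc d) _; rewrite mul0r subr0.
  rewrite /int2; under eq_Rintegral do rewrite inner.
  have c2 : continuous (fun t : R => 2 * pi * (a * sin t)).
    move=> t; apply: (@continuousM _ _ (fun=> 2 * pi) (fun t => a * sin t)).
      exact: cst_continuous.
    exact: cs.
  have d (x : R) : is_derive x (1 : R) (fun t => - cos t * (2 * pi * a))
      (2 * pi * (a * sin x)).
    have dc := is_deriveN (is_derive_cos x).
    apply: (is_derive_eq (is_derive_mulcst (2 * pi * a) dc)).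
    by rewrite opprK; ring.
  apply: etrans (FTC_Rintegral pi0 c2 d) _.
  by rewrite cospi cos0; ring.
have RE t p : complex.Re (chart_pullback omega t p) = complex.Re c * sin t.
  by rewrite E cReM /= mulr0 subr0.
have IE t p : complex.Im (chart_pullback omega t p) = complex.Im c * sin t.
  by rewrite E cImM /= mulr0 add0r.
split.
  by split; under eq_fun do under eq_fun do rewrite ?RE ?IE; exact: (I _).1.
rewrite int_S2E; apply: complex_ext.
  by rewrite cReM /= mulr0 subr0 -(I _).2; exact: int2_eq.
by rewrite cImM /= mulr0 add0r -(I _).2; exact: int2_eq.
Qed.

End Chart.

(** * The projector of the monomial frame *)

Section Monomials.
Variables (R : realType) (mu : int).
Local Notation C := R[i].
(* The postfix star stands for either of two convertible conjugations,
   depending on the open scopes; this one is a ring morphism by declaration. *)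
Local Notation conj z := (Num.conj (z : C)).
Local Notation S2 := (S2 R).
Local Notation S3 := (S3 R).
Local Notation n := `|mu|%N.
Implicit Types (p : S3) (k : 'I_n.+1).

Definition sqrt_binomial k : C := (Num.sqrt ('C(n, k)%:R : R))%:C.

Arguments sqrt_binomial : simpl never.

Lemma sqrt_binomial_sqr k : sqrt_binomial k * sqrt_binomial k = 'C(n, k)%:R.
Proof.
rewrite /sqrt_binomial -rmorphM /= -expr2 sqr_sqrtr ?ler0n //.
by rewrite rmorph_nat.
Qed.

Lemma sqrt_binomial_neq0 k : sqrt_binomial k != 0.
Proof.
apply/eqP => h; have := sqrt_binomial_sqr k; rewrite h mulr0 => /esym/eqP.
by rewrite pnatr_eq0 eqn0Ngt bin_gt0 -ltnS ltn_ord.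
Qed.

Lemma conj_sqrt_binomial k : (conj (sqrt_binomial k)) = sqrt_binomial k.
Proof. exact: conjc_real. Qed.

(** Scaling by the root of the binomial coefficient absorbs the conjugation by
    A_mu, and turns the W_k into a Parseval frame
    ([monomial_section_norm]). *)
Definition monomial_section k p : C := sqrt_binomial k * w_tilde mu p k 0.
Local Notation W := monomial_section.

Lemma monomial_section_section k : is_section mu (W k).
Proof.
split.
  apply: smooth_subCM; first exact: smooth_subC_cst.
  have sa := smooth_alpha R; have sg := smooth_gamma R.
  under eq_fun do rewrite mxE.
  by case: (mu <= 0); apply: smooth_subCM; apply: smooth_subCX => //;
    exact: smooth_subC_conj.
move=> p g; rewrite /W !mxE.
have gg : (conj (val g)) * val g = 1 by rewrite mulrC -sqr_normc (eqP (valP g)) expr1n.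
have Ea : alpha (act p g) = alpha p * val g by [].
have Eg : gamma (act p g) = gamma p * val g by [].
rewrite {}Ea {}Eg; move: (val g) gg => z zz.
have z0 : z != 0 by apply/eqP => z0; move/eqP: zz; rewrite z0 mulr0 eq_sym oner_eq0.
have zV : (conj z) = z^-1 by rewrite -[LHS]mulr1 -(divff z0) mulrA zz mul1r.
have split_pow (a b c y : C) : a * y ^+ (n - k) * (b * y ^+ k) = y ^+ n * (a * b).
  have -> : y ^+ n = y ^+ (n - k) * y ^+ k by rewrite -exprD subnK // leq_ord.
  by ring.
case: ifP => mu0.
  have -> : - mu = n%:Z by rewrite lez0_abs.
  by rewrite !exprMn (split_pow _ _ 0) -exprnP mulrCA.
have -> : - mu = - n%:Z by rewrite gtz0_abs // ltNge mu0.
rewrite -exprz_inv -zV !(rmorphM Num.conj) /= !exprMn (split_pow _ _ 0).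
by rewrite -exprnP mulrCA.
Qed.

Lemma conj_monomial k p : (conj (W k p)) * sqrt_binomial k = v_tilde mu p k 0.
Proof.
have -> : (conj (W k p)) = sqrt_binomial k * (conj (w_tilde mu p k 0)).
  apply: etrans (rmorphM Num.conj (sqrt_binomial k) (w_tilde mu p k 0)) _.
  by congr (_ * _); exact: conj_sqrt_binomial.
rewrite mulrAC sqrt_binomial_sqr !mxE.
by case: ifP => _; rewrite (rmorphM Num.conj) !(rmorphXn Num.conj) /= ?conjCK mulrA.
Qed.

(** The binomial theorem for |alpha|^2 + |gamma|^2 = 1. *)
Lemma monomial_section_norm p : \sum_k (conj (W k p)) * W k p = 1.
Proof.
have -> : 1 = (alpha p * (conj (alpha p)) + gamma p * (conj (gamma p)) ) ^+ n :> C.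
  by rewrite S3_conj expr1n.
rewrite exprDn; apply: eq_bigr => k _.
rewrite /W mulrA conj_monomial !mxE -mulr_natl !exprMn.
case: ifP => _; ring.
Qed.

Lemma invmx_A : invmx (A_mx R mu) = diag_mx (\row_k (sqrt_binomial k)^-1).
Proof.
have h : A_mx R mu *m diag_mx (\row_k (sqrt_binomial k)^-1) = 1%:M.
  rewrite mul_diag_mx; apply/matrixP => i j; rewrite !mxE.
  have [->|ij] := eqVneq i j; last by rewrite mulr0n mulr0.
  by rewrite !mulr1n divff //; exact: sqrt_binomial_neq0.
have [uA _] := mulmx1_unit h.
by rewrite -[LHS]mulmx1 -h mulmxA mulVmx // mul1mx.
Qed.

Lemma E_hopf p : E mu (hopf p) = \matrix_(i, j) (W i p * (conj (W j p))).
Proof.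
rewrite /E descendE; last exact: E_S3_invariant.
apply/matrixP => i j; rewrite /E_S3 invmx_A mul_diag_mx mul_mx_diag !mxE big_ord1.
rewrite [X in _ * (_ * X) * _]mxE -conj_monomial /W -/(sqrt_binomial i).
have alg (a c w y : C) : c != 0 -> a * (w * (y * c)) * c^-1 = a * w * y.
  by move=> c0; field.
exact: alg (sqrt_binomial_neq0 j).
Qed.

Lemma E_projector : E mu = projector W :> (S2 -> 'M[C]_n.+1).
Proof.
apply/funext; apply: hopf_ind => p; rewrite E_hopf.
apply/matrixP => i j; rewrite !mxE.
rewrite (section_pairE p (monomial_section_section j) (monomial_section_section i)).
exact: mulrC.
Qed.

End Monomials.

(** * The curvature integrand *)

Section ComplexDerivative.
Variable R : realType.
Local Notation C := R[i].
Local Notation conj z := (Num.conj (z : C)).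

Definition is_deriveC (t : R) (f : R -> C) (d : C) : Prop :=
  is_derive t (1 : R) (fun s => complex.Re (f s)) (complex.Re d) /\
  is_derive t (1 : R) (fun s => complex.Im (f s)) (complex.Im d).

Lemma is_deriveC_cst t (a : C) : is_deriveC t (fun=> a) 0.
Proof. by split; exact: is_derive_cst. Qed.

Lemma is_deriveCM t (f g : R -> C) (df dg : C) :
  is_deriveC t f df -> is_deriveC t g dg ->
  is_deriveC t (fun s => f s * g s) (df * g t + f t * dg).
Proof.
move=> [f1 f2] [g1 g2]; split.
  have -> : (fun s => complex.Re (f s * g s)) =
    (fun s => complex.Re (f s) * complex.Re (g s) - complex.Im (f s) * complex.Im (g s)).
    by apply/funext => s; exact: cReM.
  apply: (is_derive_eq (is_deriveB (is_deriveM f1 g1) (is_deriveM f2 g2))).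
  rewrite cReD !cReM /GRing.scale /=; ring.
have -> : (fun s => complex.Im (f s * g s)) =
  (fun s => complex.Re (f s) * complex.Im (g s) + complex.Im (f s) * complex.Re (g s)).
  by apply/funext => s; exact: cImM.
apply: (is_derive_eq (is_deriveD (is_deriveM f1 g2) (is_deriveM f2 g1))).
rewrite cImD !cImM /GRing.scale /=; ring.
Qed.

Lemma is_deriveC_conj t (f : R -> C) (d : C) : is_deriveC t f d ->
  is_deriveC t (fun s => (conj (f s))) (conj d).
Proof.
have E (z : C) : complex.Re (conj z) = complex.Re z /\ complex.Im (conj z) = - complex.Im z.
  by case: z.
move=> [f1 f2]; split; rewrite ?(E d).1 ?(E d).2.
  by have -> : (fun s => complex.Re (conj (f s))) = (fun s => complex.Re (f s))
    by apply/funext => s; exact: (E _).1.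
have -> : (fun s => complex.Im (conj (f s))) = (fun s => - complex.Im (f s)).
  by apply/funext => s; exact: (E _).2.
exact: (is_deriveN f2).
Qed.

Lemma is_deriveCX t (f : R -> C) (a : C) m : is_deriveC t f (a * f t) ->
  is_deriveC t (fun s => f s ^+ m) (m%:R * a * f t ^+ m).
Proof.
move=> df; elim: m => [|m IH].
  by rewrite !mul0r; exact: is_deriveC_cst.
under eq_fun do rewrite exprS.
suff -> : m.+1%:R * a * f t ^+ m.+1 =
    a * f t * f t ^+ m + f t * (m%:R * a * f t ^+ m) by exact: is_deriveCM.
by rewrite -natr1 exprS; ring.
Qed.

Definition phase (s : R) : C := cos s +i* sin s.

Lemma is_deriveC_phase s : is_deriveC s phase ('i * phase s).
Proof.
split.
  rewrite cReM /= mul0r sub0r mul1r; exact: is_derive_cos.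
rewrite cImM /= mul0r add0r mul1r; exact: is_derive_sin.
Qed.

Lemma phase_conj s : phase s * (conj (phase s)) = 1.
Proof.
apply: complex_ext; rewrite ?cReM ?cImM /=; last by ring.
by rewrite mulrN opprK -!expr2 cos2Dsin2.
Qed.

Lemma is_deriveC_unique t (f : R -> C) (d d' : C) :
  is_deriveC t f d -> is_deriveC t f d' -> d = d'.
Proof.
move=> [f1 f2] [g1 g2]; apply: complex_ext.
  by rewrite -(@derive_val _ _ _ _ _ _ _ f1) (@derive_val _ _ _ _ _ _ _ g1).
by rewrite -(@derive_val _ _ _ _ _ _ _ f2) (@derive_val _ _ _ _ _ _ _ g2).
Qed.

End ComplexDerivative.

Section Integrand.
Variables (R : realType) (mu : int).
Local Notation C := R[i].
Local Notation conj z := (Num.conj (z : C)).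
Local Notation S2 := (S2 R).
Local Notation S3 := (S3 R).
Local Notation R3 := 'rV[R]_3.
Local Notation n := `|mu|%N.
Local Notation W := (@monomial_section R mu).
Local Notation e := (projector W).
Local Notation de := (d_mx e).

(** A lift of the spherical coordinates to S^3 with alpha real. *)
Definition chart_lift (t p : R) : S3 :=
  S3_of (cos (t / 2)) 0 (sin (t / 2) * cos p) (sin (t / 2) * sin p).

Lemma chart_lift_sphere (t p : R) :
  cos (t / 2) ^+ 2 + 0 ^+ 2 + (sin (t / 2) * cos p) ^+ 2 + (sin (t / 2) * sin p) ^+ 2 = 1.
Proof.
rewrite expr0n addr0 !exprMn -addrA -mulrDr cos2Dsin2 mulr1.
exact: cos2Dsin2.
Qed.

Lemma cos_half (t : R) : cos t = cos (t / 2) ^+ 2 - sin (t / 2) ^+ 2.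
Proof.
rewrite {1}(_ : t = t / 2 + t / 2); last by field.
by rewrite cosD -!expr2.
Qed.

Lemma sin_half (t : R) : sin t = 2 * (cos (t / 2) * sin (t / 2)).
Proof.
rewrite {1}(_ : t = t / 2 + t / 2); last by field.
by rewrite sinD; ring.
Qed.

Lemma hopf_chart_lift t p : hopf (chart_lift t p) = chart t p.
Proof.
apply: hopf_S3_of; first exact: chart_lift_sphere.
- by rewrite /= mxE /= sin_half; ring.
- by rewrite /= mxE /= sin_half; ring.
- rewrite /= mxE /= cos_half.
  transitivity (cos (t / 2) ^+ 2 - sin (t / 2) ^+ 2 * (cos p ^+ 2 + sin p ^+ 2)).
    by rewrite cos2Dsin2 mulr1.
  ring.
Qed.

(** On the lift the section W_k is a real function of t times the k-th power of
    a phase that depends on p only. *)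
Definition lift_modulus (k : nat) (t : R) : R :=
  Num.sqrt 'C(n, k)%:R * (cos (t / 2) ^+ (n - k) * sin (t / 2) ^+ k).

Definition fibre_phase (s : R) : C := if mu <= 0 then phase s else (conj (phase s)).

(** The logarithmic derivative of [fibre_phase]. *)
Definition phase_rate : C := if mu <= 0 then 'i else - 'i.

Lemma conjI : (conj ('i : C)) = - 'i.
Proof. by apply: complex_ext => //=; rewrite oppr0. Qed.

Lemma is_deriveC_fibre_phase s :
  is_deriveC s fibre_phase (phase_rate * fibre_phase s).
Proof.
rewrite /phase_rate /fibre_phase; case: ifP => _.
  exact: is_deriveC_phase.
have -> : - 'i * (conj (phase s)) = (conj ('i * phase s)).
  by apply: esym; apply: etrans (rmorphM Num.conj _ _) _; congr (_ * _); exact: conjI.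
exact: is_deriveC_conj (is_deriveC_phase s).
Qed.

Lemma fibre_phase_norm s : fibre_phase s * (conj (fibre_phase s)) = 1.
Proof.
rewrite /fibre_phase; case: ifP => _; first exact: phase_conj.
by rewrite conjCK mulrC phase_conj.
Qed.

Lemma phase_rate_conj : (conj phase_rate) = - phase_rate.
Proof.
by rewrite /phase_rate; case: ifP => _; apply: complex_ext; rewrite /= ?oppr0.
Qed.

Lemma monomial_chart_lift (k : 'I_n.+1) t p :
  W k (chart_lift t p) = (lift_modulus k t)%:C * fibre_phase p ^+ k.
Proof.
have hv := val_S3_of (chart_lift_sphere t p).
have Ea : alpha (chart_lift t p) = (cos (t / 2))%:C by rewrite /alpha hv.
have Eg : gamma (chart_lift t p) = (sin (t / 2))%:C * phase p.
  rewrite /gamma hv; apply: complex_ext; rewrite ?cReM ?cImM /=; ring.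
have Ec : (conj (gamma (chart_lift t p))) = (sin (t / 2))%:C * (conj (phase p)).
  rewrite Eg; apply: complex_ext; rewrite ?cReM ?cImM /=; ring.
have Eac : (conj (alpha (chart_lift t p))) = (cos (t / 2))%:C by rewrite Ea; exact: conjc_real.
have main (z : C) : (cos (t / 2))%:C ^+ (n - k) * ((sin (t / 2))%:C * z) ^+ k =
    (cos (t / 2) ^+ (n - k) * sin (t / 2) ^+ k)%:C * z ^+ k.
  by rewrite rmorphM !rmorphXn /= exprMn mulrA.
rewrite /monomial_section mxE /fibre_phase /lift_modulus.
case: ifP => _.
  rewrite Ea Eg main mulrA; congr (_ * _).
  by rewrite -rmorphM.
rewrite Eac Ec main mulrA; congr (_ * _).
by rewrite -rmorphM.
Qed.

Let Wsec := @monomial_section_section R mu.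
Let Wnorm := @monomial_section_norm R mu.

Lemma projector_chart (k l : 'I_n.+1) t p : e (chart t p) k l =
  (lift_modulus k t * lift_modulus l t)%:C * (fibre_phase p ^+ k * (conj (fibre_phase p)) ^+ l).
Proof.
rewrite -hopf_chart_lift mxE (section_pairE _ (Wsec l) (Wsec k)) !monomial_chart_lift.
have -> : (conj ((lift_modulus l t)%:C * fibre_phase p ^+ l)) =
    (lift_modulus l t)%:C * (conj (fibre_phase p)) ^+ l.
  apply: etrans (rmorphM Num.conj _ _) _; congr (_ * _); first exact: conjc_real.
  exact: (rmorphXn Num.conj).
have -> : (lift_modulus k t * lift_modulus l t)%:C =
  (lift_modulus k t)%:C * (lift_modulus l t)%:C :> C by rewrite rmorphM.
have alg (a b c d : C) : a * b * (c * d) = c * a * (d * b) by ring.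
exact: alg.
Qed.

Lemma dS2_curve (f : S2 -> C) (c : R -> S2) (t : R) u : smooth_S2 f ->
  is_derive t (1 : R) (fun s => val (c s)) u ->
  is_deriveC t (fun s => f (c s)) (d_S2 f (c t) u).
Proof.
move=> [f1 f2] dc; split.
  exact: (is_derive_smooth_curve f1 dc).
exact: (is_derive_smooth_curve f2 dc).
Qed.

Lemma d_projector_p (k l : 'I_n.+1) t p :
  d_S2 (fun x => e x k l) (chart t p) (chart_p t p) =
  phase_rate * (k%:R * e (chart t p) k l - e (chart t p) k l * l%:R).
Proof.
have D := dS2_curve (c := chart t) (smooth_projector Wsec k l) (is_derive_chart_p t p).
apply: (is_deriveC_unique D).
have -> : (fun s => e (chart t s) k l) = fun s =>
  (lift_modulus k t * lift_modulus l t)%:C * (fibre_phase s ^+ k * (conj (fibre_phase s)) ^+ l).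
  by apply/funext => s; exact: projector_chart.
rewrite projector_chart.
have dz := is_deriveC_fibre_phase p.
have dzc : is_deriveC p (fun s => (conj (fibre_phase s))) (- phase_rate * (conj (fibre_phase p))).
  have -> : - phase_rate * (conj (fibre_phase p)) = (conj (phase_rate * fibre_phase p)).
    apply: esym; apply: etrans (rmorphM Num.conj _ _) _.
    by congr (_ * _); exact: phase_rate_conj.
  exact: is_deriveC_conj.
have D2 := is_deriveCM (is_deriveC_cst p (lift_modulus k t * lift_modulus l t)%:C)
  (is_deriveCM (is_deriveCX k dz) (is_deriveCX l dzc)).
move: D2; congr is_deriveC.
have alg (a b c r x y : C) : 0 * (b * c) + a * (x * r * b * c + b * (y * - r * c)) =
  r * (x * (a * (b * c)) - a * (b * c) * y) by ring.
exact: alg.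
Qed.

(** The generator of the rotations of S^2 about the axis, acting on the
    monomials. *)
Definition grading : 'M[C]_n.+1 := diag_mx (\row_(k < n.+1) k%:R).

Lemma d_projector_p_mx t p : de (chart t p) (chart_p t p) =
  phase_rate *: (grading *m e (chart t p) - e (chart t p) *m grading).
Proof.
apply/matrixP => k l; rewrite mxE d_projector_p /grading mul_diag_mx mul_mx_diag.
by rewrite !mxE.
Qed.

(** By cyclicity of the trace the left-hand side is
    tr (D [e, [e, e']]), and [e, [e, e']] = e' for a derivation of an
    idempotent. *)
Lemma trace_commutator m (D ex et : 'M[C]_m) : ex *m ex = ex ->
  et = et *m ex + ex *m et -> ex *m et *m ex = 0 ->
  \tr (ex *m (et *m (D *m ex - ex *m D) - (D *m ex - ex *m D) *m et)) = \tr (D *m et).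
Proof.
move=> ee de1 ede.
rewrite mulmxBr [et *m _]mulmxBr [_ *m et]mulmxBl !mulmxBr !mulmxA ede mul0mx subr0 ee.
rewrite linearB /= [X in _ - X]linearB /=.
have -> : \tr (ex *m et *m D *m ex) = \tr (D *m (ex *m et)).
  by rewrite mxtrace_mulC !mulmxA ee mxtrace_mulC mulmxA.
have -> : \tr (ex *m D *m ex *m et) = 0.
  by rewrite -mulmxA mxtrace_mulC !mulmxA ede mul0mx mxtrace0.
have -> : \tr (ex *m D *m et) = \tr (D *m (et *m ex)).
  by rewrite -mulmxA mxtrace_mulC mulmxA.
by rewrite sub0r opprK -mxtraceD -mulmxDr addrC -de1.
Qed.

Lemma tr_e_de_de_chart t p :
  chart_pullback (tr_e_de_de e) t p =
  phase_rate * \tr (grading *m de (chart t p) (chart_t t p)).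
Proof.
rewrite chart_pullbackE /tr_e_de_de d_projector_p_mx.
rewrite -scalemxAr -scalemxAl -scalerBr -scalemxAr mxtraceZ; congr (_ * _).
apply: trace_commutator.
- exact: (projector_idem Wsec Wnorm).
- exact: (d_projector Wsec Wnorm).
- exact: (projector_d_projector Wsec Wnorm).
Qed.

(** Absorb k into the binomial coefficient: k C(m, k) = m C(m - 1, k - 1). *)
Lemma binomial_mean m (x y : R) : x + y = 1 ->
  \sum_(k < m.+1) k%:R * ('C(m, k)%:R * (x ^+ (m - k) * y ^+ k)) = m%:R * y.
Proof.
move=> xy; case: m => [|m].
  by rewrite big_ord_recl big_ord0 !mul0r addr0.
rewrite big_ord_recl mul0r add0r.
transitivity (m.+1%:R * y * (x + y) ^+ m); last by rewrite xy expr1n mulr1.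
rewrite exprDn mulr_sumr; apply: eq_bigr => k _.
have b : k.+1%:R * 'C(m.+1, k.+1)%:R = m.+1%:R * 'C(m, k)%:R :> R.
  by rewrite -!natrM mul_bin_diag.
rewrite lift0 subSS mulrA b -(mulr_natr (x ^+ (m - k) * y ^+ k)) exprS.
by move: (m.+1%:R : R) ('C(m, k)%:R : R) (x ^+ _) (y ^+ _) => c d z w; ring.
Qed.

(** The diagonal of E is the binomial distribution with parameters n and
    sin^2 (t / 2). *)
Lemma grading_moment t p :
  \sum_(k < n.+1) k%:R * e (chart t p) k k = (n%:R * sin (t / 2) ^+ 2)%:C.
Proof.
have cs : cos (t / 2) ^+ 2 + sin (t / 2) ^+ 2 = 1 by rewrite cos2Dsin2.
rewrite -(binomial_mean n cs) rmorph_sum /=; apply: eq_bigr => k _.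
rewrite projector_chart -exprMn fibre_phase_norm expr1n mulr1.
rewrite [RHS]rmorphM /=; congr (_ * _); first by apply: esym; exact: rmorph_nat.
congr (_%:C).
rewrite /lift_modulus mulrACA -expr2 sqr_sqrtr ?ler0n //.
by rewrite mulrACA -!exprD -!exprM !mul2n -!addnn.
Qed.

(** n sin^2 (t / 2) = n (1 - cos t) / 2. *)
Lemma tr_grading t p :
  \tr (grading *m de (chart t p) (chart_t t p)) = (n%:R / 2 * sin t)%:C.
Proof.
have sk (k : 'I_n.+1) : smooth_S2 (fun x => k%:R * e x k k).
  by apply: smooth_subCM; [exact: smooth_subC_cst|exact: (smooth_projector Wsec)].
have -> : \tr (grading *m de (chart t p) (chart_t t p)) =
    d_S2 (fun x => \sum_(k < n.+1) k%:R * e x k k) (chart t p) (chart_t t p).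
  rewrite dS2_sum // /mxtrace; apply: eq_bigr => k _.
  have sc : smooth_S2 (fun _ : S2 => k%:R : C) by exact: smooth_subC_cst.
  rewrite (dS2M _ _ sc (smooth_projector Wsec k k)) dS2_cst mul0r add0r.
  by rewrite /grading mul_diag_mx !mxE.
have D := dS2_curve (c := fun s => chart s p)
  (smooth_subC_sum (index_enum 'I_n.+1) sk) (is_derive_chart_t t p).
apply: (is_deriveC_unique D).
have -> : (fun s => \sum_(k < n.+1) k%:R * e (chart s p) k k) =
    (fun s => (n%:R / 2 * (1 - cos s))%:C).
  apply/funext => s; rewrite grading_moment; congr (_%:C).
  have := cos2Dsin2 (s / 2); rewrite (cos_half s); move=> h.
  by rewrite -[X in X - _]h; field.
split; last exact: is_derive_cst.
have d := is_deriveB (is_derive_cst (1 : R) t 1) (is_derive_cos t).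
have := is_deriveM (is_derive_cst (n%:R / 2 : R) t 1) d.
move=> h; apply: (is_derive_eq h).
rewrite /GRing.scale /= mulr0 addr0; ring.
Qed.

Lemma phase_rateE : phase_rate * n%:R = - mu%:~R * 'i.
Proof.
rewrite /phase_rate; case: ifP => mu0.
  by rewrite -rmorphN -(lez0_abs mu0) mulrC.
have mupos : 0 < mu by rewrite ltNge mu0.
by rewrite -{2}(gtz0_abs mupos) mulNr mulrC mulNr.
Qed.

Lemma tr_e_de_de_pullback t p : chart_pullback (tr_e_de_de e) t p =
  - mu%:~R * 'i / 2 * (sin t)%:C.
Proof.
rewrite tr_e_de_de_chart tr_grading -phase_rateE.
rewrite rmorphM /= -[(n%:R / 2)%:C]/((n%:R / 2 : R)%:C).
have -> : (n%:R / 2 : R)%:C = n%:R / 2 by rewrite rmorphM /= fmorphV !rmorph_nat.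
by rewrite !mulrA.
Qed.

End Integrand.

(** * The pairing with the fundamental class *)

Section Pairing.
Variables (R : realType).
Local Notation C := R[i].
Local Notation S2 := (S2 R).
Local Notation R3 := 'rV[R]_3.

Lemma continuous2CM (f g : R -> R -> C) : continuous2C f -> continuous2C g ->
  continuous2C (fun t p => f t p * g t p).
Proof.
move=> [f1 f2] [g1 g2]; split.
  have -> : (fun t p => complex.Re (f t p * g t p)) = fun t p =>
      complex.Re (f t p) * complex.Re (g t p) + - (complex.Im (f t p) * complex.Im (g t p)).
    by apply/funext => t; apply/funext => p; exact: cReM.
  by apply: continuous2D; [|apply: continuous2N]; exact: continuous2M.
have -> : (fun t p => complex.Im (f t p * g t p)) = fun t p =>
    complex.Re (f t p) * complex.Im (g t p) + complex.Im (f t p) * complex.Re (g t p).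
  by apply/funext => t; apply/funext => p; exact: cImM.
by apply: continuous2D; exact: continuous2M.
Qed.

Lemma continuous2CB (f g : R -> R -> C) : continuous2C f -> continuous2C g ->
  continuous2C (fun t p => f t p - g t p).
Proof.
move=> [f1 f2] [g1 g2]; split.
  have -> : (fun t p => complex.Re (f t p - g t p)) = fun t p =>
      complex.Re (f t p) + - complex.Re (g t p).
    by apply/funext => t; apply/funext => p; rewrite cReD cReN.
  by apply: continuous2D => //; exact: continuous2N.
have -> : (fun t p => complex.Im (f t p - g t p)) = fun t p =>
    complex.Im (f t p) + - complex.Im (g t p).
  by apply/funext => t; apply/funext => p; rewrite cImD cImN.
by apply: continuous2D => //; exact: continuous2N.
Qed.

Lemma continuous2C_smooth (f : S2 -> C) : smooth_S2 f ->
  continuous2C (fun t p => f (chart t p)).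
Proof.
by move=> [f1 f2]; split; [exact: (continuous2_smooth f1)|exact: (continuous2_smooth f2)].
Qed.

Lemma continuous2C_dS2 (f : S2 -> C) (u : R -> R -> R3) : smooth_S2 f ->
  (forall i, continuous2 (fun t p => u t p 0 i)) ->
  continuous2C (fun t p => d_S2 f (chart t p) (u t p)).
Proof.
by move=> [f1 f2] cu; split; [exact: (continuous2_dR f1 cu)|exact: (continuous2_dR f2 cu)].
Qed.

Lemma continuous_pullback_wedge (f0 f1 f2 : S2 -> C) :
  smooth_S2 f0 -> smooth_S2 f1 -> smooth_S2 f2 ->
  continuous_pullback (fun x u v => f0 x * wedge (d_S2 f1) (d_S2 f2) x u v).
Proof.
move=> s0 s1 s2; pose g t p := f0 (chart t p) *
  (d_S2 f1 (chart t p) (chart_t t p) * d_S2 f2 (chart t p) (chart_p t p) -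
   d_S2 f1 (chart t p) (chart_p t p) * d_S2 f2 (chart t p) (chart_t t p)).
have ct := @continuous2_chart_t R; have cp := @continuous2_chart_p R.
have cg : continuous2C g.
  apply: continuous2CM; first exact: continuous2C_smooth.
  by apply: continuous2CB; apply: continuous2CM; exact: continuous2C_dS2.
have E : chart_pullback (fun x u v => f0 x * wedge (d_S2 f1) (d_S2 f2) x u v) = g.
  by apply/funext => t; apply/funext => p; rewrite chart_pullbackE.
by rewrite /continuous_pullback E.
Qed.

Lemma commutator_entry n (A B : 'M[C]_n) i j :
  (A *m B - B *m A) i j = \sum_k (A i k * B k j - B i k * A k j).
Proof. by rewrite !mxE -sumrB. Qed.

(** The triple sum of entries is the trace of the product of matrices; the
    integral is additive because every summand is continuous in the chart. *)
Lemma pairing_int n (e : S2 -> 'M[C]_n) : (forall i j, smooth_S2 (fun x => e x i j)) ->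
  pairing e (@phi_S2 R) = (two_pi_i R)^-1 * int_S2 (tr_e_de_de e).
Proof.
move=> se.
pose w i j k : form2 R := fun x u v =>
  e x i j * wedge (d_S2 (fun y => e y j k)) (d_S2 (fun y => e y k i)) x u v.
have cw i j k : continuous_pullback (w i j k) by exact: continuous_pullback_wedge.
have W3 i j := int_S2_sum (index_enum 'I_n) (cw i j).
have W2 i := int_S2_sum (index_enum 'I_n) (fun j => (W3 i j).1).
have W1 := int_S2_sum (index_enum 'I_n) (fun i => (W2 i).1).
have -> : tr_e_de_de e = fun x u v => \sum_i \sum_j \sum_k w i j k x u v.
  apply/funext => x; apply/funext => u; apply/funext => v.
  rewrite /tr_e_de_de /mxtrace; apply: eq_bigr => i _.
  rewrite mxE; apply: eq_bigr => j _.
  rewrite commutator_entry mulr_sumr; apply: eq_bigr => k _.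
  have E a b z : d_mx e x z a b = d_S2 (fun y => e y a b) x z by rewrite mxE.
  have congr4 (z a a' b b' c c' d d' : C) : a = a' -> b = b' -> c = c' -> d = d' ->
      z * (a * b - c * d) = z * (a' * b' - c' * d') by move=> -> -> -> ->.
  exact: congr4 (E j k u) (E k i v) (E j k v) (E k i u).
apply: etrans _ (congr1 ( *%R (two_pi_i R)^-1) (esym W1.2)).
rewrite mulr_sumr; apply: eq_bigr => i _; rewrite (W2 i).2.
rewrite mulr_sumr; apply: eq_bigr => j _; rewrite (W3 i j).2.
by rewrite mulr_sumr.
Qed.

End Pairing.

Theorem theorem3p16 (R : realType) (mu : int) :
  [/\ pairing (@E R mu) (@phi_S2 R)
        = (two_pi_i R)^-1 * int_S2 (tr_e_de_de (@E R mu)),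
      (exists omega, @c1 R mu omega),
      (forall omega, @c1 R mu omega ->
         (two_pi_i R)^-1 * int_S2 (tr_e_de_de (@E R mu)) = int_S2 omega
         /\ int_S2 omega = (- mu)%:~R) &
      pairing (@E R mu) (@phi_S2 R) = (- mu)%:~R].
Proof.
have Wsec := @monomial_section_section R mu.
have Wnorm := @monomial_section_norm R mu.
rewrite !E_projector; set e := projector _.
set c := (two_pi_i R)^-1.
have P1 : pairing e (@phi_S2 R) = c * int_S2 (tr_e_de_de e).
  by apply: pairing_int => i j; exact: smooth_projector.
have [_ I1] := int_S2_sin (@tr_e_de_de_pullback R mu).
have cK : c * (- mu%:~R * 'i / 2) * (4 * pi)%:C = (- mu)%:~R.
  have pi0 : (pi : R)%:C != 0.
    by apply/eqP => /(congr1 (@complex.Re R)) /= /eqP; rewrite gt_eqF // pi_gt0.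
  have i0 : ('i : R[i]) != 0.
    by apply/eqP => /(congr1 (@complex.Im R)) /= /eqP; rewrite oner_eq0.
  have -> : (4 * pi)%:C = 4 * (pi : R)%:C.
    by rewrite rmorphM /=; congr (_ * _); exact: rmorph_nat.
  have alg (m z q : R[i]) : z != 0 -> q != 0 ->
      (2 * q * z)^-1 * (- m * z / 2) * (4 * q) = - m.
    by move=> z0 q0; field; rewrite z0 q0.
  by rewrite mulrNz; exact: alg.
have IT : c * int_S2 (tr_e_de_de e) = (- mu)%:~R by rewrite I1 mulrA.
split=> //; last by rewrite P1.
  exact: (c1_nonempty Wsec Wnorm).
move=> omega /(c1_representative Wsec Wnorm) [h [sh Eomega]].
suff -> : int_S2 omega = (- mu)%:~R by [].
have [ce Ie] := stokes_S2 sh.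
have [ct It] : continuous_pullback (fun x u v => c * tr_e_de_de e x u v) /\
    int_S2 (fun x u v => c * tr_e_de_de e x u v) =
    c * (- mu%:~R * 'i / 2) * (4 * pi)%:C.
  apply: int_S2_sin => t p; rewrite chart_pullbackE.
  by have := @tr_e_de_de_pullback R mu t p; rewrite chart_pullbackE => ->; rewrite mulrA.
rewrite (@int_S2_eq _ _ (fun x u v => c * tr_e_de_de e x u v + exterior h x u v)).
  by rewrite int_S2D // It Ie addr0.
move=> t p; rewrite !chart_pullbackE Eomega //.
- exact: chart_t_tangent.
- exact: chart_p_tangent.
Qed.
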